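(* Let $\tau\in\mathbb C$ with $t=\mathrm{Im}\,\tau>0$, let $K\in\mathrm{Mat}_{g\times g}(\mathbb Z)$ be symmetric and positive definite, $\delta=\det K$, $\Omega=\tau K$, $\Pi=K^{-1}\mathbb Z^g/\mathbb Z^g$, and $\vec\xi\in\mathbb C^g$. Let $\mathsf W_{K,\vec\xi}$ be the hermitian space, $G_K$ the finite Heisenberg group, $\upsilon$ the pairing, and $S_{\vec a},R_{\vec b}$ the operators defined in the context. Then: (i) The group $G_K$ acts on $\mathsf W_{K,\vec\xi}$ by unitary operators via $$G_K\ni\bigl(([\vec a],[\vec b]),\gamma\bigr)\mapsto\gamma\,R_{\vec b}\cdot S_{\vec a},$$ and this representation is irreducible. (ii) The dimension of $\mathsf W_{K,\vec\xi}$ is $\delta$, and it has a distinguished basis $(H_{\vec c})_{\vec c\in\Pi}$, where $H_{\vec c}(\vec z)=\Theta[\vec c,\vec 0](K\vec z+\vec\xi\,|\,\Omega)$. (iii) For any $\vec a,\vec b,\vec c\in\Pi$: $S_{\vec a}(H_{\vec c})=\upsilon(\vec a,\vec c)H_{\vec c}$ and $R_{\vec b}(H_{\vec c})=H_{\vec c+\vec b}$. (iv) For any $\vec c_1\ne\vec c_2$ in $\Pi$: $\langle H_{\vec c_1},H_{\vec c_2}\rangle=0$ and $\langle H_{\vec c_1},H_{\vec c_1}\rangle=\langle H_{\vec c_2},H_{\vec c_2}\rangle$.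
   Context: $(\cdot,\cdot)$ is the standard bilinear pairing $(\vec x,\vec y)=\vec x^t\vec y$. Write $\vec\xi=\tau\vec a_0+\vec b_0$ with $\vec a_0,\vec b_0\in\mathbb R^g$. Pairing: $\Gamma_\delta=\langle\exp(2\pi i/\delta)\rangle\subset\mathbb C^*$ and $\upsilon:\Pi\times\Pi\to\Gamma_\delta$, $\upsilon([\vec a],[\vec b])=\exp(2\pi i\,\vec a^tK\vec b)$. Heisenberg group $G_K$: the set $(\Pi\times\Pi)\times\Gamma_\delta$ with product $\bigl((\vec a_1,\vec b_1),\gamma_1\bigr)\cdot\bigl((\vec a_2,\vec b_2),\gamma_2\bigr)=\bigl((\vec a_1+\vec a_2,\vec b_1+\vec b_2),\upsilon(\vec a_1,\vec b_2)\gamma_1\gamma_2\bigr)$. For $\vec l\in\mathbb R^g$ put $U_{\vec l}(\vec z,\vec\xi)=\exp\bigl(-\pi i(\vec l,2\vec\xi+2K\vec z+\Omega\vec l)\bigr)$. $\mathsf W_{K,\vec\xi}$ is the space of holomorphic functions $H:\mathbb C^g\to\mathbb C$ with $H(\vec z+\vec l)=H(\vec z)$ and $H(\vec z+\tau\vec l)=U_{\vec l}(\vec z,\vec\xi)H(\vec z)$ for all $\vec l\in\mathbb Z^g$. It carries the hermitian scalar product $$\langle\Phi_1,\Phi_2\rangle=\int_{[0,1]^{2g}}\exp\bigl(-2\pi t(\vec y,K\vec y+2\vec a_0)\bigr)\Phi_1\overline{\Phi_2}\,d\vec x\,d\vec y,\qquad\vec z=\vec x+\tau\vec y,\ \vec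 x,\vec y\in\mathbb R^g.$$ Operators: $(S_{\vec a}\Phi)(\vec z)=\Phi(\vec z+\vec a)$, $(R_{\vec b}\Phi)(\vec z)=U_{\vec b}(\vec z,\vec\xi)^{-1}\Phi(\vec z+\tau\vec b)$. For $\vec a,\vec b\in K^{-1}\mathbb Z^g$ these act on $\mathsf W_{K,\vec\xi}$ and depend only on the classes of $\vec a,\vec b$ in $\Pi$; an element of $K^{-1}\mathbb Z^g$ and its class in $\Pi$ are identified in the notation. Theta function: $\Theta[\vec a,\vec b](\vec z|\Omega)=\sum_{\vec k\in\mathbb Z^g}\exp\bigl(\pi i(\vec k+\vec a)^t\Omega(\vec k+\vec a)+2\pi i(\vec k+\vec a)^t(\vec z+\vec b)\bigr)$ for $\vec a,\vec b\in\mathbb R^g$; $\Theta[\vec c,\vec 0]$ depends only on $\vec c$ modulo $\mathbb Z^g$. *)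

(* Defs.v *)
(* Everything is over an arbitrary R : realType; the complex numbers are
   R[i].  Functions C^g -> C are written 'cV[R[i]]_g -> R[i]^o, the exponent o
   selecting the structure of R[i] as a normed module over itself. *)
From HB Require Import structures.
From mathcomp Require Import all_boot all_order all_algebra complex.
From mathcomp Require Import all_classical all_reals all_analysis.
From mathcomp Require Import showcase.summability ring.

Set Implicit Arguments.
Unset Strict Implicit.
Unset Printing Implicit Defensive.

Import Order.TTheory GRing.Theory Num.Theory numFieldNormedType.Exports.

Local Open Scope quotient_scope.
Local Open Scope complex_scope.
Local Open Scope ring_scope.

Definition pairing (A : comNzRingType) (g : nat) (x y : 'cV[A]_g) : A :=
  (x^T *m y) 0 0.

Notation "K %:mx[ A ]" := (map_mx (intr : int -> A) K)
  (at level 2, format "K %:mx[ A ]").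

Notation "x %:mxC" := (map_mx (real_complex _) x) (at level 2, format "x %:mxC").

Section Cexp.
Variable R : realType.

Definition cexp (z : R[i]) : R[i] :=
  (expR (complex.Re z) * cos (complex.Im z)) +i*
  (expR (complex.Re z) * sin (complex.Im z)).

Definition piC : R[i] := (pi : R)%:C.

Lemma cexpD (z w : R[i]) : cexp (z + w) = cexp z * cexp w.
Proof.
case: z => a b; case: w => c d.
rewrite /cexp /= expRD cosD sinD; apply/eqP; rewrite eq_complex /=.
by apply/andP; split; apply/eqP; ring.
Qed.

Lemma cexp0 : cexp 0 = 1.
Proof. by rewrite /cexp /= expR0 cos0 sin0 mulr0 mulr1. Qed.

Lemma cexpMn (z : R[i]) (n : nat) : cexp (z *+ n) = cexp z ^+ n.
Proof.
by elim: n => [|n IHn]; rewrite ?mulr0n ?cexp0 // mulrS cexpD IHn exprS.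
Qed.

Lemma cexp_neq0 (z : R[i]) : cexp z != 0.
Proof.
apply/eqP => z0; have : cexp (z - z) = 1 by rewrite subrr cexp0.
by rewrite cexpD z0 mul0r => /eqP; rewrite eq_sym oner_eq0.
Qed.

Lemma cexpN (z : R[i]) : cexp (- z) = (cexp z)^-1.
Proof.
by apply: (mulIf (cexp_neq0 z)); rewrite -cexpD addNr cexp0 mulVf ?cexp_neq0.
Qed.

Lemma cexpMz (z : R[i]) (n : int) : cexp (z *~ n) = cexp z ^ n.
Proof.
by case: n => n; rewrite ?cexpMn // NegzE mulrNz cexpN cexpMn exprnN.
Qed.

Lemma cexp_2pi : cexp (2%:R * 'i%C * piC) = 1.
Proof.
have -> : 2%:R * 'i%C * piC = 0 +i* (pi *+ 2).
  apply/eqP; rewrite eq_complex /= !(mul0r, mulr0, mulr1, add0r, addr0, subr0).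
  by apply/andP; split; apply/eqP; ring.
by rewrite /cexp /= expR0 cos2pi sin2pi mulr0 mulr1.
Qed.

End Cexp.

Section Lattice.
Variables (R : realType) (g : nat).

Definition Zlattice : {pred 'cV[R]_g} :=
  fun v => [forall i, v i 0 \is a Num.int].

Lemma ZlatticeP (v : 'cV[R]_g) :
  reflect (exists m : 'cV[int]_g, v = m%:mx[R]) (v \in Zlattice).
Proof.
apply: (iffP forallP) => [vP|[m ->] i]; last by rewrite mxE intr_int.
exists (\col_i Num.floor (v i 0)); apply/colP => i.
by rewrite !mxE floorK.
Qed.

Lemma Zlattice_zmod_closed : zmod_closed Zlattice.
Proof.
split=> [|u v /ZlatticeP[m ->] /ZlatticeP[n ->]]; apply/ZlatticeP.
  by exists 0; rewrite map_mx0.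
by exists (m - n); rewrite map_mxB.
Qed.

HB.instance Definition _ :=
  GRing.isZmodClosed.Build 'cV[R]_g Zlattice Zlattice_zmod_closed.

Variable K : 'M[int]_g.

Definition Klattice : {pred 'cV[R]_g} := fun a => K%:mx[R] *m a \in Zlattice.

Lemma Klattice_zmod_closed : zmod_closed Klattice.
Proof.
split=> [|u v uP vP]; rewrite unfold_in; first by rewrite mulmx0 rpred0.
by rewrite mulmxBr rpredB.
Qed.

HB.instance Definition _ :=
  GRing.isZmodClosed.Build 'cV[R]_g Klattice Klattice_zmod_closed.

(* K^-1 Z^g, as the preimage of Z^g under K. *)
Record klat := Klat { klat_val :> 'cV[R]_g; klatP : klat_val \in Klattice }.

HB.instance Definition _ := [isSub for klat_val].
HB.instance Definition _ := [Choice of klat by <:].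
HB.instance Definition _ := [SubChoice_isSubZmodule of klat by <:].

Definition klat_int : {pred klat} := fun a => (a : 'cV[R]_g) \in Zlattice.

Lemma klat_int_zmod_closed : zmod_closed klat_int.
Proof.
split=> [|u v uP vP]; rewrite unfold_in /=; first by rewrite rpred0.
by rewrite rpredB.
Qed.

HB.instance Definition _ :=
  GRing.isZmodClosed.Build klat klat_int klat_int_zmod_closed.

Definition Pi : zmodType := {ideal_quot klat_int}.

Definition cls (a : klat) : Pi := \pi_({ideal_quot klat_int}) a.

End Lattice.

Arguments Pi : clear implicits.
Arguments Pi R {g} K.
Arguments klat : clear implicits.
Arguments klat R {g} K.

Definition posdefmx (R : realType) (g : nat) (K : 'M[int]_g) : Prop :=
  forall x : 'cV[R]_g, x != 0 -> 0 < pairing x (K%:mx[R] *m x).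
Arguments posdefmx : clear implicits.
Arguments posdefmx R {g} K.

Section Pairing.
Variables (R : realType) (g : nat) (K : 'M[int]_g).

Definition root_unity : R[i] := cexp (2%:R * 'i%C * piC R / (\det K)%:~R).

Definition in_gamma : {pred R[i]} :=
  fun z => `[< exists n : int, z = root_unity ^ n >].

Record gamma := Gamma { gamma_val :> R[i]; gammaP : gamma_val \in in_gamma }.

HB.instance Definition _ := [isSub for gamma_val].
HB.instance Definition _ := [Choice of gamma by <:].

Definition Kform (a b : 'cV[R]_g) : R := pairing a (K%:mx[R] *m b).

(* Defined through representatives, which is legitimate by upsilonE. *)
Definition upsilon (p q : Pi R K) : R[i] :=
  cexp (2%:R * 'i%C * piC R * (Kform (repr p) (repr q))%:C).

Hypothesis symK : K^T = K.

Lemma KformC a b : Kform a b = Kform b a.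
Proof.
rewrite /Kform /pairing -[in LHS](trmxK (a^T *m _)) mxE !trmx_mul trmxK.
by rewrite map_trmx symK mulmxA.
Qed.

Lemma KformDl a b c : Kform (a + b) c = Kform a c + Kform b c.
Proof. by rewrite /Kform /pairing linearD mulmxDl mxE. Qed.

Lemma KformDr a b c : Kform a (b + c) = Kform a b + Kform a c.
Proof. by rewrite KformC KformDl !(KformC _ a). Qed.

Lemma Kform_int (a b : 'cV[R]_g) :
  a \in @Zlattice R g -> b \in @Klattice R g K ->
  exists n : int, Kform a b = n%:~R.
Proof.
move=> /ZlatticeP[m ->]; rewrite unfold_in => /ZlatticeP[n Kb].
by exists (pairing m n); rewrite /Kform Kb /pairing map_trmx -map_mxM mxE.
Qed.

Definition cunit (x : R) : R[i] := cexp (2%:R * 'i%C * piC R * x%:C).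

Lemma cunitD x y : cunit (x + y) = cunit x * cunit y.
Proof. by rewrite /cunit rmorphD mulrDr cexpD. Qed.

Lemma cunit_int (n : int) : cunit n%:~R = 1.
Proof. by rewrite /cunit rmorph_int mulrzr cexpMz cexp_2pi exp1rz. Qed.

Lemma repr_cls (c : klat R K) : exists2 m : klat R K,
  (m : 'cV[R]_g) \in @Zlattice R g & repr (cls c) = c + m.
Proof.
exists (repr (cls c) - c); last by rewrite addrC subrK.
have : repr (cls c) - c \in @klat_int R g K by rewrite Quotient.idealrBE reprK.
by [].
Qed.

Lemma upsilonE (a b : klat R K) :
  upsilon (cls a) (cls b) = cunit (Kform a b).
Proof.
have [m mZ ra] := repr_cls a; have [n nZ rb] := repr_cls b.
rewrite /upsilon -/(cunit _) ra rb /= KformDl !KformDr.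
have [i ->] := Kform_int mZ (klatP b).
have [j ->] := Kform_int mZ (klatP n).
have [k ->] : exists k : int, Kform a n = k%:~R.
  by rewrite KformC; apply: Kform_int (klatP a).
by rewrite !cunitD !cunit_int !mulr1.
Qed.

Lemma clsK (p : Pi R K) : cls (repr p) = p.
Proof. exact: reprK. Qed.

Lemma clsD (a b : klat R K) : cls (a + b) = cls a + cls b.
Proof. by rewrite /cls raddfD. Qed.

Lemma upsilonDl (p q r : Pi R K) :
  upsilon (p + q) r = upsilon p r * upsilon q r.
Proof.
rewrite -[p]clsK -[q]clsK -[r]clsK -clsD !upsilonE.
by rewrite /= KformDl cunitD.
Qed.

Lemma upsilonDr (p q r : Pi R K) :
  upsilon p (q + r) = upsilon p q * upsilon p r.
Proof.
rewrite -[p]clsK -[q]clsK -[r]clsK -clsD !upsilonE.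
by rewrite /= KformDr cunitD.
Qed.

Lemma upsilon0l (q : Pi R K) : upsilon 0 q = 1.
Proof.
have h := upsilonDl 0 0 q; rewrite addr0 in h.
by apply: (mulfI (cexp_neq0 _ : upsilon 0 q != 0)); rewrite mulr1 -h.
Qed.

Lemma upsilon0r (p : Pi R K) : upsilon p 0 = 1.
Proof.
have h := upsilonDr p 0 0; rewrite addr0 in h.
by apply: (mulfI (cexp_neq0 _ : upsilon p 0 != 0)); rewrite mulr1 -h.
Qed.

Lemma upsilonNl (p q : Pi R K) : upsilon (- p) q = (upsilon p q)^-1.
Proof.
apply: (mulIf (cexp_neq0 _ : upsilon p q != 0)).
by rewrite -upsilonDl addNr upsilon0l mulVf ?cexp_neq0.
Qed.

Lemma upsilonNr (p q : Pi R K) : upsilon p (- q) = (upsilon p q)^-1.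
Proof.
apply: (mulIf (cexp_neq0 _ : upsilon p q != 0)).
by rewrite -upsilonDr addNr upsilon0r mulVf ?cexp_neq0.
Qed.

Lemma root_unity_neq0 : root_unity != 0.
Proof. exact: cexp_neq0. Qed.

Lemma in_gamma1 : 1 \in in_gamma.
Proof. by apply/asboolP; exists 0. Qed.

Lemma in_gammaM z w : z \in in_gamma -> w \in in_gamma -> z * w \in in_gamma.
Proof.
move=> /asboolP[m ->] /asboolP[n ->]; apply/asboolP; exists (m + n).
by rewrite expfzDr ?root_unity_neq0.
Qed.

Lemma in_gammaV z : z \in in_gamma -> z^-1 \in in_gamma.
Proof.
by move=> /asboolP[m ->]; apply/asboolP; exists (- m); rewrite -invr_expz.
Qed.

Hypothesis posK : posdefmx R K.

Lemma posdef_det_neq0 : (\det K)%:~R != 0 :> R.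
Proof.
rewrite -det_map_mx; apply/negP => /det0P[v v0 vK].
have /posK : v^T != 0 by rewrite trmx_eq0.
rewrite /pairing trmxK mulmxA.
by rewrite vK mul0mx mxE ltxx.
Qed.

Lemma upsilon_gamma (p q : Pi R K) : upsilon p q \in in_gamma.
Proof.
rewrite -[p]clsK -[q]clsK upsilonE.
move: (repr p) (repr q) => a b; apply/asboolP.
have [n nE] : exists n : int, (\det K)%:~R * Kform a b = n%:~R.
  have /ZlatticeP[m aE] := klatP a; have /ZlatticeP[l bE] := klatP b.
  exists (pairing (\adj K *m m) l).
  rewrite /Kform bE /pairing.
  have -> : (\det K)%:~R * ((a : 'cV_g)^T *m l%:mx[R]) 0 0 =
            (((\det K)%:~R *: (a : 'cV_g))^T *m l%:mx[R]) 0 0.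
    by rewrite linearZ /= -scalemxAl [in RHS]mxE.
  have -> : (\det K)%:~R *: (a : 'cV[R]_g) = (\adj K *m m)%:mx[R].
    rewrite map_mxM -aE mulmxA -map_mxM mul_adj_mx map_scalar_mx.
    by rewrite mul_scalar_mx.
  by rewrite map_trmx -map_mxM mxE.
exists n; rewrite /root_unity -cexpMz /cunit; congr cexp.
have -> : Kform a b = n%:~R / (\det K)%:~R.
  by rewrite -nE mulrAC mulfV ?posdef_det_neq0 // mul1r.
by rewrite fmorph_div !rmorph_int -mulrzr; ring.
Qed.

End Pairing.
Arguments gamma : clear implicits.
Arguments gamma R {g} K.

Section Heisenberg.
Variables (R : realType) (g : nat) (K : 'M[int]_g).
Hypotheses (symK : K^T = K) (posK : posdefmx R K).

Definition heisenberg of K^T = K & posdefmx R K : Type :=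
  ((Pi R K * Pi R K) * gamma R K)%type.

Local Notation G := (heisenberg symK posK).

HB.instance Definition _ := Choice.on G.

Definition heis_mul (x y : G) : G :=
  (x.1.1 + y.1.1, x.1.2 + y.1.2,
   Gamma (in_gammaM (in_gammaM (upsilon_gamma symK posK x.1.1 y.1.2)
                               (gammaP x.2)) (gammaP y.2))).

Definition heis_one : G := (0, 0, Gamma (in_gamma1 R K)).

Definition heis_inv (x : G) : G :=
  (- x.1.1, - x.1.2,
   Gamma (in_gammaM (upsilon_gamma symK posK x.1.1 x.1.2)
                    (in_gammaV (gammaP x.2)))).

Lemma heis_mulA : associative heis_mul.
Proof.
move=> [[a1 b1] c1] [[a2 b2] c2] [[a3 b3] c3]; rewrite /heis_mul /=.
congr ((_, _), _); rewrite ?addrA //; apply/val_inj => /=.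
by rewrite upsilonDl // upsilonDr //; ring.
Qed.

Lemma heis_mul1 : left_id heis_one heis_mul.
Proof.
move=> [[a b] c]; rewrite /heis_mul /=.
congr ((_, _), _); rewrite ?add0r //; apply/val_inj => /=.
by rewrite upsilon0l // !mul1r.
Qed.

Lemma heis_mulr1 : right_id heis_one heis_mul.
Proof.
move=> [[a b] c]; rewrite /heis_mul /=.
congr ((_, _), _); rewrite ?addr0 //; apply/val_inj => /=.
by rewrite upsilon0r // mul1r mulr1.
Qed.

Lemma gamma_neq0 (c : gamma R K) : (c : R[i]) != 0.
Proof.
by case: c => c /= /asboolP[n ->]; rewrite expfz_neq0 ?root_unity_neq0.
Qed.

Lemma heis_mulV : left_inverse heis_one heis_inv heis_mul.
Proof.
move=> [[a b] c]; rewrite /heis_mul /=.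
congr ((_, _), _); rewrite ?addNr //; apply/val_inj => /=.
by rewrite upsilonNl // mulrA mulVf ?cexp_neq0 // mul1r mulVf ?gamma_neq0.
Qed.

Lemma heis_mulrV : right_inverse heis_one heis_inv heis_mul.
Proof.
move=> [[a b] c]; rewrite /heis_mul /=.
congr ((_, _), _); rewrite ?addrN //; apply/val_inj => /=.
by rewrite upsilonNr // mulrACA mulVf ?cexp_neq0 // mul1r mulfV ?gamma_neq0.
Qed.

HB.instance Definition _ := isGroup.Build G
  heis_mulA heis_mul1 heis_mulr1 heis_mulV heis_mulrV.

End Heisenberg.

Section ThetaSpace.
Variables (R : realType) (g : nat).
Local Notation V := 'cV[R[i]]_g.

(* sum is the unordered sum over the index type Z^g, the limit of the finite
   partial sums along the filter of finite subsets. *)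
Definition theta (a b : 'cV[R]_g) (z : V) (Om : 'M[R[i]]_g) : R[i]^o :=
  sum (fun k : 'cV[int]_g =>
    let ka : V := (k%:mx[R] + a)%:mxC in
    cexp (piC R * 'i%C * pairing ka (Om *m ka)
          + 2%:R * piC R * 'i%C * pairing ka (z + b%:mxC)) : R[i]^o).

Variables (tau : R[i]) (K : 'M[int]_g) (xi : V).

Definition Omega : 'M[R[i]]_g := tau *: K%:mx[R[i]].

(* The multiplier U_l(z, xi). *)
Definition mult (l : 'cV[R]_g) (z : V) : R[i] :=
  cexp (- (piC R * 'i%C *
    pairing l%:mxC (2%:R *: xi + 2%:R *: (K%:mx[R[i]] *m z) + Omega *m l%:mxC))).

Definition holomorphic (H : V -> R[i]^o) : Prop :=
  forall z, differentiable H z.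

Definition in_W : {pred V -> R[i]^o} := fun H =>
  `[< [/\ holomorphic H,
          forall l z, l \in @Zlattice R g -> H (z + l%:mxC) = H z
        & forall l z, l \in @Zlattice R g ->
            H (z + tau *: l%:mxC) = mult l z * H z] >].

Lemma in_W_submod_closed : submod_closed in_W.
Proof.
split=> [|c F G /asboolP[hF pF qF] /asboolP[hG pG qG]]; apply/asboolP; split.
- by move=> z; exact: differentiable_cst.
- by [].
- by move=> l z _; rewrite mulr0.
- by move=> z; apply: differentiableD => //; exact: differentiableZ.
- move=> l z lZ; have -> : (c *: F + G) z = c * F z + G z by [].
  by rewrite -(pF l z lZ) -(pG l z lZ).
- move=> l z lZ; have -> : (c *: F + G) z = c * F z + G z by [].
  by rewrite mulrDr mulrCA -(qF l z lZ) -(qG l z lZ).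
Qed.

HB.instance Definition _ :=
  GRing.isSubmodClosed.Build R[i] (V -> R[i]^o) in_W in_W_submod_closed.

Record Wspace := WSpace { Wfun :> V -> R[i]^o; WfunP : Wfun \in in_W }.

HB.instance Definition _ := [isSub for Wfun].
HB.instance Definition _ := [Choice of Wspace by <:].
HB.instance Definition _ := [SubChoice_isSubLmodule of Wspace by <:].

End ThetaSpace.

Section Operators.
Variables (R : realType) (g : nat).
Variables (tau : R[i]) (K : 'M[int]_g) (xi : 'cV[R[i]]_g).
Implicit Types Phi : 'cV[R[i]]_g -> R[i]^o.

Definition Sop (a : 'cV[R]_g) Phi : 'cV[R[i]]_g -> R[i]^o :=
  fun z => Phi (z + a%:mxC).

Definition Rop (b : 'cV[R]_g) Phi : 'cV[R[i]]_g -> R[i]^o :=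
  fun z => (mult tau K xi b z)^-1 * Phi (z + tau *: b%:mxC).

(* Integral over [0,1]^n, as an iterated Lebesgue integral; it is only applied
   to continuous integrands, where Fubini's theorem holds. *)
Fixpoint cube_integral (n : nat) : ('cV[R]_n -> R) -> R :=
  match n with
  | 0 => fun f => f 0
  | m.+1 => fun f =>
      Rintegral lebesgue_measure `[0 : R, 1]%classic
        (fun s => cube_integral
          (fun v : 'cV[R]_m => f (col_mx (const_mx s : 'cV[R]_1) v)))
  end.

Definition cube_integralC (n : nat) (f : 'cV[R]_n -> R[i]) : R[i] :=
  cube_integral (fun v => complex.Re (f v)) +i*
  cube_integral (fun v => complex.Im (f v)).

(* The real coordinates (x, y) of z = x + tau y are the two halves of a vector
   of R^(g + g). *)
Definition herm (a0 : 'cV[R]_g) (Phi1 Phi2 : 'cV[R[i]]_g -> R[i]^o) : R[i] :=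
  cube_integralC (fun v : 'cV[R]_(g + g) =>
    let x := usubmx v in let y := dsubmx v in
    let z := x%:mxC + tau *: y%:mxC in
    (expR (- (2%:R * pi * complex.Im tau *
              pairing y (K%:mx[R] *m y + 2%:R *: a0))))%:C
    * Phi1 z * conjc (Phi2 z)).

End Operators.

Section LinearAlgebra.
Variables (F : fieldType) (V : lmodType F).

Definition is_basis (I : choiceType) (e : I -> V) : Prop :=
  (forall (s : seq I) (c : I -> F), uniq s ->
     \sum_(i <- s) c i *: e i = 0 -> forall i, i \in s -> c i = 0) /\
  (forall v, exists (s : seq I) (c : I -> F), v = \sum_(i <- s) c i *: e i).

Definition has_dim (n : nat) : Prop := exists e : 'I_n -> V, is_basis e.

Variables (G : groupType) (rho : G -> {linear V -> V}).

Definition representation : Prop :=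
  (forall v, rho 1%g v = v) /\
  (forall x y v, rho (x * y)%g v = rho x (rho y v)).

Definition unitary_rep (form : V -> V -> F) : Prop :=
  forall x u v, form (rho x u) (rho x v) = form u v.

Definition irreducible_rep : Prop :=
  (exists v : V, v != 0) /\
  (forall U : set V, U 0 -> (forall c u v, U u -> U v -> U (c *: u + v)) ->
     (forall x u, U u -> U (rho x u)) ->
     U = [set 0]%classic \/ U = [set: V]%classic).

End LinearAlgebra.

(* Main.v *)
(* Let W be the space of the statement.  A function H in W is entire and
   Z^g-periodic, so it has Fourier coefficients
     a_m(H) = integral over [0,1]^g of H(x) e^(2 pi i (m, x)) dx.
   By Goursat's theorem the integral does not change when x is replaced by
   x + v with v in C^g; taking v = tau n and using the quasi-periodicity of H
   shows that a_m(H) is a nonzero multiple of a_(m - K n)(H).  Hence H is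
   determined by the coefficients a_m with m in Z^g / K Z^g, a set in bijection
   with Pi.  The theta series H_c converges with Gaussian speed, lies in W, and
   its coefficients vanish exactly outside the class of - K c, so the H_c form a
   basis; the Smith normal form of K gives |Pi| = det K.

   R_b S_a translates the integrand of the hermitian product, viewed as a
   Z^(2g)-periodic function of (x, y), by (a, b), hence is unitary.  The H_c are
   eigenvectors of the S_a for distinct characters, and the R_b permute them
   transitively, which gives orthogonality, equal norms and irreducibility.

   Holomorphy only means complex differentiability at every point, so no
   continuity of the derivative is available: Goursat's bisection argument is
   run directly on dyadic trapezoidal sums. *)
Require Import Defs.
From HB Require Import structures.
From mathcomp Require Import all_boot all_order all_algebra complex finmap.
From mathcomp Require Import all_classical all_reals all_analysis.
From mathcomp Require Import showcase.summability.
From mathcomp Require Import ring lra zify.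

Set Implicit Arguments.
Unset Strict Implicit.
Unset Printing Implicit Defensive.

Import Order.TTheory GRing.Theory Num.Theory numFieldNormedType.Exports.
Import Normc.
Local Open Scope complex_scope.
Local Open Scope ring_scope.

(** * Complex moduli and bisection *)

Section Modulus.
Variable R : realType.
Implicit Types (z w : R[i]) (x : R).

(** What is needed about the iterated integrals (linearity, comparison, invariance under real
    translations) is proved for averages over the grid of step [1/N] and passes to the limit. The
    limit rests on uniform continuity, and this, like the other compactness arguments here
    (boundedness, Goursat, coercivity of [K]), comes from the single principle [cube_bisection].

    Grid averages also fit Goursat's argument: a trapezoidal sum of a periodic function over one
    period is its grid average, so contour sums directly compare the means over [x] and over
    [x + v]. The contour lies in one complex coordinate, while a real vector [p] translates the
    point; bisecting in [p] together with the contour makes the threshold uniform in [p].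

    No Fourier expansion of a general element of the space is formed: uniqueness of the coefficients
    suffices, after subtracting the finite theta combination with the same coefficients. Estimates
    use the real-valued [normc], because the norm of [R[i]] takes its values in [R[i]]. *)

Lemma normr_normc z : `|z| = (normc z)%:C.
Proof. by []. Qed.

Lemma normc_ge0 z : 0 <= normc z.
Proof. by case: z => a b; exact: sqrtr_ge0. Qed.

Lemma normcD z w : normc (z + w) <= normc z + normc w.
Proof. exact: (le_normcD (z : Rcomplex R)). Qed.

Lemma normcNr z : normc (- z) = normc z.
Proof. exact: (normcN (z : Rcomplex R)). Qed.

Lemma normcB z w : normc (z - w) <= normc z + normc w.
Proof. by rewrite -(normcNr w) normcD. Qed.

Lemma normcBC z w : normc (z - w) = normc (w - z).
Proof. by rewrite -normcNr opprB. Qed.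

Lemma normc_real x : normc x%:C = `|x|.
Proof. by rewrite /normc /= expr0n addr0 sqrtr_sqr. Qed.

Lemma normcX z n : normc (z ^+ n) = normc z ^+ n.
Proof. by elim: n => [|n IH]; rewrite ?expr0 ?normc1 // !exprS normcM IH. Qed.

Lemma normc_sum (I : Type) (s : seq I) (P : pred I) (f : I -> R[i]) :
  normc (\sum_(i <- s | P i) f i) <= \sum_(i <- s | P i) normc (f i).
Proof.
elim/big_ind2: _ => [|a b c d ab cd|//]; first by rewrite normc0.
exact: le_trans (normcD _ _) (lerD ab cd).
Qed.

Lemma Re_le_normc z : `|complex.Re z| <= normc z.
Proof. by have := normc_ge_Re z; rewrite normr_normc lecR. Qed.

Lemma Im_le_normc z : `|complex.Im z| <= normc z.
Proof.
case: z => a b /=; rewrite -sqrtr_sqr ler_sqrt ?lerDr ?sqr_ge0 //.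
by rewrite addr_ge0 ?sqr_ge0.
Qed.

Lemma normc_leD z : normc z <= `|complex.Re z| + `|complex.Im z|.
Proof.
have {1}-> : z = (complex.Re z)%:C + 'i%C * (complex.Im z)%:C.
  by case: z => a b; apply/eqP; rewrite eq_complex /= !(mulr0, mul0r, mul1r, subr0,
    addr0, add0r) !eqxx.
apply: le_trans (normcD _ _) _; rewrite normcM !normc_real.
by rewrite [normc 'i]/normc /= expr0n add0r expr1n sqrtr1 mul1r.
Qed.

Lemma normc_le_eps z : (forall e, 0 < e -> normc z <= e) -> z = 0.
Proof.
move=> h; apply: eq0_normc; apply/eqP; rewrite eq_le normc_ge0 andbT.
by apply/ler_addgt0Pl => e e0; rewrite addr0 h.
Qed.

Lemma normc_eq_eps z w : (forall e, 0 < e -> normc (z - w) <= e) -> z = w.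
Proof. by move=> h; apply/eqP; rewrite -subr_eq0; apply/eqP/normc_le_eps. Qed.

Lemma normc_cexp z : normc (cexp z) = expR (complex.Re z).
Proof.
case: z => a b; rewrite /cexp /normc /= !exprMn -mulrDr cos2Dsin2 mulr1.
by rewrite sqrtr_sqr ger0_norm // expR_ge0.
Qed.

End Modulus.

Section Bisection.
Variables (R : realType) (I : finType) (P : (I -> R) -> R -> Prop).

(* A dyadic form of compactness (Cousin's lemma); [P x s] speaks about the cube
   [prod_i [x i, x i + s]]. *)
Lemma cube_bisection :
  (forall x s, 0 < s ->
     (forall b : I -> bool, P (fun i => x i + (if b i then s / 2 else 0)) (s / 2)) ->
     P x s) ->
  (forall x, exists2 d, 0 < d & forall y s, 0 < s -> s < d ->
     (forall i, y i <= x i <= y i + s) -> P y s) ->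
  forall x s, 0 < s -> P x s.
Proof.
move=> hsplit hloc x0 s0 s0_gt0; apply: contrapT => nP0.
pose half (x : I -> R) (s : R) (b : I -> bool) :=
  fun i => x i + (if b i then s / 2 else 0).
have /choice[b hb] : forall q : (I -> R) * R, exists b, 0 < q.2 ->
    ~ P q.1 q.2 -> ~ P (half q.1 q.2 b) (q.2 / 2).
  move=> q; apply: contrapT => /forallNP h.
  apply: (h (fun=> true)) => q0 nPq; exfalso; apply: nPq; apply: hsplit => // b.
  by apply: contrapT => nPb; apply: (h b) => _ _.
pose next (q : (I -> R) * R) := (half q.1 q.2 (b q), q.2 / 2).
pose u n := iter n next (x0, s0).
have us n : (u n).2 = s0 / 2 ^+ n.
  elim: n => [|n IH]; first by rewrite expr0 divr1.
  by rewrite /u iterS -/(u n) /= IH exprSr invfM mulrA.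
have us_gt0 n : 0 < (u n).2 by rewrite us divr_gt0 ?exprn_gt0.
have nPu n : ~ P (u n).1 (u n).2.
  by elim: n => [//|n IH]; rewrite /u iterS -/(u n) /=; apply: hb.
have stp i n : (u n).1 i <= (u n.+1).1 i <= (u n).1 i + (u n).2 / 2.
  have := us_gt0 n; rewrite /u iterS -/(u n) /= /half.
  by case: (b _ _) => ?; lra.
have le_l i n k : (u n).1 i <= (u (n + k)%N).1 i.
  elim: k => [|k IH]; first by rewrite addn0.
  by apply: le_trans IH _; rewrite addnS; case/andP: (stp i (n + k)%N).
have le_r i n k : (u (n + k)%N).1 i + (u (n + k)%N).2 <= (u n).1 i + (u n).2.
  elim: k => [|k IH]; first by rewrite addn0.
  apply: le_trans _ IH; rewrite addnS; case/andP: (stp i (n + k)%N) => _.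
  have -> : (u (n + k).+1).2 = (u (n + k)%N).2 / 2 by [].
  by move=> ?; lra.
have ub i n m : (u n).1 i <= (u m).1 i + (u m).2.
  have := us_gt0 m; have := us_gt0 n; have := us_gt0 (n + m)%N.
  have := le_l i n m; have := le_r i m n; rewrite (addnC m n); lra.
(* Each coordinate of the corners increases and stays below every right end ([ub]), so its supremum
   lies in all the nested cubes. *)
pose x i := sup (range (fun n => (u n).1 i)).
have xin i n : (u n).1 i <= x i <= (u n).1 i + (u n).2.
  have hub : has_ubound (range (fun n => (u n).1 i)).
    by exists ((u n).1 i + (u n).2) => _ [m _ <-].
  apply/andP; split; first by apply: ub_le_sup => //; exists n.
  by apply: ge_sup; [exists ((u n).1 i); exists n | move=> _ [m _ <-]].
have [d d0 hd] := hloc x.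
have [n hn] : exists n, s0 / 2 ^+ n < d.
  have /archi_boundP := ltW (divr_gt0 s0_gt0 d0).
  set n := Num.bound _ => hn; exists n.
  rewrite ltr_pdivrMr ?exprn_gt0 // mulrC -ltr_pdivrMr //.
  apply: lt_trans hn _; rewrite -natrX ltr_nat; exact: ltn_expl.
by apply: (nPu n); apply: hd; rewrite ?us_gt0 // us.
Qed.
End Bisection.

(** * Taylor estimates for the complex exponential *)

Section CexpBounds.
Variable R : realType.
Implicit Types (u v z w : R[i]).

Lemma mvt01 (f df : R -> R) :
  (forall t : R, is_derive t (1 : R) f (df t)) ->
  exists2 t, 0 <= t <= 1 & f 1 - f 0 = df t.
Proof.
move=> hd.
have cf : {within `[0, 1], continuous f}%classic.
  apply: continuous_subspaceT => t.
  by apply: differentiable_continuous; apply/derivable1_diffP; apply: ex_derive.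
have [t tin ->] := @MVT_segment R f df 0 1 ler01 (fun x _ => hd x) cf.
by exists t; rewrite ?subr0 ?mulr1 //; move: tin; rewrite in_itv.
Qed.

Lemma is_derive_cexp v u (t : R) :
  is_derive t (1 : R) (fun t : R => complex.Re (v * cexp (t%:C * u)))
    (complex.Re (v * u * cexp (t%:C * u))).
Proof.
case: v => v1 v2; case: u => a b.
have -> : (fun t : R => complex.Re ((v1 +i* v2) * cexp (t%:C * (a +i* b)))) =
    (v1 *: ((expR \o (a *: id)) * (cos \o (b *: id))) -
     v2 *: ((expR \o (a *: id)) * (sin \o (b *: id)))).
  apply/funext => s; rewrite /cexp /= !mul0r subr0 addr0 !fctE /=.
  by rewrite /GRing.scale /= (mulrC s a) (mulrC s b).
have da : is_derive t (1 : R) (a *: id) a.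
  by apply: is_derive_eq; rewrite /GRing.scale /= mulr1.
have db : is_derive t (1 : R) (b *: id) b.
  by apply: is_derive_eq; rewrite /GRing.scale /= mulr1.
apply: is_derive_eq.
rewrite /= !fctE /GRing.scale /= !mul0r subr0 addr0 (mulrC t a) (mulrC t b); ring.
Qed.

Lemma Re_mul_conj v : complex.Re (v^*%C * v) = normc v ^+ 2.
Proof.
case: v => a b; rewrite /normc sqr_sqrtr ?addr_ge0 ?sqr_ge0 //=; ring.
Qed.

Lemma Re_mul_le v z : complex.Re (v * z) <= normc v * normc z.
Proof. by rewrite -normcM; apply: le_trans (ler_norm _) (Re_le_normc _). Qed.

Lemma normc_conj v : normc v^*%C = normc v.
Proof. by case: v => a b; rewrite /= sqrrN. Qed.

Lemma normc_cexp_scale_le u (t : R) : 0 <= t <= 1 ->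
  normc (cexp (t%:C * u)) <= expR (normc u).
Proof.
move=> /andP[t0 t1]; rewrite normc_cexp ler_expR.
apply: le_trans (ler_norm _) _; apply: le_trans (Re_le_normc _) _.
by rewrite normcM normc_real ger0_norm // ler_piMl ?normc_ge0.
Qed.

(** The mean value theorem is real, so it is applied to [t |-> Re (v^* exp (t u))] with [v] the very
    quantity to be bounded: the increment becomes [|v|^2], and one factor [|v|] cancels. *)
Lemma normc_cexpB1 u : normc (cexp u - 1) <= normc u * expR (normc u).
Proof.
set v := cexp u - 1; have [/eqP v0|v0] := boolP (normc v == 0).
  by rewrite v0 mulr_ge0 ?normc_ge0 ?expR_ge0.
have v_gt0 : 0 < normc v by rewrite lt_def v0 normc_ge0.
have [t t01 ht] := mvt01 (is_derive_cexp v^*%C u).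
rewrite -(ler_pM2l v_gt0) -expr2 -(Re_mul_conj v).
have -> : complex.Re (v^*%C * v) = complex.Re (v^*%C * u * cexp (t%:C * u)).
  rewrite -ht rmorph1 rmorph0 mul0r mul1r cexp0 mulr1 /v mulrBr.
  by rewrite mulr1 -raddfB.
apply: le_trans (Re_mul_le _ _) _.
rewrite normcM normc_conj -mulrA ler_wpM2l ?normc_ge0 //.
by rewrite ler_wpM2l ?normc_ge0 // normc_cexp_scale_le.
Qed.

(** The same projection on [v] after subtracting the linear term: the derivative now contains
    [exp (t u) - 1], which [normc_cexpB1] bounds. *)
Lemma normc_cexp_taylor2 u :
  normc (cexp u - 1 - u) <= normc u ^+ 2 * expR (normc u).
Proof.
set v := cexp u - 1 - u; have [/eqP v0|v0] := boolP (normc v == 0).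
  by rewrite v0 mulr_ge0 ?sqr_ge0 ?expR_ge0.
have v_gt0 : 0 < normc v by rewrite lt_def v0 normc_ge0.
pose f t := complex.Re (v^*%C * (cexp (t%:C * u))) - complex.Re (v^*%C * u) * t.
have df t : is_derive t (1 : R) f (complex.Re (v^*%C * u * (cexp (t%:C * u) - 1))).
  have d1 := is_derive_cexp v^*%C u t.
  have d2 : is_derive t (1 : R) (complex.Re (v^*%C * u) *: id)
                      (complex.Re (v^*%C * u)).
    by apply: is_derive_eq; rewrite /GRing.scale /= mulr1.
  by rewrite mulrBr mulr1 raddfB; exact: is_deriveB.
have [t t01 ht] := mvt01 df.
rewrite -(ler_pM2l v_gt0) -expr2 -(Re_mul_conj v).
have -> : complex.Re (v^*%C * v) = f 1 - f 0.
  rewrite /f rmorph1 rmorph0 mul0r mul1r cexp0 mulr1 mulr0 subr0 mulr1 /v.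
  by rewrite !mulrBr mulr1 !raddfB /=; lra.
rewrite ht; apply: le_trans (Re_mul_le _ _) _.
rewrite normcM normc_conj -mulrA ler_wpM2l ?normc_ge0 //.
rewrite expr2 -mulrA ler_wpM2l ?normc_ge0 //.
apply: le_trans (normc_cexpB1 _) _.
have tu : normc (t%:C * u) <= normc u.
  case/andP: t01 => t0 t1.
  by rewrite normcM normc_real ger0_norm // ler_piMl ?normc_ge0.
by apply: ler_pM; rewrite ?normc_ge0 ?expR_ge0 ?ler_expR.
Qed.

End CexpBounds.

(** * Riemann sums and means of periodic functions *)

Section UnitIntegral.
Variable R : realType.

(** A primitive turns the integral into a telescoping sum, and the mean value theorem replaces each
    increment by a value of [h] at distance at most [1/N] from the grid point. *)
Lemma unit_integral_riemann (h : R -> R) (N : nat) (e : R) :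
  continuous h -> (0 < N)%N ->
  (forall s t, `|s - t| <= N%:R^-1 -> `|h s - h t| <= e) ->
  `|Rintegral lebesgue_measure `[0 : R, 1]%classic h -
    N%:R^-1 * \sum_(j < N) h (j%:R / N%:R)| <= e.
Proof.
move=> hc N0 hm.
(* Starting at -1 puts both ends of [0,1] inside the interval where the primitive is
   differentiable. *)
pose F (y : R) := \int[lebesgue_measure]_(t in `[(-1)%R, y]) h t.
have dF x : -1 < x -> x < 2 -> derivable F x 1 /\ (F^`()%classic x = h x).
  move=> x1 x2.
  apply: (@continuous_FTC1 R h (BLeft (-1)) x 2 x2) => //; last exact: hc.
    apply: continuous_compact_integrable; first exact: segment_compact.
    by apply: continuous_subspaceT.
have cF x : -1 < x -> x < 2 -> {for x, continuous F}.
  move=> x1 x2; apply: differentiable_continuous; apply/derivable1_diffP.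
  by case: (dF x x1 x2).
have -> : Rintegral lebesgue_measure `[0 : R, 1]%classic h = F 1 - F 0.
  rewrite /Rintegral (@continuous_FTC2 R h F 0 1) ?ltr01 //.
  - by apply: continuous_subspaceT.
  - split.
    + by move=> x; rewrite in_itv /= => /andP[x0 x1]; apply: (dF x _ _).1; lra.
    + by apply: cvg_at_right_filter; apply: cF; lra.
    + by apply: cvg_at_left_filter; apply: cF; lra.
  - by move=> x; rewrite in_itv /= => /andP[x0 x1]; apply: (dF x _ _).2; lra.
have N0r : 0 < N%:R :> R by rewrite ltr0n.
have NN : N%:R != 0 :> R by rewrite gt_eqF.
have -> : F 1 - F 0 = \sum_(j < N) (F (j.+1%:R / N%:R) - F (j%:R / N%:R)).
  rewrite -(big_mkord xpredT (fun j => F (j.+1%:R / N%:R) - F (j%:R / N%:R))).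
  by rewrite telescope_sumr // divff // mul0r.
have step (j : 'I_N) : `|F (j.+1%:R / N%:R) - F (j%:R / N%:R) -
    N%:R^-1 * h (j%:R / N%:R)| <= N%:R^-1 * e.
  have lt1 : j%:R / N%:R < j.+1%:R / N%:R :> R.
    by rewrite ltr_pM2r ?invr_gt0 // ltr_nat.
  have j0 : 0 <= j%:R / N%:R :> R by rewrite divr_ge0 ?ler0n.
  have j1 : j.+1%:R / N%:R <= 1 :> R by rewrite ler_pdivrMr // mul1r ler_nat.
  have [c ci ->] : exists2 c, c \in `]j%:R / N%:R, j.+1%:R / N%:R[%R &
      F (j.+1%:R / N%:R) - F (j%:R / N%:R) = h c * (j.+1%:R / N%:R - j%:R / N%:R).
    apply: MVT => //.
      move=> x; rewrite in_itv /= => /andP[x0 x1].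
      have [d <-] : derivable F x 1 /\ (F^`()%classic x = h x) by apply: dF; lra.
      by rewrite derive1E; apply: derivableP.
    apply: continuous_in_subspaceT => x.
    rewrite inE /= in_itv /= => /andP[x0 x1]; apply: cF; lra.
  have -> : j.+1%:R / N%:R - j%:R / N%:R = N%:R^-1 :> R.
    by rewrite -mulrBl -natrB ?leqnSn // subSnn mul1r.
  rewrite mulrC -mulrBr normrM ger0_norm ?invr_ge0 ?ler0n //.
  rewrite ler_wpM2l ?invr_ge0 ?ler0n //; apply: hm.
  move: ci; rewrite in_itv /= => /andP[c0 c1].
  have : j.+1%:R / N%:R - j%:R / N%:R = N%:R^-1 :> R.
    by rewrite -mulrBl -natrB ?leqnSn // subSnn mul1r.
  by rewrite ger0_norm; lra.
rewrite mulr_sumr -sumrB; apply: le_trans (ler_norm_sum _ _ _) _.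
apply: le_trans (ler_sum _ (fun j _ => step j)) _.
by rewrite sumr_const card_ord -[(_ * e) *+ N]mulr_natl mulrA divff // mul1r.
Qed.

End UnitIntegral.

(** * Averages over the grid of step 1/N *)

Section GridAverage.
Variables (R : realType) (N : nat).

(** The recursion copies that of [cube_integral], so the two are compared by induction on the
    dimension; the field is a parameter because real and complex averages both occur. *)
Fixpoint grid_avg (K : fieldType) (n : nat) : ('cV[R]_n -> K) -> K :=
  match n with
  | 0 => fun f => f 0
  | m.+1 => fun f => N%:R^-1 * \sum_(j < N) grid_avg
      (fun v : 'cV[R]_m => f (col_mx (const_mx (j%:R / N%:R) : 'cV[R]_1) v))
  end.

Lemma eq_grid_avg (K : fieldType) n (f h : 'cV[R]_n -> K) :
  f =1 h -> grid_avg f = grid_avg h.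
Proof. by move/funext => ->. Qed.

Lemma grid_avgD (K : fieldType) n (f h : 'cV[R]_n -> K) :
  grid_avg (fun x => f x + h x) = grid_avg f + grid_avg h.
Proof.
elim: n f h => [//|n IH] f h /=; rewrite -mulrDr -big_split /=.
by congr (_ * _); apply: eq_bigr => j _; rewrite IH.
Qed.

Lemma grid_avgZ (K : fieldType) n (c : K) (f : 'cV[R]_n -> K) :
  grid_avg (fun x => c * f x) = c * grid_avg f.
Proof.
elim: n f => [//|n IH] f /=; rewrite mulrCA; congr (_ * _).
by rewrite mulr_sumr; apply: eq_bigr => j _; rewrite IH.
Qed.

Lemma grid_avgB (K : fieldType) n (f h : 'cV[R]_n -> K) :
  grid_avg (fun x => f x - h x) = grid_avg f - grid_avg h.
Proof.
rewrite -mulN1r -grid_avgZ -grid_avgD; apply: eq_grid_avg => x.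
by rewrite mulN1r.
Qed.

Lemma grid_avg_sum (K : fieldType) n (J : Type) (s : seq J)
    (f : J -> 'cV[R]_n -> K) :
  grid_avg (fun x => \sum_(i <- s) f i x) = \sum_(i <- s) grid_avg (f i).
Proof.
elim: s => [|i s IH].
  transitivity (grid_avg (fun _ : 'cV[R]_n => (0 : K) * 0)).
    by apply: eq_grid_avg => x; rewrite big_nil mul0r.
  by rewrite grid_avgZ mul0r big_nil.
rewrite big_cons -IH -grid_avgD; apply: eq_grid_avg => x.
by rewrite big_cons.
Qed.

Lemma ler_grid_avg n (f h : 'cV[R]_n -> R) :
  (forall x, f x <= h x) -> grid_avg f <= grid_avg h.
Proof.
elim: n f h => [|n IH] f h fh /=; first exact: fh.
rewrite ler_wpM2l ?invr_ge0 ?ler0n //; apply: ler_sum => j _.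
by apply: IH => v; exact: fh.
Qed.

Lemma normc_grid_avg n (f : 'cV[R]_n -> R[i]) :
  normc (grid_avg f) <= grid_avg (fun x => normc (f x)).
Proof.
elim: n f => [//|n IH] f /=.
have -> : (N%:R^-1 : R[i]) = (N%:R^-1 : R)%:C by rewrite fmorphV rmorph_nat.
rewrite normcM normc_real ger0_norm ?invr_ge0 ?ler0n //.
rewrite ler_wpM2l ?invr_ge0 ?ler0n //.
by apply: le_trans (normc_sum _ _ _) _; apply: ler_sum => j _; exact: IH.
Qed.

Lemma ReIm_grid_avg n (f : 'cV[R]_n -> R[i]) :
  complex.Re (grid_avg f) = grid_avg (fun x => complex.Re (f x)) /\
  complex.Im (grid_avg f) = grid_avg (fun x => complex.Im (f x)).
Proof.
elim: n f => [//|n IH] f /=.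
have -> : (N%:R^-1 : R[i]) = (N%:R^-1 : R)%:C by rewrite fmorphV rmorph_nat.
have E (c : R) (z : R[i]) : complex.Re (c%:C * z) = c * complex.Re z /\
    complex.Im (c%:C * z) = c * complex.Im z.
  by case: z => a b /=; rewrite !mul0r subr0 addr0.
rewrite (E _ _).1 (E _ _).2 !raddf_sum.
split; congr (_ * _); apply: eq_bigr => j _; [exact: (IH _).1|exact: (IH _).2].
Qed.

Hypothesis N_gt0 : (0 < N)%N.

Let NN (K : numFieldType) : N%:R != 0 :> K.
Proof. by rewrite pnatr_eq0 -lt0n. Qed.

Lemma grid_avg_cst (K : numFieldType) n (c : K) :
  grid_avg (fun _ : 'cV[R]_n => c) = c.
Proof.
elim: n => [//|n IH] /=; rewrite IH sumr_const card_ord -[c *+ N]mulr_natl.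
by rewrite mulrA mulVf ?NN // mul1r.
Qed.

Lemma sum_int_periodic (K : zmodType) (u : int -> K) (k : int) :
  (forall m, u (m + N%:Z) = u m) ->
  \sum_(j < N) u (j%:Z + k) = \sum_(j < N) u j%:Z.
Proof.
move=> up; have step m : \sum_(j < N) u (j%:Z + (m + 1)) = \sum_(j < N) u (j%:Z + m).
  move: N_gt0 up; case: (N) => [//|M] _ up.
  rewrite big_ord_recr [RHS]big_ord_recl /= add0r addrC.
  congr (_ + _); first by rewrite -[RHS]up; congr u; rewrite -addn1 PoszD; ring.
  by apply: eq_bigr => j _; congr u; rewrite /bump /= add1n -addn1 PoszD; ring.
have h0 : \sum_(j < N) u (j%:Z + 0) = \sum_(j < N) u j%:Z.
  by apply: eq_bigr => j _; rewrite addr0.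
elim/int_rec: k => [//|n IH|n IH]; first by rewrite -IH -(step n%:Z) -addn1 PoszD.
by rewrite -IH -(step (- n.+1%:Z)); apply: eq_bigr => j _; congr u; lia.
Qed.

Definition lattice_periodic (T : Type) n (f : 'cV[R]_n -> T) :=
  forall x l, l \in @Zlattice R n -> f (x + l) = f x.

Lemma ZlatticeS n (h : 'cV[R]_(1 + n)) :
  (h \in @Zlattice R _) = (h 0 0 \is a Num.int) && (dsubmx h \in @Zlattice R n).
Proof.
apply/forallP/andP => [H|[h0 /forallP hd] i].
  by split=> //; apply/forallP => i; rewrite mxE.
rewrite -[h]vsubmxK; case: (splitP i) => [j ij|j ij].
  have -> : i = lshift n j by apply: val_inj.
  rewrite col_mxEu mxE; have -> // : lshift n j = 0.
  by apply: val_inj; rewrite /= (ord1 j).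
have -> : i = rshift 1 j by apply: val_inj.
by rewrite col_mxEd; exact: hd.
Qed.

(** Translation by a grid vector permutes the grid modulo the lattice, so invariance is exact at
    every [N], before any limit. *)
Lemma grid_avg_shift (K : numFieldType) n (f : 'cV[R]_n -> K) h :
  lattice_periodic f -> N%:R *: h \in @Zlattice R n ->
  grid_avg (fun x => f (x + h)) = grid_avg f.
Proof.
elim: n f h => [|n IH] f h pf hZ /=; first by rewrite (flatmx0 (0 + h)).
rewrite -[n.+1]/(1 + n)%N in h hZ f pf *.
move: hZ; rewrite ZlatticeS => /andP[]; rewrite mxE => /intrP[k hk].
have -> : dsubmx (N%:R *: h) = N%:R *: dsubmx h by apply/colP => i; rewrite !mxE.
move=> hd; congr (_ * _).
have fE s v : f (col_mx (const_mx s : 'cV[R]_1) v + h) =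
    f (col_mx (const_mx (s + h 0 0) : 'cV[R]_1) (v + dsubmx h)).
  congr f; rewrite -{1}[h]vsubmxK add_col_mx; congr col_mx.
  apply/colP => i; rewrite !mxE; congr (_ + h _ _); apply: val_inj => /=.
  by rewrite (ord1 i).
pose g s := grid_avg (fun v : 'cV[R]_n => f (col_mx (const_mx s : 'cV[R]_1) v)).
have pfs s : lattice_periodic (fun v : 'cV[R]_n =>
  f (col_mx (const_mx s : 'cV[R]_1) v)).
  move=> v l lZ; have lZ' : (col_mx 0 l : 'cV[R]_(1 + n)) \in @Zlattice R _.
    rewrite ZlatticeS col_mxKd lZ andbT.
    have -> : 0 = lshift n 0 :> 'I_(1 + n) by apply: val_inj.
    by rewrite col_mxEu mxE.
  by rewrite -[RHS](pf _ _ lZ') add_col_mx addr0.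
have gE (j : 'I_N) : grid_avg (fun v : 'cV[R]_n =>
    f (col_mx (const_mx (j%:R / N%:R) : 'cV[R]_1) v + h)) =
    g ((j%:Z + k)%:~R / N%:R).
  rewrite /g -(IH _ _ (pfs _) hd); apply: eq_grid_avg => v; rewrite fE.
  congr (f (col_mx (const_mx _) _)).
  by rewrite intrD mulrDl -hk (mulrC _ (h 0 0)) mulfK ?NN.
rewrite (eq_bigr _ (fun j _ => gE j)) (sum_int_periodic (u := fun m =>
  g (m%:~R / N%:R))).
  by apply: eq_bigr => j _.
move=> m; rewrite intrD mulrDl divff ?NN //; apply: eq_grid_avg => v.
have lZ : (col_mx 1 0 : 'cV[R]_(1 + n)) \in @Zlattice R _.
  rewrite ZlatticeS col_mxKd rpred0 andbT.
  have -> : 0 = lshift n 0 :> 'I_(1 + n) by apply: val_inj.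
  by rewrite col_mxEu mxE.
rewrite -[RHS](pf _ _ lZ) add_col_mx addr0; congr (f (col_mx _ _)).
by apply/colP => i; rewrite !mxE (ord1 i).
Qed.

End GridAverage.

Section CubeIntegral.
Variable R : realType.

Lemma eventually_inv_le (d : R) : 0 < d ->
  exists N0, forall N, (N0 <= N)%N -> (0 < N)%N /\ N%:R^-1 <= d.
Proof.
move=> d0; exists (Num.bound d^-1).+1 => N hN.
have N0 : (0 < N)%N by apply: leq_trans hN.
split=> //; rewrite invf_ple ?posrE ?ltr0n //.
have /ltW := archi_boundP (ltW (ltac:(by rewrite invr_gt0) : 0 < d^-1)).
by move=> h; apply: le_trans h _; rewrite ler_nat; apply: leq_trans hN.
Qed.

Definition near_pt n (d : R) (x y : 'cV[R]_n) := forall i, `|x i 0 - y i 0| <= d.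

Lemma near_col_mx n (d s t : R) (v w : 'cV[R]_n) : `|s - t| <= d ->
  near_pt d v w ->
  near_pt d (col_mx (const_mx s : 'cV[R]_1) v) (col_mx (const_mx t : 'cV[R]_1) w).
Proof.
move=> st vw i; case: (splitP i) => j ij.
  by have -> : i = lshift n j by [apply: val_inj]; rewrite !col_mxEu !mxE.
by have -> : i = rshift 1 j by [apply: val_inj]; rewrite !col_mxEd.
Qed.

Lemma real_grid_avg_le N n (f : 'cV[R]_n -> R) (e : R) : (0 < N)%N ->
  (forall x, `|f x| <= e) -> `|grid_avg N f| <= e.
Proof.
move=> N0 fe; rewrite ler_norml -{1}(grid_avg_cst R N0 n e) -{2}(grid_avg_cst R N0 n e).
rewrite -mulN1r -grid_avgZ.
by apply/andP; split; apply: ler_grid_avg => x; move: (fe x);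
  rewrite ler_norml ?mulN1r => /andP[].
Qed.

(** Each of the [n] integrations costs one error [e]. Uniform continuity makes the inner integral a
    continuous function of the first coordinate. *)
Lemma cube_integral_approx n (f : 'cV[R]_n -> R) (N : nat) (e : R) :
  (forall e, 0 < e -> exists2 d, 0 < d & forall x y, near_pt d x y ->
    `|f x - f y| <= e) ->
  (0 < N)%N ->
  (forall x y, near_pt N%:R^-1 x y -> `|f x - f y| <= e) ->
  `|cube_integral f - grid_avg N f| <= n%:R * e.
Proof.
elim: n f N e => [|n IH] f N e uf N0 fe; first by rewrite /= subrr normr0 mul0r.
pose fs s := fun v : 'cV[R]_n => f (col_mx (const_mx s : 'cV[R]_1) v).
have ufs s e' : 0 < e' -> exists2 d, 0 < d & forall x y, near_pt d x y ->
  `|fs s x - fs s y| <= e'.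
  move=> e0; have [d d0 hd] := uf _ e0; exists d => // x y xy; apply: hd.
  by apply: near_col_mx => //; rewrite subrr normr0 ltW.
pose h s := cube_integral (fs s).
(* The inner integral inherits the modulus of [f] from grid averages, where it holds term by term;
   refining the grid makes the extra error [r] arbitrary. *)
have hmod d e' : (forall x y, near_pt d x y -> `|f x - f y| <= e') ->
    forall s t, `|s - t| <= d -> `|h s - h t| <= e'.
  move=> hde s t st; apply/ler_addgt0Pr => r r0.
  have n0 : 0 < 2 * (n%:R + 1) :> R by rewrite mulr_gt0 ?ltr_wpDl ?ler0n.
  have [d1 d10 hd1] := uf (r / (2 * (n%:R + 1))) (divr_gt0 r0 n0).
  have [M hM] := eventually_inv_le d10; have {hM} [M0 hM] := hM M (leqnn M).
  have ap u : `|h u - grid_avg M (fs u)| <= n%:R * (r / (2 * (n%:R + 1))).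
    apply: IH => // [|x y xy]; first exact: ufs.
    apply: hd1; apply: near_col_mx; first by rewrite subrr normr0 ltW.
    by move=> i; apply: le_trans (xy i) hM.
  have av : `|grid_avg M (fs s) - grid_avg M (fs t)| <= e'.
    rewrite -grid_avgB; apply: real_grid_avg_le => // v.
    apply: hde; apply: near_col_mx => // i; rewrite subrr normr0.
    exact: le_trans (normr_ge0 _) st.
  have hr : n%:R * (r / (2 * (n%:R + 1))) <= r / 2.
    by rewrite mulrA ler_pdivrMr //; lra.
  have := ap s; have := ap t; move: av hr; rewrite !ler_norml.
  move=> /andP[? ?] ? /andP[? ?] /andP[? ?]; apply/andP; split; lra.
have hc : continuous h.
  move=> s; apply/cvgrPdist_le => e' e0; have [d d0 hd] := uf _ e0.
  suff : nbhs s (fun t => `|s - t| <= d) by apply: filterS => t; exact: hmod.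
  by exists d => //= u /ltW.
rewrite /= -/h.
have s1 := unit_integral_riemann hc N0 (hmod _ _ fe).
have s2 : `|N%:R^-1 * \sum_(j < N) h (j%:R / N%:R) - N%:R^-1 * \sum_(j < N) grid_avg N
  (fs (j%:R / N%:R))| <= n%:R * e.
  rewrite -mulrBr -sumrB normrM ger0_norm ?invr_ge0 ?ler0n //.
  rewrite ler_pdivrMl ?ltr0n //.
  apply: le_trans (ler_norm_sum _ _ _) _.
  have -> : N%:R * (n%:R * e) = \sum_(j < N) n%:R * e by rewrite sumr_const card_ord
    mulr_natl.
  apply: ler_sum => j _; apply: IH => // [|x y xy]; first exact: ufs.
  apply: fe; apply: near_col_mx => //; by rewrite subrr normr0 invr_ge0 ler0n.
have -> : n.+1%:R * e = e + n%:R * e by rewrite -natr1 mulrDl mul1r addrC.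
by apply: le_trans (ler_distD _ _ _) (lerD s1 s2).
Qed.

End CubeIntegral.

Section ComplexLimits.
Variable R : realType.
Implicit Types (u v : nat -> R[i]) (A B : R[i]).

Definition climit u A := forall e, 0 < e ->
  exists N0, forall N, (N0 <= N)%N -> normc (u N - A) <= e.

Lemma climit_uniq u A B : climit u A -> climit u B -> A = B.
Proof.
move=> hA hB; apply: normc_eq_eps => e e0.
have e2 : 0 < e / 2 by rewrite divr_gt0.
have [NA hNA] := hA _ e2; have [NB hNB] := hB _ e2.
have := hNA _ (leq_maxl NA NB); have := hNB _ (leq_maxr NA NB).
set w := u _ => h1 h2; have -> : A - B = (w - B) - (w - A) by ring.
by apply: le_trans (normcB _ _) _; lra.
Qed.

(** Index 0 is excluded because the average over the empty grid is a default value. *)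
Lemma eq_climit u v A : (forall N, (0 < N)%N -> u N = v N) ->
  climit u A -> climit v A.
Proof.
move=> uv hA e e0; have [N0 h] := hA e e0; exists N0.+1 => N hN.
by rewrite -uv ?h //; [exact: ltnW|exact: leq_trans hN].
Qed.

Lemma climitD u v A B : climit u A -> climit v B ->
  climit (fun N => u N + v N) (A + B).
Proof.
move=> hA hB e e0; have e2 : 0 < e / 2 by rewrite divr_gt0.
have [NA hNA] := hA _ e2; have [NB hNB] := hB _ e2.
exists (maxn NA NB) => N; rewrite geq_max => /andP[/hNA h1 /hNB h2].
have -> : u N + v N - (A + B) = (u N - A) + (v N - B) by ring.
by apply: le_trans (normcD _ _) _; lra.
Qed.

Lemma climitZ u A c : climit u A -> climit (fun N => c * u N) (c * A).
Proof.
move=> hA e e0; have c1 : 0 < normc c + 1 by rewrite ltr_wpDl ?normc_ge0.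
have [N0 h] := hA _ (divr_gt0 e0 c1).
exists N0 => N /h; rewrite ler_pdivlMr // => hN.
rewrite -mulrBr normcM mulrC; apply: le_trans hN.
by rewrite ler_wpM2l ?normc_ge0 // lerDl.
Qed.

Lemma climit_cst A : climit (fun=> A) A.
Proof. by move=> e e0; exists 0 => N _; rewrite subrr normc0 ltW. Qed.

Lemma climit_le u v A B : climit u A -> climit v B ->
  (forall N, (0 < N)%N -> normc (u N) <= complex.Re (v N)) -> normc A <= complex.Re B.
Proof.
move=> hA hB uv; apply/ler_addgt0Pr => e e0.
have e2 : 0 < e / 2 by rewrite divr_gt0.
have [NA hNA] := hA _ e2; have [NB hNB] := hB _ e2.
set N := (maxn NA NB).+1.
have h1 : normc (u N - A) <= e / 2 by apply: hNA; rewrite leqW ?leq_maxl.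
have h2 : normc (v N - B) <= e / 2 by apply: hNB; rewrite leqW ?leq_maxr.
have h3 := uv N isT.
have -> : A = u N - (u N - A) by ring.
have h4 : complex.Re (v N - B) <= e / 2.
  by apply: le_trans (ler_norm _) _; apply: le_trans (Re_le_normc _) h2.
move: h4; rewrite raddfB /= => h4.
by apply: le_trans (normcB _ _) _; lra.
Qed.

End ComplexLimits.

Section PointwiseContinuity.
Variables (R : realType) (n : nat).
Implicit Types f h : 'cV[R]_n -> R[i].

Definition cont f := forall x e, 0 < e ->
  exists2 d, 0 < d & forall y, near_pt d x y -> normc (f x - f y) <= e.

Lemma near_ptW (d d' : R) (x y : 'cV[R]_n) : d <= d' -> near_pt d x y -> near_pt d' x y.
Proof. by move=> dd h i; apply: le_trans (h i) dd. Qed.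

Lemma cont_cst (c : R[i]) : cont (fun=> c).
Proof. by move=> x e e0; exists 1 => // y _; rewrite subrr normc0 ltW. Qed.

Lemma contD f h : cont f -> cont h -> cont (fun x => f x + h x).
Proof.
move=> cf ch x e e0; have e2 : 0 < e / 2 by rewrite divr_gt0.
have [d1 d10 h1] := cf x _ e2; have [d2 d20 h2] := ch x _ e2.
exists (Num.min d1 d2); first by rewrite lt_min d10.
move=> y xy; have -> : f x + h x - (f y + h y) = (f x - f y) + (h x - h y) by ring.
have l1 : Num.min d1 d2 <= d1 by rewrite ge_min lexx.
have l2 : Num.min d1 d2 <= d2 by rewrite ge_min lexx orbT.
have := h1 y (near_ptW l1 xy); have := h2 y (near_ptW l2 xy).
by move=> ? ?; apply: le_trans (normcD _ _) _; lra.
Qed.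

Lemma contM f h : cont f -> cont h -> cont (fun x => f x * h x).
Proof.
move=> cf ch x e e0.
pose a := normc (f x) + 1; pose b := normc (h x) + 1.
have a0 : 0 < a by rewrite ltr_wpDl ?normc_ge0.
have b0 : 0 < b by rewrite ltr_wpDl ?normc_ge0.
have [d1 d10 h1] := cf x (Num.min 1 (e / 2 / b)) (ltac:(by rewrite lt_min ltr01
  !divr_gt0)).
have [d2 d20 h2] := ch x (e / 2 / a) (ltac:(by rewrite !divr_gt0)).
exists (Num.min d1 d2); first by rewrite lt_min d10.
move=> y xy.
have l1 : Num.min d1 d2 <= d1 by rewrite ge_min lexx.
have l2 : Num.min d1 d2 <= d2 by rewrite ge_min lexx orbT.
have := h1 y (near_ptW l1 xy); have := h2 y (near_ptW l2 xy).
rewrite le_min => k2 /andP[k0 k1].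
have -> : f x * h x - f y * h y = (f x - f y) * h x + f y * (h x - h y) by ring.
apply: le_trans (normcD _ _) _; rewrite !normcM.
have fy : normc (f y) <= a.
  have -> : f y = f x - (f x - f y) by ring.
  by apply: le_trans (normcB _ _) _; rewrite lerD2l.
have j1 : normc (f x - f y) * normc (h x) <= e / 2.
  apply: (@le_trans _ _ (e / 2 / b * b)); last by rewrite divfK // gt_eqF.
  by apply: ler_pM; rewrite ?normc_ge0 // lerDl.
have j2 : normc (f y) * normc (h x - h y) <= e / 2.
  apply: (@le_trans _ _ (a * (e / 2 / a))); last by rewrite mulrC divfK // gt_eqF.
  by apply: ler_pM; rewrite ?normc_ge0.
by lra.
Qed.

Lemma cont_sum (I : Type) (s : seq I) (f : I -> 'cV[R]_n -> R[i]) :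
  (forall i, cont (f i)) -> cont (fun x => \sum_(i <- s) f i x).
Proof.
move=> cf; elim: s => [|i s IH].
  by under eq_fun do rewrite big_nil; exact: cont_cst.
by under eq_fun do rewrite big_cons; exact: contD.
Qed.

Lemma cont_coord i : cont (fun x => (x i 0)%:C).
Proof.
by move=> x e e0; exists e => // y /(_ i); rewrite -rmorphB normc_real.
Qed.

Lemma cont_cexp f : cont f -> cont (fun x => cexp (f x)).
Proof.
move=> cf x e e0.
pose a := normc (cexp (f x)) * expR 1 + 1.
have a0 : 0 < a by rewrite ltr_wpDl ?mulr_ge0 ?normc_ge0 ?expR_ge0.
have [d d0 hd] := cf x (Num.min 1 (e / a)) (ltac:(by rewrite lt_min ltr01 !divr_gt0)).
exists d => // y /hd; rewrite le_min normcBC => /andP[k1 k2].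
have -> : cexp (f x) - cexp (f y) = - (cexp (f x) * (cexp (f y - f x) - 1)).
  by rewrite mulrBr -cexpD mulr1; rewrite (_ : f x + (f y - f x) = f y); ring.
rewrite normcNr normcM.
have k3 := normc_cexpB1 (f y - f x).
apply: (@le_trans _ _ (normc (cexp (f x)) * (e / a * expR 1))).
  rewrite ler_wpM2l ?normc_ge0 //; apply: le_trans k3 _.
  by apply: ler_pM; rewrite ?normc_ge0 ?expR_ge0 ?ler_expR.
rewrite mulrCA mulrAC ler_pdivrMr // ler_wpM2l ?(ltW e0) //.
by rewrite lerDl.
Qed.

Lemma cont_conj f : cont f -> cont (fun x => (f x)^*%C).
Proof.
move=> cf x e e0; have [d d0 hd] := cf x e e0; exists d => // y /hd.
by rewrite -rmorphB /= normc_conj.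
Qed.

Lemma cont_shift f a : cont f -> cont (fun x => f (x + a)).
Proof.
move=> cf x e e0; have [d d0 hd] := cf (x + a) e e0; exists d => // y xy.
by apply: hd => i; rewrite !mxE opprD addrACA subrr addr0.
Qed.

End PointwiseContinuity.

(** * Means of continuous periodic functions *)

Section PeriodicMean.
Variables (R : realType) (n : nat).
Implicit Types f h : 'cV[R]_n -> R[i].

Definition cont_periodic f := lattice_periodic f /\ cont f.

Lemma finite_uniform (T : finType) (Q : T -> R -> Prop) :
  (forall b d d', d' <= d -> Q b d -> Q b d') ->
  (forall b, exists2 d, 0 < d & Q b d) -> exists2 d, 0 < d & forall b, Q b d.
Proof.
move=> Qle hQ.
suff /(_ (enum T)) [d d0 h] : forall s : seq T, exists2 d, 0 < d & forall b, b \in s ->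
  Q b d.
  by exists d => // b; apply: h; rewrite mem_enum.
elim=> [|b s [d d0 IH]]; first by exists 1.
have [d' d'0 hb] := hQ b; exists (Num.min d d'); first by rewrite lt_min d0.
move=> c; rewrite inE => /predU1P[->|/IH h];
  [apply: (Qle _ _ _ _ hb)|apply: (Qle _ _ _ _ h)].
  by rewrite ge_min lexx orbT.
by rewrite ge_min lexx.
Qed.

Lemma unit_cube_representative (x : 'cV[R]_n) :
  exists2 l, l \in @Zlattice R n & forall i, 0 <= (x + l) i 0 <= 1.
Proof.
exists (\col_i - (Num.floor (x i 0))%:~R).
  by apply/ZlatticeP; exists (\col_i - Num.floor (x i 0)); apply/colP => i;
    rewrite !mxE intrN.
move=> i; rewrite !mxE; have := floor_le (x i 0); have := floorD1_gt (x i 0).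
rewrite intrD /=; lra.
Qed.

Lemma half_cube (x : 'I_n -> R) s (u : 'cV[R]_n) :
  (forall i, x i <= u i 0 <= x i + s) -> exists b : {ffun 'I_n -> bool},
    forall i, x i + (if b i then s / 2 else 0) <= u i 0
      <= x i + (if b i then s / 2 else 0) + s / 2.
Proof.
move=> hu; exists [ffun i => x i + s / 2 <= u i 0] => i; rewrite ffunE.
by have := hu i; have [h|h] := leP (x i + s / 2) (u i 0) => /andP[? ?]; apply/andP;
  split; lra.
Qed.

Lemma cont_periodic_uniform f : cont_periodic f -> forall e, 0 < e ->
  exists2 d, 0 < d & forall x y, near_pt d x y -> normc (f x - f y) <= e.
Proof.
move=> [pf cf] e e0.
(* Only the first point is confined to the cube, so the sub-cubes fit together without care at their
   common faces. *)
pose P (x : 'I_n -> R) (s : R) := exists2 d, 0 < d & forall u v : 'cV[R]_n,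
  (forall i, x i <= u i 0 <= x i + s) -> near_pt d u v -> normc (f u - f v) <= e.
have [d d0 hd] : P (fun=> 0) 1.
  apply: cube_bisection => // [x s s0 hb|x].
    have [b d d' dd h u v hu uv|d d0 hd] := @finite_uniform {ffun 'I_n ->
      bool} (fun b d => forall u v : 'cV[R]_n,
      (forall i, x i + (if b i then s / 2 else 0) <= u i 0
      <= x i + (if b i then s / 2 else 0) + s / 2) -> near_pt d u v ->
      normc (f u - f v) <= e) _ hb.
      by apply: h => //; apply: near_ptW uv.
    by exists d => // u v /half_cube[b hu]; exact: hd hu.
  have e2 : 0 < e / 2 by rewrite divr_gt0.
  have [d d0 hd] := cf (\col_i x i) _ e2.
  exists (d / 2); first by rewrite divr_gt0.
  move=> y s s0 sd hy; exists (d / 2); first by rewrite divr_gt0.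
  move=> u v hu uv.
  have h1 : normc (f (\col_i x i) - f u) <= e / 2.
    apply: hd => i; rewrite mxE ler_norml; have := hu i; have := hy i; lra.
  have h2 : normc (f (\col_i x i) - f v) <= e / 2.
    apply: hd => i; rewrite mxE ler_norml; have := hu i; have := hy i.
    by have := uv i; rewrite ler_norml; lra.
  have -> : f u - f v = (f (\col_i x i) - f v) - (f (\col_i x i) - f u) by ring.
  by apply: le_trans (normcB _ _) _; lra.
exists d => // x y xy; have [l lZ hl] := unit_cube_representative x.
rewrite -(pf x l lZ) -(pf y l lZ); apply: hd; first by move=> i; rewrite add0r.
by move=> i; rewrite !mxE opprD addrACA subrr addr0.
Qed.

Lemma cont_periodic_bounded f : cont_periodic f ->
  exists2 M, 0 < M & forall x, normc (f x) <= M.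
Proof.
move=> [pf cf].
(* The bound is written [d^-1] so that a smaller [d] makes a weaker claim, as [finite_uniform]
   requires. *)
pose P (x : 'I_n -> R) (s : R) := exists2 d, 0 < d & forall u : 'cV[R]_n,
  (forall i, x i <= u i 0 <= x i + s) -> normc (f u) <= d^-1.
have [d d0 hd] : P (fun=> 0) 1.
  apply: cube_bisection => // [x s s0 hb|x].
    have [//|b|d d0 hd] := @finite_uniform {ffun 'I_n -> bool} (fun b d => 0 < d ->
      forall u : 'cV[R]_n, (forall i, x i + (if b i then s / 2 else 0) <= u i 0
      <= x i + (if b i then s / 2 else 0) + s / 2) -> normc (f u) <= d^-1).
    - move=> b d d' dd h d'0 v hv; apply: le_trans (h (lt_le_trans d'0 dd) v hv) _.
      by rewrite lef_pV2 ?posrE // (lt_le_trans d'0 dd).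
    - by have [d d0 h] := hb b; exists d.
    - by exists d => // u /half_cube[b hu]; exact: hd hu.
  have [d d0 hd] := cf (\col_i x i) _ ltr01.
  exists d => // y s s0 sd hy; exists (normc (f (\col_i x i)) + 1)^-1.
    by rewrite invr_gt0 ltr_wpDl ?normc_ge0.
  move=> u hu; rewrite invrK.
  have h1 : normc (f (\col_i x i) - f u) <= 1.
    apply: hd => i; rewrite mxE ler_norml; have := hu i; have := hy i; lra.
  have -> : f u = f (\col_i x i) - (f (\col_i x i) - f u) by ring.
  by apply: le_trans (normcB _ _) _; rewrite lerD2l.
exists d^-1 => [|x]; first by rewrite invr_gt0.
have [l lZ hl] := unit_cube_representative x.
by rewrite -(pf x l lZ); apply: hd => i; rewrite add0r.
Qed.

Lemma mean_limit f : cont_periodic f ->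
  climit (fun N => grid_avg N f) (cube_integralC f).
Proof.
move=> gf e e0.
have n0 : 0 < 2 * (n%:R + 1) :> R by rewrite mulr_gt0 ?ltr_wpDl ?ler0n.
have [d d0 hd] := cont_periodic_uniform gf (divr_gt0 e0 n0).
have [N0 hN0] := eventually_inv_le d0; exists N0 => N /hN0[N1 Nd].
have hr : n%:R * (e / (2 * (n%:R + 1))) <= e / 2.
  by rewrite mulrA ler_pdivrMr //; lra.
have hRe : `|cube_integral (fun x => complex.Re (f x)) - grid_avg N (fun x =>
  complex.Re (f x))| <= e / 2.
  apply: le_trans hr; apply: cube_integral_approx =>
    // [e' /(cont_periodic_uniform gf)[d' d'0 h]|x y xy].
    exists d' => // x y /h; apply: le_trans; rewrite -raddfB; exact: Re_le_normc.
  rewrite -raddfB; apply: le_trans (Re_le_normc _) _; apply: hd; exact: near_ptW xy.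
have hIm : `|cube_integral (fun x => complex.Im (f x)) - grid_avg N (fun x =>
  complex.Im (f x))| <= e / 2.
  apply: le_trans hr; apply: cube_integral_approx =>
    // [e' /(cont_periodic_uniform gf)[d' d'0 h]|x y xy].
    exists d' => // x y /h; apply: le_trans; rewrite -raddfB; exact: Im_le_normc.
  rewrite -raddfB; apply: le_trans (Im_le_normc _) _; apply: hd; exact: near_ptW xy.
apply: le_trans (normc_leD _) _; rewrite !raddfB /=.
rewrite (ReIm_grid_avg N f).1 (ReIm_grid_avg N f).2.
by rewrite distrC in hRe; rewrite distrC in hIm; lra.
Qed.

Lemma cont_periodic_cst (c : R[i]) : cont_periodic (fun=> c).
Proof. by split; [|exact: cont_cst]. Qed.

Lemma cont_periodicD f h : cont_periodic f -> cont_periodic h ->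
  cont_periodic (fun x => f x + h x).
Proof.
by move=> [pf cf] [ph ch]; split; [move=> x l lZ; rewrite pf ?ph | exact: contD].
Qed.

Lemma cont_periodicM f h : cont_periodic f -> cont_periodic h ->
  cont_periodic (fun x => f x * h x).
Proof.
by move=> [pf cf] [ph ch]; split; [move=> x l lZ; rewrite pf ?ph | exact: contM].
Qed.

Lemma cont_periodic_shift f a : cont_periodic f -> cont_periodic (fun x => f (x + a)).
Proof.
move=> [pf cf]; split; last exact: cont_shift.
by move=> x l lZ; rewrite (addrAC x l a) (pf (x + a) l lZ).
Qed.

Lemma mean_uniq f A : cont_periodic f -> climit (fun N => grid_avg N f) A ->
  cube_integralC f = A.
Proof. by move=> gf; apply: climit_uniq; exact: mean_limit. Qed.

Lemma meanD f h : cont_periodic f -> cont_periodic h ->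
  cube_integralC (fun x => f x + h x) = cube_integralC f + cube_integralC h.
Proof.
move=> gf gh; apply: mean_uniq; first exact: cont_periodicD.
apply: eq_climit (climitD (mean_limit gf) (mean_limit gh)) => N _.
by rewrite grid_avgD.
Qed.

Lemma meanZ c f : cont_periodic f ->
  cube_integralC (fun x => c * f x) = c * cube_integralC f.
Proof.
move=> gf; apply: mean_uniq; first exact: cont_periodicM (cont_periodic_cst c) gf.
apply: eq_climit (climitZ c (mean_limit gf)) => N _.
by rewrite grid_avgZ.
Qed.

Lemma mean_cst c : cube_integralC (fun _ : 'cV[R]_n => c) = c.
Proof.
apply: mean_uniq; first exact: cont_periodic_cst.
by apply: eq_climit (climit_cst c) => N N0; rewrite grid_avg_cst.
Qed.

Lemma mean_sum (I : Type) (s : seq I) (f : I -> 'cV[R]_n -> R[i]) :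
  (forall i, cont_periodic (f i)) ->
  cont_periodic (fun x => \sum_(i <- s) f i x) /\
  cube_integralC (fun x => \sum_(i <- s) f i x) = \sum_(i <- s) cube_integralC (f i).
Proof.
move=> gf; elim: s => [|i s [IH1 IH2]].
  have -> : (fun x => \sum_(j <- [::]) f j x) = (fun=> 0).
    by apply/funext => x; rewrite big_nil.
  by rewrite big_nil; split; [exact: cont_periodic_cst|exact: mean_cst].
have -> : (fun x => \sum_(j <- i :: s) f j x) = (fun x => f i x + \sum_(j <- s) f j x).
  by apply/funext => x; rewrite big_cons.
by rewrite big_cons; split; [exact: cont_periodicD|rewrite meanD // IH2].
Qed.

Lemma mean_shift f a : cont_periodic f ->
  cube_integralC (fun x => f (x + a)) = cube_integralC f.
Proof.
move=> gf; apply: mean_uniq; first exact: cont_periodic_shift.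
move=> e e0; have e2 : 0 < e / 2 by rewrite divr_gt0.
have [N1 h1] := mean_limit gf e2.
have [d d0 hd] := cont_periodic_uniform gf e2.
have [N2 h2] := eventually_inv_le d0.
exists (maxn N1 N2) => N; rewrite geq_max => /andP[/h1 k1 /h2[N0 k2]].
have Nr : 0 < N%:R :> R by rewrite ltr0n.
(* [a] is rounded down to the grid: the average is exactly invariant under [b], and the entries of
   [a - b] lie in [[0, 1/N)], which uniform continuity absorbs. *)
pose b : 'cV[R]_n := \col_i ((Num.floor (N%:R * a i 0))%:~R / N%:R).
have bZ : N%:R *: b \in @Zlattice R n.
  apply/ZlatticeP; exists (\col_i Num.floor (N%:R * a i 0)).
  by apply/colP => i; rewrite !mxE mulrC divfK // gt_eqF.
have k3 : normc (grid_avg N (fun x => f (x + a)) - grid_avg N f) <= e / 2.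
  rewrite -[X in _ - X](grid_avg_shift N0 gf.1 bZ) -grid_avgB.
  apply: le_trans (normc_grid_avg _ _) _.
  rewrite -(grid_avg_cst R N0 n (e / 2)); apply: ler_grid_avg => x.
  apply: hd; apply: near_ptW k2 _ => i; rewrite !mxE opprD addrACA subrr add0r.
  have := floor_le (N%:R * a i 0); have := floorD1_gt (N%:R * a i 0).
  set m := Num.floor _; rewrite intrD /= => m1 m2.
  have -> : a i 0 - m%:~R / N%:R = (N%:R * a i 0 - m%:~R) / N%:R.
    by rewrite mulrBl mulrAC mulfV ?mul1r // gt_eqF.
  rewrite normrM ger0_norm; last by lra.
  rewrite ger0_norm ?invr_ge0 ?ler0n // ler_piMl ?invr_ge0 ?ler0n //; lra.
have -> : grid_avg N (fun x => f (x + a)) - cube_integralC f =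
  (grid_avg N (fun x => f (x + a)) - grid_avg N f) + (grid_avg N f - cube_integralC f)
    by ring.
by apply: le_trans (normcD _ _) _; lra.
Qed.

Lemma mean_le f h : cont_periodic f -> cont_periodic h ->
  (forall x, normc (f x) <= complex.Re (h x)) ->
  normc (cube_integralC f) <= complex.Re (cube_integralC h).
Proof.
move=> gf gh fh; apply: climit_le (mean_limit gf) (mean_limit gh) _ => N _.
apply: le_trans (normc_grid_avg _ _) _.
by rewrite (ReIm_grid_avg N h).1; apply: ler_grid_avg.
Qed.

End PeriodicMean.

(** * Goursat's theorem for periodic functions *)

Section Trapezoid.
Variable R : realType.
Implicit Types (h : R -> R[i]) (a s : R) (M : nat).

Definition trapezoid M h a s : R[i] :=
  (s / M%:R)%:C * \sum_(j < M) ((h (a + s * (j%:R / M%:R)) + h (a + s * (j.+1%:R /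
    M%:R))) / 2).

(** Halving the interval and the number of panels together keeps the nodes, so additivity is exact
    and not merely asymptotic. *)
Lemma trapezoid_split M h a s : (0 < M)%N ->
  trapezoid (M + M) h a s = trapezoid M h a (s / 2) + trapezoid M h (a + s / 2) (s / 2).
Proof.
move=> M0; have M0r : M%:R != 0 :> R by rewrite pnatr_eq0 -lt0n.
have MM : (M + M)%:R = 2 * M%:R :> R by rewrite natrD; ring.
rewrite /trapezoid big_split_ord mulrDr MM.
have -> : s / (2 * M%:R) = s / 2 / M%:R :> R by rewrite invfM mulrA.
congr (_ * _ + _ * _); apply: eq_bigr => j _ /=; congr ((h _ + h _) / _).
- by field; rewrite M0r.
- by field; rewrite M0r.
- by rewrite natrD; field; rewrite M0r.
- by rewrite -addnS natrD; field; rewrite M0r.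
Qed.

Lemma trapezoidB M h1 h2 a s :
  trapezoid M (fun u => h1 u - h2 u) a s = trapezoid M h1 a s - trapezoid M h2 a s.
Proof.
rewrite /trapezoid -mulrBr -sumrB; congr (_ * _); apply: eq_bigr => j _.
by rewrite -mulrBl; congr (_ / _); ring.
Qed.

Lemma trapezoid_cst M c a s : (0 < M)%N -> trapezoid M (fun=> c) a s = s%:C * c.
Proof.
move=> M0; have M0r : M%:R != 0 :> R by rewrite pnatr_eq0 -lt0n.
have M0c : M%:R != 0 :> R[i] by rewrite pnatr_eq0 -lt0n.
rewrite /trapezoid sumr_const card_ord -mulrnAl -[(_ + _) *+ M]mulr_natr.
by rewrite rmorphM fmorphV rmorph_nat; field; rewrite M0c.
Qed.

Lemma trapezoid_le M h a s B : (0 < M)%N -> 0 <= s -> 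
  (forall u, a <= u <= a + s -> normc (h u) <= B) ->
  normc (trapezoid M h a s) <= s * B.
Proof.
move=> M0 s0 hB; have M0r : 0 < M%:R :> R by rewrite ltr0n.
rewrite /trapezoid normcM normc_real ger0_norm ?divr_ge0 ?ler0n //.
rewrite -mulrA ler_wpM2l // ler_pdivrMl //.
apply: le_trans (normc_sum _ _ _) _.
have -> : M%:R * B = \sum_(j < M) B by rewrite sumr_const card_ord mulr_natl.
apply: ler_sum => j _; rewrite normcM normcV.
have -> : normc (2 : R[i]) = 2.
  by rewrite (_ : 2 = (2 : R)%:C) ?normc_real ?rmorph_nat // ger0_norm.
rewrite ler_pdivrMr //; apply: le_trans (normcD _ _) _.
have in01 (k : nat) : (k <= M)%N -> a <= a + s * (k%:R / M%:R) <= a + s.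
  move=> kM; rewrite lerDl mulr_ge0 ?divr_ge0 ?ler0n //= lerD2l ler_piMr //.
  by rewrite ler_pdivrMr // mul1r ler_nat.
have := hB _ (in01 j (ltnW (ltn_ord j))); have := hB _ (in01 j.+1 (ltn_ord j)); lra.
Qed.

(** The link between contour sums and grid averages: the half weights of the two equal end values
    merge into one full weight. *)
Lemma trapezoid_periodic M h : (0 < M)%N -> h 1 = h 0 ->
  trapezoid M h 0 1 = M%:R^-1 * \sum_(j < M) h (j%:R / M%:R).
Proof.
move=> M0 h10; have M0r : M%:R != 0 :> R by rewrite pnatr_eq0 -lt0n.
rewrite /trapezoid -mulr_suml big_split /=.
have -> : \sum_(j < M) h (0 + 1 * (j.+1%:R / M%:R)) = \sum_(j < M) h (j%:R / M%:R).
  move: M0 M0r; case: M => [//|M] _ M0r.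
  rewrite big_ord_recr [RHS]big_ord_recl /= addrC divff // mul0r add0r mul1r h10.
  by congr (_ + _); apply: eq_bigr => j _; rewrite add0r mul1r.
under eq_bigr do rewrite add0r mul1r.
by rewrite mul1r fmorphV rmorph_nat -mulr2n -[_ *+ 2]mulr_natr mulfK // pnatr_eq0.
Qed.

End Trapezoid.

Section Goursat.
Variables (R : realType) (m : nat) (w : R[i]) (f : 'cV[R]_m -> R -> R -> R[i]).

(** The integral of [f] along the oriented boundary of the parallelogram with corner [a + w b] and
    sides [s] and [w s], computed with [2^k] panels per side; [p] is a parameter. *)
Definition contour k (p : 'cV[R]_m) (a b s : R) : R[i] :=
  trapezoid (2 ^ k) (fun u => f p u b) a s - trapezoid (2 ^ k) (fun u =>
    f p u (b + s)) a s
  + w * (trapezoid (2 ^ k) (f p (a + s)) b s - trapezoid (2 ^ k) (f p a) b s).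

Lemma contour_split k p a b s :
  contour k.+1 p a b s = contour k p a b (s / 2) + contour k p (a + s / 2) b (s / 2)
    + contour k p a (b + s / 2) (s / 2) + contour k p (a + s / 2) (b + s / 2) (s / 2).
Proof.
rewrite /contour expnS mul2n -addnn !trapezoid_split ?expn_gt0 //.
have E c : c + s / 2 + s / 2 = c + s by lra.
by rewrite !E; ring.
Qed.

(** Complex differentiability in the variable [a + w b]. The dependence on [p] may go into an
    arbitrary [c], since a contour is taken at fixed [p]. *)
Hypothesis f_loc : forall (p0 : 'cV[R]_m) (a0 b0 e : R), 0 < e ->
  exists2 d, 0 < d & exists (c : 'cV[R]_m -> R[i]) (A : R[i]), forall r p a b,
    r <= d -> near_pt r p p0 -> `|a - a0| <= r -> `|b - b0| <= r ->
    normc (f p a b - (c p + A * (a%:C + w * b%:C))) <= e * r.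

(* Goursat's bisection, with integrals replaced by dyadic trapezoidal sums: the
   trapezoidal rule is additive under bisection and its contour sum vanishes
   exactly on affine functions of a + w b. *)
Lemma contour_cvg0 e : 0 < e -> exists N, forall k, (N <= k)%N -> forall p : 'cV[R]_m,
  (forall i, 0 <= p i 0 <= 1) -> normc (contour k p 0 0 1) <= e.
Proof.
move=> e0; pose I := ('I_m + bool)%type.
(* The coordinates in ['I_m] confine [p], the two in [bool] are the corner of the parallelogram;
   bisecting all of them makes [N] uniform in [p]. The tolerance is proportional to the area [s^2],
   so the four quarters add up exactly. *)
pose P (q : I -> R) (s : R) := exists N, forall k, (N <= k)%N -> forall p : 'cV[R]_m,
  (forall i, q (inl i) <= p i 0 <= q (inl i) + s) ->
  normc (contour k p (q (inr false)) (q (inr true)) s) <= e * s ^+ 2.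
suff [N hN] : P (fun=> 0) 1.
  by exists N => k /hN h p hp; have := h p; rewrite expr1n mulr1; apply=> i;
    rewrite add0r.
apply: cube_bisection => // [q s s0 hb|q].
  pose hf (q : I -> R) (b : I -> bool) := fun i => q i + (if b i then s / 2 else 0).
  have [D hD] : exists D : {ffun I -> bool} -> nat, forall b k, (D b <= k)%N ->
      forall p : 'cV[R]_m, 
      (forall i, hf q b (inl i) <= p i 0 <= hf q b (inl i) + s / 2) ->
      normc (contour k p (hf q b (inr false)) (hf q b (inr true)) (s / 2)) <= e * (s /
        2) ^+ 2.
    have /choice[D hD] := fun b : {ffun I -> bool} => hb b.
    by exists D => b; exact: hD.
  (* The successor pays for the dyadic level that [contour_split] consumes. *)
  exists (\max_b D b).+1 => -[//|k] hk p hp; rewrite contour_split.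
  have [b hpb] := half_cube hp.
  (* The half-cube of [p] is dictated by [p], while all four choices for the corner are needed. *)
  pose bb (x y : bool) : {ffun I -> bool} := [ffun i => match i with inl i =>
    b i | inr false => x | inr true => y end].
  have hq x y : normc (contour k p (q (inr false) + if x then s / 2 else 0)
      (q (inr true) + if y then s / 2 else 0) (s / 2)) <= e * (s / 2) ^+ 2.
    have := hD (bb x y) k (leq_trans (leq_bigmax _) (hk : (_ <= k)%N)) p.
    rewrite /hf !ffunE; apply=> i; rewrite ffunE; exact: hpb.
  have := hq false false; have := hq false true; have := hq true false;
    have := hq true true.
  rewrite /= !addr0 => h1 h2 h3 h4.
  have -> : e * s ^+ 2 = e * (s / 2) ^+ 2 + e * (s / 2) ^+ 2 + e * (s / 2) ^+ 2 + e *
    (s / 2) ^+ 2 by field.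
  apply: le_trans (normcD _ _) _; apply: lerD _ h1.
  apply: le_trans (normcD _ _) _; apply: lerD _ h3.
  by apply: le_trans (normcD _ _) _; apply: lerD h4 h2.
(* Each pair of opposite sides will contribute at most [2 (e / W) s^2], with weights 1 and [|w|]. *)
pose W := 2 * (1 + normc w).
have W0 : 0 < W by rewrite mulr_gt0 // ltr_wpDr ?normc_ge0.
have [d d0 [c [A hd]]] := f_loc (\col_i q (inl i)) (q (inr false)) (q (inr true))
  (divr_gt0 e0 W0).
exists d => // y s s0 sd hy; exists 0%N => k _ p hp.
set a := y (inr false); set b := y (inr true).
pose h u v := f p u v - (c p + A * (u%:C + w * v%:C)).
have hs u v : a <= u <= a + s -> b <= v <= b + s -> normc (h u v) <= e / W * s.
  move=> hu hv; apply: hd; first exact: ltW.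
  - by move=> i; rewrite mxE ler_norml; have := hy (inl i); have := hp i; lra.
  - by rewrite ler_norml; have := hy (inr false); rewrite -/a; lra.
  - by rewrite ler_norml; have := hy (inr true); rewrite -/b; lra.
have k0 : (0 < 2 ^ k)%N by rewrite expn_gt0.
(* The affine part changes by [- A w s] between the sides in direction 1 and by [A s] between those
   in direction [w]; with the weight [w] these constants cancel, so only the remainder [h] is
   left. *)
have -> : contour k p a b s =
    trapezoid (2 ^ k) (fun u => h u b - h u (b + s)) a s
    + w * trapezoid (2 ^ k) (fun v => h (a + s) v - h a v) b s.
  have -> : (fun u => h u b - h u (b + s)) = (fun u =>
    (f p u b - f p u (b + s)) - (- (A * w * s%:C))).
    by apply/funext => u; rewrite /h rmorphD /=; ring.
  have -> : (fun v => h (a + s) v - h a v) = (fun v =>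
    (f p (a + s) v - f p a v) - A * s%:C).
    by apply/funext => u; rewrite /h rmorphD /=; ring.
  rewrite !trapezoidB !trapezoid_cst // /contour; ring.
have as0 : a <= a <= a + s by rewrite lexx lerDl ltW.
have as1 : a <= a + s <= a + s by rewrite lexx lerDl ltW.
have bs0 : b <= b <= b + s by rewrite lexx lerDl ltW.
have bs1 : b <= b + s <= b + s by rewrite lexx lerDl ltW.
have t1 : normc (trapezoid (2 ^ k) (fun u =>
  h u b - h u (b + s)) a s) <= s * (2 * (e / W * s)).
  apply: trapezoid_le => //; first exact: ltW.
  move=> u hu; apply: le_trans (normcB _ _) _.
  by have := hs u b hu bs0; have := hs u (b + s) hu bs1; lra.
have t2 : normc (trapezoid (2 ^ k) (fun v =>
  h (a + s) v - h a v) b s) <= s * (2 * (e / W * s)).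
  apply: trapezoid_le => //; first exact: ltW.
  move=> u hu; apply: le_trans (normcB _ _) _.
  by have := hs a u as0 hu; have := hs (a + s) u as1 hu; lra.
apply: le_trans (normcD _ _) _.
have -> : e * s ^+ 2 = s * (2 * (e / W * s)) + normc w * (s * (2 * (e / W * s))).
  rewrite /W; field; rewrite gt_eqF // ltr_wpDr ?normc_ge0 //.
by apply: lerD => //; rewrite normcM; apply: ler_wpM2l t2; exact: normc_ge0.
Qed.

End Goursat.

(** * Complex differentiability and complex translations of means *)

Section ComplexDifferentiable.
Variables (R : realType) (g : nat).
Implicit Types (F : 'cV[R[i]]_g -> R[i]) (z h : 'cV[R[i]]_g).

(** Differentiability for the sup norm, with a real [r] bounding all entries of [h] so that every
    estimate is real; [L] lists the partial derivatives. [differentiable_cdiff] shows the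
    equivalence with [differentiable]. *)
Definition cdiff F z := exists L : 'I_g -> R[i], forall e : R, 0 < e ->
  exists2 d : R, 0 < d & forall h r, 0 <= r <= d -> (forall i, normc (h i 0) <= r) ->
    normc (F (z + h) - F z - \sum_i L i * h i 0) <= e * r.

Lemma normc_linear_form_le (L : 'I_g -> R[i]) h (r : R) :
  (forall i, normc (h i 0) <= r) ->
  normc (\sum_i L i * h i 0) <= (\sum_i normc (L i)) * r.
Proof.
move=> hr; apply: le_trans (normc_sum _ _ _) _; rewrite mulr_suml.
by apply: ler_sum => i _; rewrite normcM ler_wpM2l ?normc_ge0.
Qed.

Lemma cdiff_continuous F z e : cdiff F z -> 0 < e -> exists2 d, 0 < d &
  forall h, (forall i, normc (h i 0) <= d) -> normc (F (z + h) - F z) <= e.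
Proof.
move=> [L /(_ 1 ltr01)[d d0 hd]] e0; pose S := \sum_i normc (L i) + 1.
have S0 : 0 < S by rewrite ltr_wpDl // sumr_ge0 // => i _; exact: normc_ge0.
exists (Num.min d (e / S)); first by rewrite lt_min d0 divr_gt0.
move=> h hh; set r := Num.min d (e / S) in hh.
have rd : 0 <= r <= d.
  by apply/andP; split; [rewrite le_min !ltW ?divr_gt0|rewrite ge_min lexx].
have re : r <= e / S by rewrite ge_min lexx orbT.
have h1 := hd h r rd hh; have h2 := normc_linear_form_le L hh.
rewrite -[F (z + h) - F z](subrK (\sum_i L i * h i 0)).
apply: le_trans (normcD _ _) _; apply: le_trans (lerD h1 h2) _.
by rewrite -mulrDl addrC -/S mulrC -ler_pdivlMr.
Qed.

Lemma cont_comp_cdiff F n (phi : 'cV[R]_n -> 'cV[R[i]]_g) :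
  (forall z, cdiff F z) -> (forall i, cont (fun x => phi x i 0)) ->
  cont (fun x => F (phi x)).
Proof.
move=> dF cphi x e e0; have [d d0 hd] := cdiff_continuous (dF (phi x)) e0.
have [//|i|d' d'0 h] := @finite_uniform R 'I_g (fun i d' => forall y, near_pt d' x y ->
    normc (phi x i 0 - phi y i 0) <= d).
- move=> i d1 d2 d12 h y xy; apply: h; exact: near_ptW xy.
- by have [d1 d10 h] := cphi i x d d0; exists d1.
exists d' => // y xy; have -> : phi y = phi x + (phi y - phi x) by rewrite addrC subrK.
by rewrite normcBC; apply: hd => i; rewrite !mxE normcBC; exact: h.
Qed.

Lemma cont_real_shift F w : (forall z, cdiff F z) -> cont (fun x => F (w + x%:mxC)).
Proof.
move=> dF; apply: cont_comp_cdiff => // i.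
have -> : (fun x : 'cV[R]_g => (w + x%:mxC) i 0) = (fun x => w i 0 + (x i 0)%:C).
  by apply/funext => x; rewrite !mxE.
by apply: contD; [exact: cont_cst|exact: cont_coord].
Qed.

Section Periodic.
Variable F : 'cV[R[i]]_g -> R[i].
Hypothesis dF : forall z, cdiff F z.
Hypothesis pF : forall l z, l \in @Zlattice R g -> F (z + l%:mxC) = F z.

Lemma cont_periodic_real_shift w : cont_periodic (fun x => F (w + x%:mxC)).
Proof.
split; last exact: cont_real_shift.
by move=> x l lZ; rewrite map_mxD addrA (pF _ lZ).
Qed.

Lemma delta_lattice (i : 'I_g) : (delta_mx i 0 : 'cV[R]_g) \in @Zlattice R g.
Proof. by apply/ZlatticeP; exists (delta_mx i 0); rewrite map_delta_mx. Qed.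

(** The contour is a parallelogram in the [i]-th coordinate with sides 1 and [c]. Its sides in
    direction [c] cancel by periodicity, the other two are averages of the two integrands along a
    line, and averaging over the base point [p] gives both means. *)
Lemma mean_shift_coord (i : 'I_g) (c : R[i]) w :
  cube_integralC (fun x => F (w + x%:mxC)) =
  cube_integralC (fun x => F (w + c *: delta_mx i 0 + x%:mxC)).
Proof.
pose f (p : 'cV[R]_g) (a b : R) := F (w + p%:mxC + (a%:C + c * b%:C) *: delta_mx i 0).
have f_loc (p0 : 'cV[R]_g) (a0 b0 e : R) : 0 < e ->
  exists2 d, 0 < d & exists (C : 'cV[R]_g -> R[i]) (A : R[i]), forall r p a b,
    r <= d -> near_pt r p p0 -> `|a - a0| <= r -> `|b - b0| <= r ->
    normc (f p a b - (C p + A * (a%:C + c * b%:C))) <= e * r.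
  move=> e0; pose z0 := w + p0%:mxC + (a0%:C + c * b0%:C) *: delta_mx i 0.
  (* The entries of the displacement [h] are at most [|p - p0| + |a - a0| + |c| |b - b0|], hence at
     most [(2 + |c|) r]. *)
  have W0 : 0 < 2 + normc c by rewrite ltr_wpDr ?normc_ge0.
  have [L /(_ (e / (2 + normc c)) (divr_gt0 e0 W0))[d d0 hd]] := dF z0.
  exists (d / (2 + normc c)); first exact: divr_gt0.
  exists (fun p => F z0 + \sum_j L j * (p j 0 - p0 j 0)%:C - L i * (a0%:C + c *
    b0%:C)), (L i).
  move=> r p a b rd pp0 aa0 bb0; have r0 := le_trans (normr_ge0 _) aa0.
  pose h : 'cV[R[i]]_g := (p - p0)%:mxC + ((a - a0)%:C + c * (b - b0)%:C) *: delta_mx i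
    0.
  have zh : z0 + h = w + p%:mxC + (a%:C + c * b%:C) *: delta_mx i 0.
    by apply/colP => j; rewrite !mxE !rmorphB /=; ring.
  have -> : f p a b - (F z0 + \sum_j L j * (p j 0 - p0 j 0)%:C - L i * (a0%:C + c *
    b0%:C)
       + L i * (a%:C + c * b%:C)) = F (z0 + h) - F z0 - \sum_j L j * h j 0.
    have -> : \sum_j L j * h j 0 = \sum_j L j * (p j 0 - p0 j 0)%:C +
        L i * ((a - a0)%:C + c * (b - b0)%:C).
      rewrite [X in _ + X](_ : _ = \sum_j (if j == i then L j * ((a - a0)%:C + c * (b -
        b0)%:C) else 0)).
        rewrite -big_split; apply: eq_bigr => j _; rewrite !mxE eqxx andbT.
        by case: eqP => _ /=; rewrite ?mulr1 ?mulr0 ?addr0 ?mulrDr // addr0.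
      by rewrite -big_mkcond big_pred1_eq.
    by rewrite zh /f !rmorphB /=; ring.
  have -> : e * r = e / (2 + normc c) * (r * (2 + normc c)).
    by rewrite mulrACA mulVf ?mulr1 // gt_eqF.
  apply: hd; first by rewrite mulr_ge0 ?(ltW W0) //= -ler_pdivlMr.
  move=> j; rewrite !mxE eqxx andbT; apply: le_trans (normcD _ _) _.
  have j1 : normc (p j 0 - p0 j 0)%:C <= r by rewrite normc_real.
  have j2 : normc (((a - a0)%:C + c * (b - b0)%:C) * (j == i)%:R) <= r * (1 + normc c).
    apply: (@le_trans _ _ (normc ((a - a0)%:C + c * (b - b0)%:C))).
      by case: eqP => _; rewrite ?mulr1 // mulr0 normc0 normc_ge0.
    apply: le_trans (normcD _ _) _; rewrite normcM !normc_real mulrDr mulr1 lerD //.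
    by rewrite mulrC ler_wpM2r ?normc_ge0.
  lra.
have g1 := cont_periodic_real_shift w.
have g2 := cont_periodic_real_shift (w + c *: delta_mx i 0).
apply: normc_eq_eps => e e0; have e2 : 0 < e / 2 by rewrite divr_gt0.
pose D x := F (w + x%:mxC) + (-1) * F (w + c *: delta_mx i 0 + x%:mxC).
have g3 : cont_periodic (fun x : 'cV[R]_g => (-1) * F (w + c *: delta_mx i 0 + x%:mxC)).
  exact: cont_periodicM (cont_periodic_cst _ _) g2.
have gD : cont_periodic D by exact: cont_periodicD.
have -> : cube_integralC (fun x => F (w + x%:mxC)) -
    cube_integralC (fun x => F (w + c *: delta_mx i 0 + x%:mxC)) = cube_integralC D.
  by rewrite meanD // meanZ // mulN1r.
have [N1 h1] := mean_limit gD e2.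
have [N2 h2] := contour_cvg0 f_loc e2.
(* One dyadic grid serves both limits: [k] passes the threshold of the contour, and [M = 2^k >= k]
   that of the mean. *)
pose k := maxn N1 N2; pose M := (2 ^ k)%N.
have M0 : (0 < M)%N by rewrite expn_gt0.
have Mr : M%:R != 0 :> R by rewrite pnatr_eq0 -lt0n.
have kM : (k <= M)%N by rewrite ltnW // ltn_expl.
have k1 := h1 M (leq_trans (leq_maxl N1 N2) kM).
suff k2 : normc (grid_avg M D) <= e / 2.
  rewrite -[cube_integralC D](subKr (grid_avg M D)).
  by apply: le_trans (normcB _ _) _; lra.
have step (x : 'cV[R]_g) : normc (M%:R^-1 * \sum_(j < M) D (x + (j%:R / M%:R) *:
  delta_mx i 0)) <= e / 2.
  have pE : lattice_periodic (fun x =>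
    M%:R^-1 * \sum_(j < M) D (x + (j%:R / M%:R) *: delta_mx i 0)).
    move=> y l lZ; congr (_ * _); apply: eq_bigr => j _.
    by rewrite (addrAC y l) (gD.1 _ l lZ).
  have [l lZ hl] := unit_cube_representative x.
  rewrite -(pE x l lZ); have := h2 k (leq_maxr _ _) (x + l) hl.
  rewrite /contour -/M.
  have per b : f (x + l) 1 b = f (x + l) 0 b.
    rewrite /f -(pF (w + (x + l)%:mxC + (0%:C + c * b%:C) *: delta_mx i 0)
      (delta_lattice i)).
    rewrite map_delta_mx -[in RHS]addrA; congr (F (_ + _)).
    rewrite -[X in _ = _ + X]scale1r -scalerDl; congr (_ *: _).
    by rewrite rmorph1 rmorph0; ring.
  have -> : f (x + l) (0 + 1) = f (x + l) 0.
    by apply/funext => b; rewrite add0r per.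
  rewrite subrr mulr0 addr0.
  rewrite !trapezoid_periodic // -mulrBr -sumrB.
  congr (normc (_ * _) <= _); apply: eq_bigr => j _; rewrite /D mulN1r /f.
  rewrite add0r rmorph0 rmorph1 mulr0 mulr1 addr0; congr (F _ - F _).
    by rewrite (map_mxD _ (x + l)) map_mxZ map_delta_mx addrA.
  by apply/colP => i'; rewrite !mxE !rmorphD rmorphM /= rmorph_nat; ring.
(* Averaging first along direction [i] leaves the grid average unchanged, because these shifts are
   grid vectors. *)
have -> : grid_avg M D = grid_avg M (fun x =>
  M%:R^-1 * \sum_(j < M) D (x + (j%:R / M%:R) *: delta_mx i 0)).
  rewrite grid_avgZ grid_avg_sum.
  have E (j : 'I_M) : grid_avg M (fun x =>
    D (x + (j%:R / M%:R) *: delta_mx i 0)) = grid_avg M D.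
    apply: grid_avg_shift => //; first exact: gD.1.
    rewrite scalerA mulrC divfK // scaler_nat rpredMn //; exact: delta_lattice.
  rewrite (eq_bigr _ (fun j _ => E j)) sumr_const card_ord -[grid_avg M D *+
    M]mulr_natl mulrA.
  by rewrite mulVf ?mul1r // pnatr_eq0 -lt0n.
apply: le_trans (normc_grid_avg _ _) _.
by rewrite -[leRHS](grid_avg_cst R M0 g); exact: ler_grid_avg.
Qed.

Lemma mean_complex_shift v :
  cube_integralC (fun x => F (v + x%:mxC)) = cube_integralC (fun x => F (x%:mxC)).
Proof.
have -> : v = \sum_(i <- enum 'I_g) v i 0 *: delta_mx i 0.
  apply/colP => j; rewrite summxE big_enum (bigD1 j) //= !mxE !eqxx mulr1 big1 ?addr0
    //.
  by move=> i ij; rewrite !mxE eq_sym (negbTE ij) mulr0.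
elim: (enum 'I_g) => [|i s IH].
  by rewrite big_nil; congr cube_integralC; apply/funext => x; rewrite add0r.
by rewrite big_cons addrC -mean_shift_coord.
Qed.

End Periodic.
End ComplexDifferentiable.

(** * Uniqueness of Fourier coefficients *)

Section Pairing.
Variables (A : comNzRingType) (g : nat).
Implicit Types x y z : 'cV[A]_g.

Lemma pairingE x y : pairing x y = \sum_i x i 0 * y i 0.
Proof. by rewrite /pairing mxE; apply: eq_bigr => i _; rewrite mxE. Qed.

Lemma pairingC x y : pairing x y = pairing y x.
Proof. by rewrite !pairingE; apply: eq_bigr => i _; rewrite mulrC. Qed.

Lemma pairingDl x y z : pairing (x + y) z = pairing x z + pairing y z.
Proof. by rewrite !pairingE -big_split; apply: eq_bigr => i _; rewrite mxE mulrDl. Qed.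

Lemma pairingDr x y z : pairing x (y + z) = pairing x y + pairing x z.
Proof. by rewrite !(pairingC x) pairingDl. Qed.

Lemma pairingZl a x y : pairing (a *: x) y = a * pairing x y.
Proof. by rewrite !pairingE mulr_sumr; apply: eq_bigr => i _; rewrite mxE mulrA. Qed.

Lemma pairingZr a x y : pairing x (a *: y) = a * pairing x y.
Proof. by rewrite !(pairingC x) pairingZl. Qed.

Lemma pairingNl x y : pairing (- x) y = - pairing x y.
Proof. by rewrite -scaleN1r pairingZl mulN1r. Qed.

Lemma pairing0l x : pairing 0 x = 0.
Proof. by rewrite -(scale0r 0) pairingZl mul0r. Qed.

Lemma pairing_mulmx (m : nat) (M : 'M[A]_(g, m)) x (y : 'cV[A]_m) :
  pairing x (M *m y) = pairing (M^T *m x) y.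
Proof. by rewrite /pairing trmx_mul trmxK mulmxA. Qed.

End Pairing.

Lemma pairing_map (A B : comNzRingType) (f : {rmorphism A ->
  B}) (g : nat) (x y : 'cV[A]_g) :
  pairing (map_mx f x) (map_mx f y) = f (pairing x y).
Proof. by rewrite /pairing map_trmx -map_mxM mxE. Qed.

Section Characters.
Variables (R : realType) (g : nat).
Implicit Types (m n : 'cV[int]_g).

Lemma cunit0 : cunit (0 : R) = 1.
Proof. by rewrite /cunit rmorph0 mulr0 cexp0. Qed.

Lemma cunit_cos (x : R) : cunit x = cos (2 * pi * x) +i* sin (2 * pi * x).
Proof.
rewrite /cunit /cexp /piC.
have -> : 2%:R * 'i%C * pi%:C * x%:C = 0 +i* (2 * pi * x).
  have -> : (2%:R : R[i]) = (2 : R)%:C by rewrite rmorph_nat.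
  by apply/eqP; rewrite eq_complex /=; apply/andP; split; apply/eqP; ring.
by rewrite /= expR0 !mul1r.
Qed.

Definition rchar m (x : 'cV[R]_g) : R[i] := cunit (pairing m%:mx[R] x).

Definition echar m (z : 'cV[R[i]]_g) : R[i] :=
  cexp (2%:R * 'i%C * piC R * pairing m%:mx[R[i]] z).

Lemma echar_real m x : echar m x%:mxC = rchar m x.
Proof.
rewrite /echar /rchar /cunit; congr cexp; congr (_ * _).
rewrite -pairing_map; congr pairing.
by apply/colP => i; rewrite !mxE rmorph_int.
Qed.

Lemma rcharD m n x : rchar (m + n) x = rchar m x * rchar n x.
Proof. by rewrite /rchar map_mxD pairingDl cunitD. Qed.

Lemma echarD m z w : echar m (z + w) = echar m z * echar m w.
Proof. by rewrite /echar pairingDr mulrDr cexpD. Qed.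

Lemma rchar_cont_periodic m : cont_periodic (rchar m).
Proof.
split.
  move=> x l /ZlatticeP[k ->]; rewrite /rchar pairingDr cunitD pairing_map.
  by rewrite cunit_int mulr1.
apply: cont_cexp; apply: contM; first exact: cont_cst.
have -> : (fun x : 'cV[R]_g => (pairing m%:mx[R] x)%:C) =
  (fun x => \sum_i (m i 0)%:~R * (x i 0)%:C).
  apply/funext => x; rewrite pairingE rmorph_sum /=; apply: eq_bigr => i _.
  by rewrite !mxE rmorphM /= rmorph_int.
apply: cont_sum => i; apply: contM; [exact: cont_cst|exact: cont_coord].
Qed.

End Characters.

Section FourierUniqueness.
Variables (R : realType) (n : nat).

Lemma count_le (N : nat) (y : R) : y <= N%:R ->
  y <= \sum_(j < N) (if j%:R <= y then 1 else 0).
Proof.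
elim: N => [|N IH] hy; first by rewrite big_ord0.
rewrite big_ord_recr /=; have [yN|Ny] := leP y N%:R.
  by apply: le_trans (IH yN) _; rewrite lerDl; case: ifP => _; rewrite ?ler01.
have -> : \sum_(j < N) (if j%:R <= y then 1 else 0) = N%:R :> R.
  rewrite -[in RHS](card_ord N) -sum1_card natr_sum; apply: eq_bigr => j _.
  by rewrite (le_trans _ (ltW Ny)) // ler_nat ltnW.
by rewrite (ltW Ny) natr1.
Qed.

(** At least [N d] of the values [j / N] lie in [[0, d]], since [j = 0] counts; so the bound does
    not depend on [N]. *)
Lemma grid_avg_lower_bound (m : nat) (h : 'cV[R]_m -> R) (B d : R) (N : nat) :
  (0 < N)%N -> 0 <= B -> 0 <= d <= 1 -> (forall x, 0 <= h x) ->
  (forall x : 'cV[R]_m, (forall i, 0 <= x i 0 <= d) -> B <= h x) ->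
  B * d ^+ m <= grid_avg N h.
Proof.
move=> N0 B0 /andP[d0 d1]; have Nr : 0 < N%:R :> R by rewrite ltr0n.
elim: m h => [|m IH] h h0 hB /=.
  by rewrite expr0 mulr1; apply: hB => -[].
rewrite exprSr mulrA ler_pdivlMl // mulrCA.
have hd : N%:R * d <= N%:R by rewrite ler_piMr.
apply: le_trans (ler_wpM2l _ (count_le hd)) _ => //.
  by rewrite mulr_ge0 // exprn_ge0.
rewrite mulr_sumr; apply: ler_sum => j _; case: ifP => [jd|_]; last first.
  by rewrite mulr0 -(grid_avg_cst R N0 m 0); apply: ler_grid_avg => v; exact: h0.
rewrite mulr1; apply: IH => // v hv; apply: hB => i.
rewrite -[m.+1]/(1 + m)%N in i *; case: (splitP i) => k ik.
  have -> : i = lshift m k by apply: val_inj.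
  by rewrite col_mxEu mxE divr_ge0 ?ler0n // ler_pdivrMr // mulrC.
by have -> : i = rshift 1 k by [apply: val_inj]; rewrite col_mxEd.
Qed.

(** A trigonometric polynomial with values in [0,1], equal to 1 exactly where the [i]-th coordinate
    is an integer. *)
Definition hump (i : 'I_n) (x : 'cV[R]_n) : R := (1 + cos (2 * pi * x i 0)) / 2.

Lemma hump_char i x : (hump i x)%:C =
  (2 + rchar (delta_mx i 0) x + rchar (- delta_mx i 0) x) / 4.
Proof.
have pE : pairing (delta_mx i 0)%:mx[R] x = x i 0.
  rewrite pairingE (bigD1 i) //= !mxE !eqxx mul1r big1 ?addr0 // => j ij.
  by rewrite !mxE (negbTE ij) mul0r.
rewrite /rchar map_mxN pairingNl pE !cunit_cos mulrN cosN sinN.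
apply: (mulIf (_ : (4 : R[i]) != 0)); first by rewrite pnatr_eq0.
rewrite divfK ?pnatr_eq0 // /hump.
have -> : (4 : R[i]) = (4 : R)%:C by rewrite rmorph_nat.
have -> : (2 : R[i]) = (2 : R)%:C by rewrite rmorph_nat.
by apply/eqP; rewrite eq_complex /=; apply/andP; split; apply/eqP; field.
Qed.

Lemma hump_bounds i x : 0 <= hump i x <= 1.
Proof. by have := cos_geN1 (2 * pi * x i 0); have := cos_le1 (2 * pi * x i 0);
  rewrite /hump; lra. Qed.

Lemma hump_cont_periodic i : cont_periodic (fun x => (hump i x)%:C).
Proof.
have -> : (fun x => (hump i x)%:C) = fun x =>
  (2 + rchar (delta_mx i 0) x + rchar (- delta_mx i 0) x) * 4^-1.
  by apply/funext => x; exact: hump_char.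
apply: cont_periodicM (cont_periodic_cst _ _);
  apply: cont_periodicD (rchar_cont_periodic _ _).
by apply: cont_periodicD (rchar_cont_periodic _ _); exact: cont_periodic_cst.
Qed.

Definition humps (x : 'cV[R]_n) : R := \prod_i hump i x.

Lemma humps_ge0 x : 0 <= humps x.
Proof. by apply: prodr_ge0 => i _; case/andP: (hump_bounds i x). Qed.

Lemma humps_le i x : humps x <= hump i x.
Proof.
rewrite /humps (bigD1 i) //= ler_piMr //; first by case/andP: (hump_bounds i x).
by apply: prodr_ile1 => j _; exact: hump_bounds.
Qed.

Section Vanishing.
Variable f : 'cV[R]_n -> R[i].
Hypothesis gf : cont_periodic f.
Hypothesis f_coef0 : forall m, cube_integralC (fun x => f x * rchar m x) = 0.

Let annihilated (p : 'cV[R]_n -> R[i]) := cont_periodic p /\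
  forall m, cube_integralC (fun x => f x * p x * rchar m x) = 0.

(** Multiplication by a hump only mixes the frequencies [m], [m + e_i] and [m - e_i], so all
    coefficients stay zero. *)
Let annihilated_hump p i : annihilated p -> annihilated (fun x => p x * (hump i x)%:C).
Proof.
move=> [gp hp]; split; first exact: cont_periodicM (hump_cont_periodic i).
move=> m.
have gm k : cont_periodic (fun x => 4^-1 * (f x * p x * rchar k x)).
  apply: cont_periodicM (cont_periodic_cst _ _) _.
  by apply: cont_periodicM (cont_periodicM gf gp) (rchar_cont_periodic _ _).
have g2 : cont_periodic (fun x => 2 * (4^-1 * (f x * p x * rchar m x))).
  exact: cont_periodicM (cont_periodic_cst _ _) (gm _).
have hm k : cube_integralC (fun x => 4^-1 * (f x * p x * rchar k x)) = 0.
  rewrite meanZ ?hp ?mulr0 //.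
  by apply: cont_periodicM (cont_periodicM gf gp) (rchar_cont_periodic _ _).
have -> : (fun x => f x * (p x * (hump i x)%:C) * rchar m x) =
    (fun x => 2 * (4^-1 * (f x * p x * rchar m x)) + 4^-1 * (f x * p x * rchar (m +
      delta_mx i 0) x)
       + 4^-1 * (f x * p x * rchar (m - delta_mx i 0) x)).
  by apply/funext => x; rewrite hump_char !rcharD; ring.
have g3 := cont_periodicD g2 (gm (m + delta_mx i 0)).
by rewrite (meanD g3 (gm _)) (meanD g2 (gm _)) (meanZ _ (gm _)) !hm mulr0 !addr0.
Qed.

Let annihilated_humps k : annihilated (fun x => (humps x ^+ k)%:C).
Proof.
elim: k => [|k IH].
  have -> : (fun x => (humps x ^+ 0)%:C) = (fun=> 1).
    by apply/funext => x; rewrite expr0 rmorph1.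
  split; first exact: cont_periodic_cst.
  by move=> m; under eq_fun do rewrite mulr1; exact: f_coef0.
have : forall s : seq 'I_n, annihilated (fun x =>
  (humps x ^+ k * \prod_(i <- s) hump i x)%:C).
  elim=> [|i s IHs].
    have -> // : (fun x => (humps x ^+ k * \prod_(i <- [::]) hump i x)%:C) = (fun x =>
      (humps x ^+ k)%:C).
    by apply/funext => x; rewrite big_nil mulr1.
  have -> : (fun x => (humps x ^+ k * \prod_(j <- i :: s) hump j x)%:C) =
     (fun x => (humps x ^+ k * \prod_(j <- s) hump j x)%:C * (hump i x)%:C).
    by apply/funext => x; rewrite big_cons -rmorphM /= mulrCA mulrC.
  exact: annihilated_hump.
move=> /(_ (index_enum 'I_n)).
have -> // : (fun x => (humps x ^+ k * \prod_(i <- index_enum 'I_n) hump i x)%:C) =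
  (fun x => (humps x ^+ k.+1)%:C).
by apply/funext => x; rewrite exprSr.
Qed.

Lemma hump_away i (x : 'cV[R]_n) (d : R) : 0 < d -> d <= 1 / 2 ->
  d <= `|x i 0| <= 1 / 2 ->
  hump i x <= (1 + cos (2 * pi * d)) / 2.
Proof.
move=> d0 d2 /andP[xd x2]; rewrite /hump ler_pM2r ?invr_gt0 // lerD2l.
have -> : cos (2 * pi * x i 0) = cos (2 * pi * `|x i 0|).
  by case: (ger0P (x i 0)) => _; rewrite ?mulrN ?cosN.
have pi0 := pi_gt0 R.
have in0pi (y : R) : 0 <= y -> y <= 1 / 2 -> 2 * pi * y \in `[0, pi]%R.
  by move=> y0 y1; rewrite in_itv /= mulr_ge0 ?mulr_ge0 ?(ltW pi0) //=; nra.
rewrite leNgt ltr_cos ?in0pi ?normr_ge0 ?(ltW d0) // -leNgt.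
by rewrite ler_wpM2l // mulr_ge0 // ltW.
Qed.

(* The powers of [humps] concentrate at the lattice points. *)
Lemma fourier_unique0 : f 0 = 0.
Proof.
apply: normc_le_eps => e e0; rewrite leNgt; apply/negP => fe.
have [d1 d10 hd1] := gf.2 0 e e0.
pose d := Num.min d1 (1 / 2).
have d0 : 0 < d by rewrite lt_min d10 /=; lra.
have dd1 : d <= d1 by rewrite ge_min lexx.
have d2 : d <= 1 / 2 by rewrite ge_min lexx orbT.
pose rho := (1 + cos (2 * pi * d)) / 2.
have pi0 := pi_gt0 R.
have rho1 : rho < 1.
  suff : cos (2 * pi * d) < cos 0 by rewrite cos0 /rho; lra.
  have p0 : 0 < 2 * pi * d by rewrite !mulr_gt0.
  rewrite ltr_cos // in_itv /= ?lexx ?(ltW pi0) ?(ltW p0) //=; nra.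
have rho0 : 0 <= rho by rewrite /rho; have := cos_geN1 (2 * pi * d); lra.
(* After reduction to the cell [|x_i| <= 1/2], either every coordinate is below [d], or one of them
   is not and its hump alone is at most [rho]. *)
have dich x : normc (f x - f 0) <= e \/ humps x <= rho.
  pose l : 'cV[R]_n := \col_i (- (Num.floor (x i 0 + 1 / 2))%:~R).
  have lZ : l \in @Zlattice R n.
    by apply/ZlatticeP; exists (\col_i - Num.floor (x i 0 + 1 / 2)); apply/colP => i;
      rewrite !mxE intrN.
  have gh : humps (x + l) = humps x.
    apply: eq_bigr => i _; have := (hump_cont_periodic i).1 x l lZ.
    by move/(congr1 (@complex.Re R)).
  have xl i : `|(x + l) i 0| <= 1 / 2.
    rewrite !mxE ler_norml; have := floor_le (x i 0 + 1 / 2).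
    have := floorD1_gt (x i 0 + 1 / 2); rewrite intrD /=; lra.
  have [h|/existsNP[i /negP]] := pselect (forall i, `|(x + l) i 0| < d).
    left; rewrite -(gf.1 x l lZ) normcBC; apply: hd1 => i.
    by rewrite mxE sub0r normrN; apply: le_trans dd1; apply: ltW.
  rewrite -leNgt => hi; right.
  by rewrite -gh; apply: le_trans (humps_le i _) _; apply: hump_away => //; rewrite hi;
    exact: xl.
(* [rho'] lies strictly between [rho] and 1: [humps] is at least [rho'] on a small cube at the
   origin, so the mean of [humps^k] decays no faster than [rho'^k]. *)
pose rho' := (1 + rho) / 2.
have hlow : exists2 t : R, 0 < t <= 1 & forall x : 'cV[R]_n, (forall i,
  0 <= x i 0 <= t) -> rho' <= humps x.
  have ch : cont (fun x => (humps x)%:C).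
    have [[_]] := annihilated_humps 1; by under eq_fun do rewrite expr1.
  have r0 : 0 < 1 - rho' by rewrite /rho'; lra.
  have [t t0 ht] := ch 0 _ r0.
  exists (Num.min t 1); first by rewrite lt_min t0 ltr01 ge_min lexx orbT.
  move=> x hx; have : normc ((humps 0)%:C - (humps x)%:C) <= 1 - rho'.
    apply: ht => i; rewrite mxE sub0r normrN.
    case/andP: (hx i) => x0; rewrite le_min => /andP[xt _].
    by rewrite ger0_norm.
  have -> : humps 0 = 1.
    rewrite /humps big1 // => i _; rewrite /hump mxE mulr0 cos0; lra.
  by rewrite -rmorphB normc_real ler_norml; lra.
have [t /andP[t0 t1] ht] := hlow.
have [M M0 hM] := cont_periodic_bounded gf.
pose M' := 2 * M.
pose c k := complex.Re (cube_integralC (fun x => (humps x ^+ k)%:C)).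
have rho'0 : 0 < rho' by rewrite /rho'; lra.
have lowc k : rho' ^+ k * t ^+ n <= c k.
  have [gk _] := annihilated_humps k.
  have B0 : 0 <= rho' ^+ k * t ^+ n by rewrite mulr_ge0 ?exprn_ge0 // ltW.
  have h : normc (rho' ^+ k * t ^+ n)%:C <= c k; last first.
    by move: h; rewrite normc_real ger0_norm.
  apply: climit_le (climit_cst _) (mean_limit gk) _ => N N0.
  rewrite normc_real ger0_norm // (ReIm_grid_avg N _).1 /=.
  apply: grid_avg_lower_bound => //.
  - by rewrite exprn_ge0 // ltW.
  - by rewrite (ltW t0).
  - by move=> x; rewrite exprn_ge0 // humps_ge0.
  - by move=> x hx; apply: lerXn2r; rewrite ?nnegrE ?humps_ge0 ?(ltW rho'0) // ht.
(* As the mean of [f humps^k] vanishes, [f 0] times the mean of [humps^k] is minus the mean of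
   [(f - f 0) humps^k]; that integrand is at most [e humps^k] near the lattice and [2 M rho^k]
   elsewhere. *)
have upc k : normc (f 0) * c k <= e * c k + M' * rho ^+ k.
  have [gk hk] := annihilated_humps k.
  have g1 : cont_periodic (fun x => (f x - f 0) * (humps x ^+ k)%:C).
    by apply: cont_periodicM gk; apply: cont_periodicD => //; exact: cont_periodic_cst.
  have g2 : cont_periodic (fun x => f 0 * (humps x ^+ k)%:C).
    exact: cont_periodicM (cont_periodic_cst _ _) gk.
  have s0 : cube_integralC (fun x => (f x - f 0) * (humps x ^+ k)%:C) +
      f 0 * cube_integralC (fun x => (humps x ^+ k)%:C) = 0.
    rewrite -(meanZ _ gk) -meanD //; have := hk 0.
    by congr (cube_integralC _ = _); apply/funext => x;
      rewrite /rchar map_mx0 pairing0l cunit0; ring.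
  have cE : cube_integralC (fun x => (humps x ^+ k)%:C) = (c k)%:C.
    have ck0 : cube_integral (fun x : 'cV[R]_n => complex.Im (humps x ^+ k)%:C) = 0.
      transitivity (complex.Im (cube_integralC (fun _ : 'cV[R]_n => 0 : R[i]))) => //.
      by rewrite mean_cst.
    by apply/eqP; rewrite eq_complex eqxx /= -[X in _ == X]ck0.
  have ck0 : 0 <= c k by apply: le_trans (lowc k); rewrite mulr_ge0 ?exprn_ge0 // ltW.
  have g3 : cont_periodic (fun x => e%:C * (humps x ^+ k)%:C + (M' * rho ^+ k)%:C).
    apply: cont_periodicD (cont_periodic_cst _ _).
    exact: cont_periodicM (cont_periodic_cst _ _) gk.
  have g4 : cont_periodic (fun x => e%:C * (humps x ^+ k)%:C).
    exact: cont_periodicM (cont_periodic_cst _ _) gk.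
  have hx x : normc ((f x - f 0) * (humps x ^+ k)%:C) <=
      complex.Re (e%:C * (humps x ^+ k)%:C + (M' * rho ^+ k)%:C).
    rewrite -rmorphM -rmorphD /= normcM normc_real ger0_norm ?exprn_ge0 ?humps_ge0 //.
    have hk0 : 0 <= humps x ^+ k by rewrite exprn_ge0 ?humps_ge0.
    have rk0 : 0 <= M' * rho ^+ k by rewrite mulr_ge0 ?exprn_ge0 // /M' mulr_ge0 ?(ltW
      M0).
    case: (dich x) => [h|h].
      by apply: (@le_trans _ _ (e * humps x ^+ k)); rewrite ?ler_wpM2r ?lerDl.
    apply: (@le_trans _ _ (M' * rho ^+ k)); last by rewrite lerDr mulr_ge0 // ltW.
    apply: ler_pM => //; rewrite ?normc_ge0 //.
      by apply: le_trans (normcB _ _) _; rewrite /M'; have := hM x; have := hM 0; lra.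
    by apply: lerXn2r; rewrite ?nnegrE ?humps_ge0.
  have := mean_le g1 g3 hx.
  move/eqP: s0; rewrite addr_eq0 => /eqP ->.
  rewrite normcNr cE normcM normc_real (ger0_norm ck0).
  rewrite meanD ?meanZ ?mean_cst ?cE //; last exact: cont_periodic_cst.
  by rewrite -rmorphM -rmorphD.
(* The two bounds combine to [(|f 0| - e) t^n <= M' r^k], which fails for large [k]. *)
pose r := rho / rho'.
have r0 : 0 <= r by rewrite divr_ge0 // ltW.
have r1 : `|r| < 1 by rewrite ger0_norm // ltr_pdivrMr // mul1r /rho'; lra.
have /cvgrPdist_lt/(_ ((normc (f 0) - e) * t ^+ n / M')) := cvg_expr r1.
have M'0 : 0 < M' by rewrite /M' mulr_gt0.
have pos : 0 < (normc (f 0) - e) * t ^+ n / M'.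
  by rewrite divr_gt0 // mulr_gt0 ?exprn_gt0 // subr_gt0.
move=> /(_ pos) [k _ /(_ k (leqnn k))] /=.
rewrite sub0r normrN ger0_norm ?exprn_ge0 // ltr_pdivlMr // expr_div_n mulrAC
  ltr_pdivrMr ?exprn_gt0 //.
have h1 := upc k; have h2 := lowc k.
have h3 : (normc (f 0) - e) * (rho' ^+ k * t ^+ n) <= (normc (f 0) - e) * c k.
  by rewrite ler_wpM2l // subr_ge0 ltW.
move=> h4; have : (normc (f 0) - e) * c k <= M' * rho ^+ k by rewrite mulrBl; lra.
lra.
Qed.

End Vanishing.

End FourierUniqueness.

(** * Products, exponentials and coefficients of entire functions *)

Section CdiffClosure.
Variables (R : realType) (g : nat).
Implicit Types (F G : 'cV[R[i]]_g -> R[i]) (z h : 'cV[R[i]]_g).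

Lemma cdiffM F G z : cdiff F z -> cdiff G z -> cdiff (fun z => F z * G z) z.
Proof.
move=> dF dG; have [LF hF] := dF; have [LG hG] := dG.
exists (fun i => G z * LF i + F z * LG i) => e e0.
pose a := \sum_i normc (LF i) + normc (G z) + normc (F z) + 2.
have SF0 : 0 <= \sum_i normc (LF i) by apply: sumr_ge0 => i _; exact: normc_ge0.
have Gz := normc_ge0 (G z); have Fz := normc_ge0 (F z).
have a0 : 0 < a by rewrite /a; lra.
have ea0 : 0 < e / a by rewrite divr_gt0.
have [d1 d10 h1] := hF _ ea0; have [d2 d20 h2] := hG _ ea0.
have m0 : 0 < Num.min 1 (e / a) by rewrite lt_min ltr01.
have [d3 d30 h3] := cdiff_continuous dG m0.
exists (Num.min d1 (Num.min d2 d3)); first by rewrite !lt_min d10 d20.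
move=> h r /andP[r0]; rewrite !le_min => /and3P[r1 r2 r3] hr.
have k1 : normc (F (z + h) - F z - \sum_i LF i * h i 0) <= e / a * r by apply: h1;
  rewrite ?r0.
have k2 : normc (G (z + h) - G z - \sum_i LG i * h i 0) <= e / a * r by apply: h2;
  rewrite ?r0.
have k3 : normc (G (z + h) - G z) <= Num.min 1 (e / a).
  by apply: h3 => i; apply: le_trans (hr i) r3.
move: k3; rewrite le_min => /andP[k3 k4].
have k5 := normc_linear_form_le LF hr.
have -> : \sum_i (G z * LF i + F z * LG i) * h i 0 =
    G z * \sum_i LF i * h i 0 + F z * \sum_i LG i * h i 0.
  by rewrite !mulr_sumr -big_split /=; apply: eq_bigr => i _; ring.
set SF := \sum_i LF i * h i 0 in k1 k5 *; set SG := \sum_i LG i * h i 0 in k2 *.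
have -> : F (z + h) * G (z + h) - F z * G z - (G z * SF + F z * SG) =
  (F (z + h) - F z - SF) * G (z + h) + SF * (G (z + h) - G z) + F z * (G (z + h) - G z
    - SG) by ring.
have kG : normc (G (z + h)) <= normc (G z) + 1.
  by rewrite -[G (z + h)](subrK (G z)) addrC; apply: le_trans (normcD _ _) _;
    rewrite lerD2l.
apply: le_trans (normcD _ _) _; apply: le_trans (lerD (normcD _ _) (lexx _)) _.
rewrite !normcM.
have t1 : normc (F (z + h) - F z - SF) * normc (G (z + h)) <= e / a * r * (normc (G z)
  + 1).
  by apply: ler_pM; rewrite ?normc_ge0.
have t2 : normc SF * normc (G (z + h) - G z) <= (\sum_i normc (LF i)) * r * (e / a).
  by apply: ler_pM; rewrite ?normc_ge0.
have t3 : normc (F z) * normc (G (z + h) - G z - SG) <= normc (F z) * (e / a * r).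
  by rewrite ler_wpM2l.
have -> : e * r = e / a * r * a by rewrite mulrAC divfK // gt_eqF.
have er0 : 0 <= e / a * r by apply: le_trans (normc_ge0 _) k1.
rewrite /a; lra.
Qed.

Lemma cdiff_cexp_linear (u : 'I_g -> R[i]) z :
  cdiff (fun z => cexp (\sum_i u i * z i 0)) z.
Proof.
pose c := cexp (\sum_i u i * z i 0); pose U := \sum_i normc (u i).
have U0 : 0 <= U by apply: sumr_ge0 => i _; exact: normc_ge0.
exists (fun i => c * u i) => e e0.
pose b := normc c * (U ^+ 2 * expR U) + 1.
have b0 : 0 < b by rewrite ltr_wpDl // !mulr_ge0 ?normc_ge0 ?exprn_ge0 ?expR_ge0.
exists (Num.min 1 (e / b)); first by rewrite lt_min ltr01 divr_gt0.
move=> h r /andP[r0]; rewrite le_min => /andP[r1 r2] hr.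
have ru := normc_linear_form_le u hr.
set v := \sum_i u i * h i 0 in ru.
have -> : \sum_i u i * (z + h) i 0 = \sum_i u i * z i 0 + v.
  by rewrite -big_split; apply: eq_bigr => i _; rewrite mxE mulrDr.
have -> : \sum_i c * u i * h i 0 = c * v.
  by rewrite mulr_sumr; apply: eq_bigr => i _; rewrite mulrA.
rewrite cexpD -/c (_ : c * cexp v - c - c * v = c * (cexp v - 1 - v)); last by ring.
rewrite normcM.
have rU : U * r <= U by rewrite ler_piMr.
apply: (@le_trans _ _ (normc c * ((U * r) ^+ 2 * expR U))).
  rewrite ler_wpM2l ?normc_ge0 //; apply: le_trans (normc_cexp_taylor2 _) _.
  apply: ler_pM; rewrite ?exprn_ge0 ?normc_ge0 ?expR_ge0 //.
    by apply: lerXn2r; rewrite ?nnegrE ?normc_ge0 ?mulr_ge0.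
  by rewrite ler_expR; apply: le_trans ru rU.
have -> : normc c * ((U * r) ^+ 2 * expR U) = normc c * (U ^+ 2 * expR U) * r * r by
  ring.
rewrite ler_wpM2r //; move: r2; rewrite ler_pdivlMr // => r2; apply: le_trans r2.
by rewrite mulrC ler_wpM2l // lerDl.
Qed.

Lemma cdiff_echar m z : cdiff (echar (R := R) (g := g) m) z.
Proof.
have -> : echar (R := R) (g := g) m = fun z =>
  cexp (\sum_i (2%:R * 'i%C * piC R * (m i 0)%:~R) * z i 0).
  apply/funext => y; rewrite /echar pairingE mulr_sumr; congr cexp.
  by apply: eq_bigr => i _; rewrite !mxE mulrA.
exact: cdiff_cexp_linear.
Qed.

Lemma echar_lattice m z l : l \in @Zlattice R g -> echar m (z + l%:mxC) = echar m z.
Proof.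
move=> lZ; rewrite echarD echar_real.
have := (rchar_cont_periodic R m).1 0 l lZ; rewrite add0r => ->.
by rewrite /rchar pairingC pairing0l cunit0 mulr1.
Qed.

Section Entire.
Variable F : 'cV[R[i]]_g -> R[i].
Hypothesis dF : forall z, cdiff F z.
Hypothesis pF : forall l z, l \in @Zlattice R g -> F (z + l%:mxC) = F z.

Definition fourier_coef m := cube_integralC (fun x => F (x%:mxC) * rchar m x).

Lemma fourier_coef_shift m w :
  cube_integralC (fun x => F (w + x%:mxC) * echar m (w + x%:mxC)) = fourier_coef m.
Proof.
rewrite (@mean_complex_shift R g (fun z => F z * echar m z)).
- by congr cube_integralC; apply/funext => x; rewrite echar_real.
- by move=> z; apply: cdiffM => //; exact: cdiff_echar.
- by move=> l z lZ; rewrite pF // echar_lattice.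
Qed.

(** [fourier_unique0] only gives the value at the origin. Moving [w] there is a complex translation,
    which changes each coefficient by the nonzero factor [echar m w]. *)
Lemma entire_fourier_unique : (forall m, fourier_coef m = 0) -> forall w, F w = 0.
Proof.
move=> hF w; have gw := cont_periodic_real_shift dF pF w.
have := fourier_unique0 gw; rewrite map_mx0 addr0; apply=> m.
have gm : cont_periodic (fun x => F (w + x%:mxC) * rchar m x).
  exact: cont_periodicM gw (rchar_cont_periodic _ _).
have e0 : echar m w != 0 by exact: cexp_neq0.
apply: (mulfI e0); rewrite mulr0 -(meanZ _ gm) -(hF m) -(fourier_coef_shift m w).
by congr cube_integralC; apply/funext => x; rewrite echarD echar_real; ring.
Qed.

End Entire.
End CdiffClosure.

(** * Comparison with differentiability in normed spaces *)

Section Differentiable.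
Variables (R : realType) (g : nat).
Let V : normedModType R[i] := 'cV[R[i]]_g.
Implicit Types (h : V).

Lemma mx_norm_real h : exists2 r : R, 0 <= r & `|h| = r%:C.
Proof.
have [n0|n0] := eqVneq (mx_norm h) 0; first by exists 0.
have [k hk] := mx_norm_neq0 n0; exists (normc ((h : 'cV[R[i]]_g) k.1 k.2)).
  exact: normc_ge0.
exact: hk.
Qed.

Lemma mx_norm_coord h i : `|(h : 'cV[R[i]]_g) i 0| <= `|h|.
Proof.
have [/mx_norm_eq0 ->|n0] := eqVneq (mx_norm h) 0; first by rewrite mxE normr0.
rewrite normr_normc.
have [r r0 hr] := mx_norm_real h; rewrite hr lecR; apply/ler_addgt0Pr => e e0.
have : ball (0 : V) (`|h| + e%:C) h.
  by rewrite mx_norm_ball /ball_ /= sub0r normrN ltrDl (ltcR 0 e).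
move=> [_ /(_ i 0)]; rewrite /ball /= mxE sub0r normrN hr -rmorphD normr_normc ltcR.
exact: ltW.
Qed.

Lemma mx_norm_le h (r : R) : 0 <= r ->
  (forall i, normc ((h : 'cV[R[i]]_g) i 0) <= r) -> `|h| <= r%:C.
Proof.
move=> r0 hr; have [n0|n0] := eqVneq (mx_norm h) 0.
  have -> : `|h| = 0 by exact: n0.
  by rewrite lecR.
have [k hk] := mx_norm_neq0 n0.
have -> : `|h| = `|(h : 'cV[R[i]]_g) k.1 k.2| by exact: hk.
by rewrite normr_normc lecR (ord1 k.2).
Qed.

Definition linear_form (L : 'I_g ->
  R[i]) (h : 'cV[R[i]]_g) : R[i]^o := \sum_i L i * h i 0.

Lemma linear_form_is_linear L : linear (linear_form L).
Proof.
move=> a u v; rewrite /linear_form scaler_sumr -big_split; apply: eq_bigr => i _.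
by rewrite !mxE mulrDr mulrCA.
Qed.

HB.instance Definition _ L :=
  GRing.isLinear.Build R[i] 'cV[R[i]]_g R[i]^o *:%R (linear_form L)
    (linear_form_is_linear L).

Lemma linear_form_continuous L : continuous (linear_form L : V -> R[i]^o).
Proof.
apply: bounded_linear_continuous; apply/linear_boundedP.
exists (\sum_i normc (L i))%:C; split; first by rewrite complex_real.
move=> r Sr h; apply: le_trans (ler_wpM2r (normr_ge0 _) (ltW Sr)).
have [r' r'0 hE] := mx_norm_real h.
rewrite hE normr_normc -rmorphM lecR; apply: normc_linear_form_le => i.
by rewrite -lecR -hE -normr_normc; exact: mx_norm_coord.
Qed.

Lemma differentiable_cdiff (F : V -> R[i]^o) (z : V) : differentiable F z <-> cdiff F z.
Proof.
split=> [dF|[L hL]].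
  exists (fun i => 'd F z (delta_mx i 0)) => e e0.
  have /diff_locallyP[_ /eqaddoP/(_ e%:C)] := dF.
  rewrite (ltcR 0 e) => /(_ e0) /nbhs_norm0P[d /= d0 hd].
  (* A positive element of [R[i]] is real, by definition of the order. *)
  have [d' dE] : exists d', d = d'%:C.
    by exists (complex.Re d); case: d d0 {hd} => a b /=;
      rewrite ltcE /= => /andP[/eqP -> _].
  rewrite dE (ltcR 0 d') in d0 *.
  exists (d' / 2); first by rewrite divr_gt0.
  move=> h r /andP[r0 rd] hr.
  have hn : `|h : V| <= r%:C by exact: mx_norm_le.
  have := hd h _; rewrite /= dE => /(_ _)/le_trans H.
  have hd' : `|h : V| < d'%:C.
    by apply: le_lt_trans hn _; rewrite ltcR; apply: le_lt_trans rd _; lra.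
  have := hd h; rewrite /= dE => /(_ hd').
  rewrite !fctE /= => h1.
  have -> : \sum_i 'd F z (delta_mx i 0) * h i 0 = 'd F z h.
    rewrite {2}(_ : h = \sum_i h i 0 *: delta_mx i 0); last first.
      apply/colP => j; rewrite summxE (bigD1 j) //= !mxE !eqxx mulr1 big1 ?addr0 //.
      by move=> i ij; rewrite !mxE eq_sym (negbTE ij) mulr0.
    by rewrite linear_sum; apply: eq_bigr => i _; rewrite linearZ mulrC.
  rewrite -lecR -normr_normc rmorphM /=; apply: le_trans (ler_wpM2l _ hn);
    last by rewrite (lecR 0 e) ltW.
  by move: h1; rewrite opprD addrA (addrC h z).
have hL' : F \o shift z = cst (F z) + linear_form L +o_ (0 : V) id.
  apply/eqaddoP => e e0.
  have [e' eE] : exists e', e = e'%:C.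
    by exists (complex.Re e); case: e e0 => a b /=; rewrite ltcE /= => /andP[/eqP -> _].
  rewrite eE (ltcR 0 e') in e0 *; have [d d0 hd] := hL e' e0.
  apply/(@nbhs_norm0P _ V); exists d%:C; first by rewrite /= (ltcR 0 d).
  move=> h /= hh; have [r r0 rE] := mx_norm_real h.
  rewrite rE -rmorphM normr_normc lecR; rewrite rE ltcR in hh.
  rewrite !fctE /= opprD addrA (addrC h z).
  apply: hd; first by rewrite r0 ltW.
  by move=> i; rewrite -lecR -rE -normr_normc; exact: mx_norm_coord.
have dE := diff_unique (@linear_form_continuous L) hL'.
by apply/diff_locallyP; rewrite dE; split=> //; exact: linear_form_continuous.
Qed.

End Differentiable.

(** * Unordered sums over lattices *)

Section UnorderedSums.
Variables (R : realType) (I : choiceType).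
Implicit Types (f h : I -> R[i]) (b : I -> R) (A B : {fset I}).

Definition has_sum f (S : R[i]) := forall e : R, 0 < e ->
  exists A : {fset I}, forall B : {fset I}, (A `<=` B)%fset ->
    normc (\sum_(i <- B) f i - S) <= e.

Lemma has_sum_unique f S T : has_sum f S -> has_sum f T -> S = T.
Proof.
move=> hS hT; apply: normc_eq_eps => e e0; have e2 : 0 < e / 2 by rewrite divr_gt0.
have [A hA] := hS _ e2; have [B hB] := hT _ e2.
have := hA _ (fsubsetUl A B); have := hB _ (fsubsetUr A B).
set w := \sum_(i <- _) _ => h1 h2; have -> : S - T = (w - T) - (w - S) by ring.
by apply: le_trans (normcB _ _) _; lra.
Qed.

Lemma has_sumD f h S T : has_sum f S -> has_sum h T ->
  has_sum (fun i => f i + h i) (S + T).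
Proof.
move=> hS hT e e0; have e2 : 0 < e / 2 by rewrite divr_gt0.
have [A hA] := hS _ e2; have [B hB] := hT _ e2.
exists (A `|` B)%fset => D; rewrite fsubUset => /andP[/hA h1 /hB h2].
rewrite big_split /=; set x := \sum_(i <- D) f i in h1 *.
set y := \sum_(i <- D) h i in h2 *.
have -> : x + y - (S + T) = (x - S) + (y - T) by ring.
by apply: le_trans (normcD _ _) _; lra.
Qed.

Lemma has_sumZ c f S : has_sum f S -> has_sum (fun i => c * f i) (c * S).
Proof.
move=> hS e e0; have c1 : 0 < normc c + 1 by rewrite ltr_wpDl ?normc_ge0.
have [A hA] := hS _ (divr_gt0 e0 c1); exists A => B /hA.
rewrite ler_pdivlMr // => hB; rewrite -mulr_sumr -mulrBr normcM mulrC.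
by apply: le_trans hB; rewrite ler_wpM2l ?normc_ge0 // lerDl.
Qed.

Lemma has_sumB f h S T : has_sum f S -> has_sum h T ->
  has_sum (fun i => f i - h i) (S - T).
Proof.
move=> hS hT; have := has_sumD hS (has_sumZ (-1) hT); rewrite mulN1r.
by congr has_sum; apply/funext => i; rewrite mulN1r.
Qed.

Lemma eq_has_sum f h S : f =1 h -> has_sum f S -> has_sum h S.
Proof. by move/funext => ->. Qed.

Lemma has_sum_fsum (J : Type) (s : seq J) (f : J -> I -> R[i]) (S : J -> R[i]) :
  (forall j, has_sum (f j) (S j)) ->
  has_sum (fun i => \sum_(j <- s) f j i) (\sum_(j <- s) S j).
Proof.
move=> hf; elim: s => [|j s IH].
  rewrite big_nil => e e0; exists fset0 => B _; rewrite big1 ?subrr ?normc0 ?ltW //.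
  by move=> i _; rewrite big_nil.
rewrite big_cons; apply: eq_has_sum (has_sumD (hf j) IH) => i.
by rewrite big_cons.
Qed.

Lemma has_sum_reindex (phi psi : I -> I) f S : cancel phi psi -> cancel psi phi ->
  has_sum f S -> has_sum (f \o phi) S.
Proof.
move=> phiK psiK hS e e0; have [A hA] := hS e e0.
exists [fset psi i | i in A]%fset => B AB.
have -> : \sum_(i <- B) (f \o phi) i = \sum_(i <- [fset phi i | i in B]%fset) f i.
  by rewrite big_imfset //= => x y _ _; exact: can_inj phiK x y.
apply: hA; apply/fsubsetP => i iA; apply/imfsetP; exists (psi i); rewrite ?psiK //.
by apply: (fsubsetP AB); apply/imfsetP; exists i.
Qed.

Definition bounded_sum b := exists M : R, forall A, \sum_(i <- A) b i <= M.

Lemma bounded_sum_le b b' : (forall i, b i <= b' i) -> bounded_sum b' -> bounded_sum b.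
Proof. by move=> bb [M hM]; exists M => A;
  apply: le_trans (ler_sum _ (fun i _ => bb i)) (hM A). Qed.

Lemma bounded_sumZ c b : 0 <= c -> bounded_sum b -> bounded_sum (fun i => c * b i).
Proof.
by move=> c0 [M hM]; exists (c * M) => A; rewrite -mulr_sumr ler_wpM2l.
Qed.

Lemma bounded_sum_tail b (e : R) : (forall i, 0 <= b i) -> bounded_sum b -> 0 < e ->
  exists A, forall B, (A `<=` B)%fset -> \sum_(i <- (B `\` A)%fset) b i <= e.
Proof.
move=> b0 [M hM] e0; pose E := range (fun A : {fset I} => \sum_(i <- A) b i).
have hs : has_sup E.
  by split; [exists (\sum_(i <- fset0) b i); exists fset0|exists M => _ [A _ <-]].
have [_ [A _ <-] hA] := sup_adherent e0 hs; exists A => B AB.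
have hB : \sum_(i <- B) b i <= sup E by apply: ub_le_sup; [case: hs|exists B].
have : \sum_(i <- B) b i = \sum_(i <- A) b i + \sum_(i <- (B `\` A)%fset) b i.
  rewrite (big_fsetID _ (fun i => i \in A)) /=; congr (_ + _).
    by apply: eq_fbigl => i; rewrite !inE /= andbC;
      case: (boolP (i \in A)) => // /(fsubsetP AB) ->.
  by apply: eq_fbigl => i; rewrite !inE /= andbC.
lra.
Qed.

Lemma sum_fsubset_diff f A B : (A `<=` B)%fset ->
  \sum_(i <- B) f i = \sum_(i <- A) f i + \sum_(i <- (B `\` A)%fset) f i.
Proof.
move=> AB; rewrite (big_fsetID _ (fun i => i \in A)) /=; congr (_ + _).
  by apply: eq_fbigl => i; rewrite !inE /= andbC;
    case: (boolP (i \in A)) => // /(fsubsetP AB) ->.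
by apply: eq_fbigl => i; rewrite !inE /= andbC.
Qed.

Lemma has_sum_nonneg b : (forall i, 0 <= b i) -> bounded_sum b ->
  exists S, has_sum (fun i => (b i)%:C) S.
Proof.
move=> b0 hb; have [M hM] := hb;
  pose E := range (fun A : {fset I} => \sum_(i <- A) b i).
have hs : has_sup E.
  by split; [exists (\sum_(i <- fset0) b i); exists fset0|exists M => _ [A _ <-]].
exists (sup E)%:C => e e0; have [_ [A _ <-] hA] := sup_adherent e0 hs.
exists A => B AB; rewrite -rmorph_sum -rmorphB normc_real.
have hB : \sum_(i <- B) b i <= sup E by apply: ub_le_sup; [case: hs|exists B].
have le_AB : \sum_(i <- A) b i <= \sum_(i <- B) b i.
  rewrite -lecR !rmorph_sum /= (sum_fsubset_diff (fun i => (b i)%:C) AB).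
  by rewrite lerDl sumr_ge0 // => i _; rewrite (lecR 0).
by rewrite ler_norml; lra.
Qed.

Lemma bounded_has_sum f : bounded_sum (fun i => normc (f i)) -> exists S, has_sum f S.
Proof.
move=> hb.
(* A real family is the difference of the nonnegative families [|u| + u] and [|u|], both dominated
   by multiples of [normc f]. *)
have real_sum (u : I -> R) : (forall i, `|u i| <= normc (f i)) ->
    exists S, has_sum (fun i => (u i)%:C) S.
  move=> uf.
  have [S hS] : exists S, has_sum (fun i => (`|u i| + u i)%:C) S.
    apply: has_sum_nonneg => [i|]; first by have := ler_norm (- u i); rewrite normrN;
      lra.
    apply: bounded_sum_le (bounded_sumZ (ler0n R 2) hb) => i.
    by have := uf i; have := ler_norm (u i); lra.
  have [T hT] : exists T, has_sum (fun i => (`|u i|)%:C) T.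
    by apply: has_sum_nonneg => //; apply: bounded_sum_le hb.
  exists (S - T); apply: eq_has_sum (has_sumB hS hT) => i.
  by rewrite -rmorphB /= addrC addKr.
have [S hS] := real_sum _ (fun i => Re_le_normc (f i)).
have [T hT] := real_sum _ (fun i => Im_le_normc (f i)).
exists (S + 'i%C * T); apply: eq_has_sum (has_sumD hS (has_sumZ 'i%C hT)) => i.
case: (f i) => x y; apply/eqP; rewrite eq_complex /=.
by rewrite !(mulr0, mul0r, mul1r, subr0, addr0, add0r) !eqxx.
Qed.

Lemma has_sum_le f b S : has_sum f S -> (forall i, normc (f i) <= b i) ->
  forall M, (forall A, \sum_(i <- A) b i <= M) -> normc S <= M.
Proof.
move=> hS fb M hM; apply/ler_addgt0Pr => e e0;
  have [A /(_ A (fsubset_refl A)) hA] := hS e e0.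
rewrite -[S](subKr (\sum_(i <- A) f i)); apply: le_trans (normcB _ _) _.
apply: lerD => //; apply: le_trans (normc_sum _ _ _) _.
by apply: le_trans (hM A); exact: ler_sum.
Qed.

(** The Weierstrass test: the tail of [b] controls all [x] at once. This uniformity lets
    [theta_coef_has_sum] take means term by term. *)
Lemma has_sum_uniform (X : Type) (F : X -> I -> R[i]) (S : X -> R[i]) b :
  (forall x, has_sum (F x) (S x)) -> (forall x i, normc (F x i) <= b i) ->
  bounded_sum b -> forall e, 0 < e ->
  exists A, forall B, (A `<=` B)%fset ->
    forall x, normc (\sum_(i <- B) F x i - S x) <= e.
Proof.
move=> hF Fb hb e e0; have e2 : 0 < e / 2 by rewrite divr_gt0.
have b_ge0 (x : X) i : 0 <= b i by apply: le_trans (normc_ge0 _) (Fb x i).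
(* For empty [X] the claim is vacuous; otherwise a point is what shows that [b] is nonnegative. *)
have [[x0]|nX] := pselect (inhabited X); last first.
  by exists fset0 => B _ x; exfalso; apply: nX.
have [A hA] := bounded_sum_tail (b_ge0 x0) hb e2.
have tail B x : (A `<=` B)%fset ->
  normc (\sum_(i <- B) F x i - \sum_(i <- A) F x i) <= e / 2.
  move=> AB; rewrite (sum_fsubset_diff (F x) AB) addrC addKr.
  apply: le_trans (normc_sum _ _ _) _; apply: le_trans (hA B AB).
  by apply: ler_sum => i _; exact: Fb.
exists A => B AB x; apply/ler_addgt0Pr => r r0.
have [D hD] := hF x r r0; have h1 := hD _ (fsubsetUr B D).
have h2 := tail B x AB; have h3 := tail _ x (fsubset_trans AB (fsubsetUl B D)).
set p := \sum_(i <- (_ `|` _)%fset) _ in h1 h3.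
have -> : \sum_(i <- B) F x i - S x = (\sum_(i <- B) F x i - \sum_(i <- A) F x i)
   - (p - \sum_(i <- A) F x i) + (p - S x) by ring.
apply: le_trans (normcD _ _) _; apply: lerD => //.
by apply: le_trans (normcB _ _) _; lra.
Qed.

Lemma has_sum_sum f S : has_sum f S -> sum (f : I -> R[i]^o) = S.
Proof.
move=> hS; pose T : normedModType R[i] := R[i]^o; have FF := @totally_filter I.
suff fS : (partial_sum (f : I -> T) x @[x --> totally] --> (S : T))%classic.
  exact: (@cvg_lim T (@norm_hausdorff _ T) _ _ FF _ _ fS).
apply/cvgrPdist_le => e e0.
have [e' eE] : exists e', e = e'%:C.
  by exists (complex.Re e); case: e e0 => a b /=; rewrite ltcE /= => /andP[/eqP -> _].
rewrite eE (ltcR 0 e') in e0 *; have [A hA] := hS e' e0.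
exists A => // B /= AB; rewrite normr_normc lecR normcBC /partial_sum.
by have := hA B AB; rewrite big_seq_fsetE.
Qed.

End UnorderedSums.

(** * Geometric sums over the integer lattice *)

Section GeometricSums.
Variables (R : realType) (q : R).
Hypothesis q01 : 0 <= q < 1.

Lemma ler_sum_subset (T : eqType) (s1 s2 : seq T) (f : T -> R) : (forall i, 0 <= f i) ->
  uniq s1 -> {subset s1 <= s2} -> \sum_(i <- s1) f i <= \sum_(i <- s2) f i.
Proof.
move=> f0; elim: s1 s2 => [|x s1 IH] s2 /=; first by rewrite big_nil sumr_ge0.
move=> /andP[xs us] sub; have xs2 : x \in s2 by apply: sub; rewrite inE eqxx.
rewrite big_cons (perm_big _ (perm_to_rem xs2)) /= big_cons lerD2l;
  apply: IH => // y ys.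
have := perm_mem (perm_to_rem xs2) y; rewrite sub ?inE ?ys ?orbT // => /esym.
by case/orP => // /eqP yx; move: xs; rewrite -yx ys.
Qed.

Lemma centered_geometric_sum (M : nat) :
  \sum_(j < M.*2.+1) q ^+ `|(j%:Z - M%:Z)%R|%N <= 2 / (1 - q).
Proof.
have /andP[q0 q1'] := q01; have q1 : 0 < 1 - q by rewrite subr_gt0.
suff -> : \sum_(j < M.*2.+1) q ^+ `|(j%:Z - M%:Z)%R|%N = (1 + q - 2 * q ^+ M.+1) / (1 -
  q).
  rewrite ler_pM2r ?invr_gt0 //; have : 0 <= q ^+ M.+1 by rewrite exprn_ge0.
  lra.
apply: (mulIf (lt0r_neq0 q1)); rewrite divfK ?lt0r_neq0 //.
elim: M => [|M IH]; first by rewrite big_ord1 /=; rewrite expr0 expr1; ring.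
rewrite doubleS big_ord_recr big_ord_recl /=.
have -> : \sum_(i < M.*2.+1) q ^+ `|(bump 0 i)%:Z - (M.+1)%:Z|%N =
   \sum_(j < M.*2.+1) q ^+ `|(j%:Z - M%:Z)%R|%N.
  by apply: eq_bigr => i _; congr (_ ^+ _); rewrite /bump /=; lia.
have -> : `|(M.*2.+2%:Z - M.+1%:Z)%R|%N = M.+1 by lia.
rewrite subn0.
by rewrite !mulrDl IH !exprS; ring.
Qed.

Variable g : nat.

Definition absum (k : 'cV[int]_g) : nat := (\sum_i `|k i 0%R|)%N.

(** A finite set lies in a box [|k_i| <= M], over which the sum factors into [g] geometric sums,
    each at most [2 / (1 - q)] whatever [M] is. *)
Lemma lattice_geometric_bounded : bounded_sum (fun k : 'cV[int]_g => q ^+ absum k).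
Proof.
have /andP[q0 _] := q01.
exists ((2 / (1 - q)) ^+ g) => A.
pose M := (\max_(k <- A) absum k)%N.
pose psi (phi : {ffun 'I_g -> 'I_(M.*2.+1)}) : 'cV[int]_g := \col_i ((phi i)%:Z - M%:Z).
have sub : {subset (A : seq _) <= [seq psi phi | phi <- enum {: {ffun 'I_g ->
  'I_(M.*2.+1)}}]}.
  move=> k kA; have kM i : (`|k i 0%R| <= M)%N.
    apply: (@leq_trans (absum k)); first by rewrite /absum (bigD1 i) //= leq_addr.
    exact: leq_bigmax_seq.
  apply/mapP; exists [ffun i => inord `|(k i 0%R + M%:Z)%R|%N];
    first by rewrite mem_enum.
  apply/colP => i; rewrite mxE ffunE inordK; have := kM i; lia.
apply: le_trans (ler_sum_subset _ (fset_uniq A) sub) _.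
  by move=> k; rewrite exprn_ge0.
rewrite big_map big_enum /=.
have -> : \sum_(phi : {ffun 'I_g -> 'I_(M.*2.+1)}) q ^+ absum (psi phi) =
    \sum_(phi : {ffun 'I_g -> 'I_(M.*2.+1)}) \prod_i q ^+ `|((phi i)%:Z - M%:Z)%R|%N.
  apply: eq_bigr => phi _; rewrite -prodrXr; apply: eq_bigr => i _.
  by rewrite mxE.
rewrite -(bigA_distr_bigA (fun (i : 'I_g) (j : 'I_(M.*2.+1)) =>
  q ^+ `|(j%:Z - M%:Z)%R|%N)) /=.
rewrite -[X in _ ^+ X](card_ord g) -prodr_const; apply: ler_prod => i _.
rewrite centered_geometric_sum andbT sumr_ge0 // => j _; exact: exprn_ge0.
Qed.

End GeometricSums.

(** * Coercivity of the form K *)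

Section Coercivity.
Variables (R : realType) (g : nat) (K : 'M[int]_g).
Hypothesis posK : posdefmx R K.

(** By compactness the form has a positive lower bound on the unit sphere, and homogeneity extends
    it to all vectors. Bisection starts from [[-1, 1]^g], which contains the sphere. *)
Lemma posdef_coercive : exists2 lam : R, 0 < lam &
  forall x : 'cV[R]_g, lam * (\sum_i x i 0 ^+ 2) <= Kform K x x.
Proof.
have cK : cont (fun x : 'cV[R]_g => (Kform K x x)%:C).
  have -> : (fun x : 'cV[R]_g => (Kform K x x)%:C) =
    (fun x => \sum_i (x i 0)%:C * \sum_j (K i j)%:~R * (x j 0)%:C).
    apply/funext => x; rewrite /Kform pairingE rmorph_sum; apply: eq_bigr => i _ /=.
    rewrite mxE rmorphM rmorph_sum; congr (_ * _); apply: eq_bigr => j _ /=.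
    by rewrite mxE rmorphM /= rmorph_int.
  apply: cont_sum => i; apply: contM; first exact: cont_coord.
  by apply: cont_sum => j; apply: contM; [exact: cont_cst|exact: cont_coord].
pose P (x : 'I_g -> R) (s : R) := exists2 d, 0 < d & forall u : 'cV[R]_g,
  (forall i, x i <= u i 0 <= x i + s) -> \sum_i u i 0 ^+ 2 = 1 -> d <= Kform K u u.
have [d d0 hd] : P (fun=> -1) 2.
  apply: cube_bisection => // [x s s0 hb|x].
    have [//|b|d d0 hd] := @finite_uniform R {ffun 'I_g -> bool} (fun b d =>
      forall u : 'cV[R]_g, (forall i, x i + (if b i then s / 2 else 0) <= u i 0
      <= x i + (if b i then s / 2 else 0) + s / 2) -> \sum_i u i 0 ^+ 2 = 1 ->
        d <= Kform K u u).
    - by move=> b d d' dd h u hu u1; apply: le_trans dd (h u hu u1).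
    - by have [d d0 h] := hb b; exists d.
    - by exists d => // u /half_cube[b hu]; exact: hd hu.
  pose x0 : 'cV[R]_g := \col_i x i.
  have [x00|x0n] := eqVneq x0 0.
    have g1 : 0 < (g.+1)%:R :> R by rewrite ltr0n.
    (* Around the origin, where the form vanishes, the cube is made to miss the sphere: entries of
       size at most [1/(g+1)] have squares summing to at most [g/(g+1) < 1]. *)
    exists (g.+1%:R^-1); first by rewrite invr_gt0.
    move=> y s s0 sd hy; exists 1 => // u hu u1; exfalso.
    have : \sum_i u i 0 ^+ 2 <= \sum_(i < g) g.+1%:R^-1.
      apply: ler_sum => i _; have := hu i; have := hy i.
      have -> : x i = 0 by move/colP: x00 => /(_ i); rewrite !mxE.
      have gi : g.+1%:R^-1 <= 1 :> R by rewrite invf_le1 // ler1n.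
      move: sd gi; set w := g.+1%:R^-1 => sd gi /andP[? ?] /andP[? ?].
      have hw : `|u i 0| <= w.
        rewrite ler_norml; apply/andP; split; lra.
      rewrite -real_normK ?num_real // expr2 -[leRHS]mulr1.
      by apply: ler_pM => //; apply: le_trans hw gi.
    rewrite u1 sumr_const card_ord -[_ *+ g]mulr_natr mulrC ler_pdivlMr // mul1r
      ler_nat.
    by rewrite ltnn.
  have Q0 : 0 < Kform K x0 x0 by exact: posK.
  have Q2 : 0 < Kform K x0 x0 / 2 by rewrite divr_gt0.
  have [d d0 hd] := cK x0 _ Q2.
  exists d => // y s s0 sd hy; exists (Kform K x0 x0 / 2) => // u hu _.
  have : normc ((Kform K x0 x0)%:C - (Kform K u u)%:C) <= Kform K x0 x0 / 2.
    by apply: hd => i; rewrite mxE ler_norml; have := hu i; have := hy i; lra.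
  by rewrite -rmorphB normc_real ler_norml; lra.
exists d => // x; set S := \sum_i x i 0 ^+ 2.
have S0 : 0 <= S by apply: sumr_ge0 => i _; exact: sqr_ge0.
have [Sz|Sn] := eqVneq S 0.
  have -> : x = 0.
    apply/colP => i; rewrite mxE; apply/eqP; rewrite -sqrf_eq0; apply/eqP.
    have := @psumr_eq0P R 'I_g xpredT (fun i => x i 0 ^+ 2) (fun i _ => sqr_ge0 _) Sz.
    exact.
  by rewrite Sz mulr0 /Kform pairing0l.
have Sp : 0 < S by rewrite lt_def Sn.
pose n := Num.sqrt S; have n0 : 0 < n by rewrite sqrtr_gt0.
have n2 : n ^+ 2 = S by rewrite sqr_sqrtr.
have xE : x = n *: (n^-1 *: x) by rewrite scalerA divff ?scale1r // gt_eqF.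
have u1 : \sum_i (n^-1 *: x) i 0 ^+ 2 = 1.
  under eq_bigr do rewrite mxE exprMn.
  by rewrite -mulr_sumr -/S exprVn n2 mulVf.
have -> : Kform K x x = n ^+ 2 * Kform K (n^-1 *: x) (n^-1 *: x).
  by rewrite {1 2}xE /Kform -[in LHS]scalemxAr pairingZl pairingZr mulrA expr2.
have h := hd (n^-1 *: x); rewrite -n2 mulrC ler_wpM2l ?sqr_ge0 //; apply: (h _ u1) => i.
have : (n^-1 *: x) i 0 ^+ 2 <= 1.
  rewrite -u1 (bigD1 i) //= lerDl sumr_ge0 // => j _; exact: sqr_ge0.
by rewrite mxE; nra.
Qed.

End Coercivity.

(** * Theta functions *)

Section ThetaTerms.
Variables (R : realType) (g : nat) (tau : R[i]) (K : 'M[int]_g) (xi : 'cV[R[i]]_g).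
Hypotheses (tau_gt0 : 0 < complex.Im tau) (symK : K^T = K) (posK : posdefmx R K).
Implicit Types (k : 'cV[int]_g) (c : 'cV[R]_g) (z w h : 'cV[R[i]]_g).

(** The summand of [theta] at [b = 0], copied with its zero vector so that [theta c 0] is its sum by
    conversion. *)
Definition theta_term c w k : R[i] :=
  let ka : 'cV[R[i]]_g := (k%:mx[R] + c)%:mxC in
  cexp (piC R * 'i%C * pairing ka (Omega tau K *m ka)
          + 2%:R * piC R * 'i%C * pairing ka (w + (0 : 'cV[R]_g)%:mxC)).

Lemma map_mxC_K : (K%:mx[R])%:mxC = K%:mx[R[i]].
Proof. by apply/matrixP => i j; rewrite !mxE rmorph_int. Qed.

Lemma pairing_K_C (x y : 'cV[R]_g) : pairing x%:mxC (K%:mx[R[i]] *m y%:mxC) = (Kform K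
  x y)%:C.
Proof. by rewrite -map_mxC_K -map_mxM pairing_map. Qed.

Lemma pairing_Omega (x y : 'cV[R]_g) : pairing x%:mxC (Omega tau K *m y%:mxC) = tau *
  (Kform K x y)%:C.
Proof. by rewrite /Omega -scalemxAl pairingZr pairing_K_C. Qed.

Lemma theta_termE c w k : theta_term c w k =
  cexp (piC R * 'i%C * (tau * (Kform K (k%:mx[R] + c) (k%:mx[R] + c))%:C)
        + 2%:R * piC R * 'i%C * pairing (k%:mx[R] + c)%:mxC w).
Proof. by rewrite /theta_term pairing_Omega map_mx0 addr0. Qed.

Lemma normc_theta_term c w k : normc (theta_term c w k) =
  expR (- (pi * complex.Im tau * Kform K (k%:mx[R] + c) (k%:mx[R] + c))
        - 2 * pi * \sum_i (k%:mx[R] + c) i 0 * complex.Im (w i 0)).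
Proof.
have ReD (u v : R[i]) : complex.Re (u + v) = complex.Re u + complex.Re v.
  by case: u; case: v.
have ReQ (x : R) : complex.Re (piC R * 'i%C * (tau * x%:C)) = - (pi * complex.Im tau *
  x).
  by case: (tau) => t1 t2; rewrite /piC /=; ring.
have ReL : complex.Re (2%:R * piC R * 'i%C * pairing (k%:mx[R] + c)%:mxC w) =
    - (2 * pi * \sum_i (k%:mx[R] + c) i 0 * complex.Im (w i 0)).
  have -> : pairing (k%:mx[R] + c)%:mxC w = \sum_i ((k%:mx[R] + c) i 0)%:C * w i 0.
    by rewrite pairingE; apply: eq_bigr => i _; rewrite mxE.
  rewrite mulr_sumr mulr_sumr -sumrN raddf_sum; apply: eq_bigr => i _.
  have -> : (2%:R : R[i]) = (2 : R)%:C by rewrite rmorph_nat.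
  by case: (w i 0) => w1 w2; rewrite /piC /=; ring.
by rewrite theta_termE normc_cexp ReD ReQ ReL.
Qed.

(** Gaussian decay beats any exponential rate [s], uniformly for [w] in a strip [|Im w_i| <= B]:
    coercivity reduces the exponent to one quadratic polynomial per coordinate. *)
Lemma theta_term_bound c (s B : R) : 0 <= s -> 0 <= B -> exists2 C, 0 <= C &
  forall k w, (forall i, `|complex.Im (w i 0)| <= B) ->
    normc (theta_term c w k) <= C * expR (- (s * (absum k)%:R)).
Proof.
move=> s0 B0; have [lam lam0 hlam] := posdef_coercive posK.
have pi0 := pi_gt0 R.
pose al := pi * complex.Im tau * lam; pose be := 2 * pi * B.
have al0 : 0 < al by rewrite !mulr_gt0.
(* Per coordinate, the maximum of [(be + s) x - al x^2], plus [s |c_i|] for passing from [k + c] to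
   [k]. *)
pose C0 := \sum_(i < g) ((be + s) ^+ 2 / (4 * al) + s * `|c i 0|).
exists (expR C0); first exact: expR_ge0.
move=> k w hw; rewrite normc_theta_term -expRD ler_expR.
set v := k%:mx[R] + c.
have h1 : al * (\sum_i v i 0 ^+ 2) <= pi * complex.Im tau * Kform K v v.
  by rewrite /al -mulrA ler_wpM2l // mulr_ge0 // ltW.
have -> : (absum k)%:R = \sum_i `|(k i 0)%:~R| :> R.
  by rewrite /absum natr_sum; apply: eq_bigr => i _; rewrite natr_absz intr_norm.
apply: (@le_trans _ _ (\sum_i (- (al * v i 0 ^+ 2) + be * `|v i 0|))).
  rewrite big_split /= sumrN -mulr_sumr; apply: lerD; first by rewrite lerN2.
  rewrite mulr_sumr -sumrN; apply: ler_sum => i _.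
  apply: le_trans (ler_norm _) _; rewrite normrN !normrM.
  rewrite (ger0_norm (ltW pi0)) ger0_norm // /be -!mulrA !ler_wpM2l ?(ltW pi0) //.
  by rewrite mulrC ler_wpM2r.
rewrite /C0 mulr_sumr -sumrB; apply: ler_sum => i _.
have kv : `|(k i 0)%:~R| <= `|v i 0| + `|c i 0| :> R.
  have -> : (k i 0)%:~R = v i 0 - c i 0 by rewrite !mxE addrK.
  exact: ler_normB.
have h2 : s * `|(k i 0)%:~R| <= s * (`|v i 0| + `|c i 0|) by rewrite ler_wpM2l.
have h3 : - (al * v i 0 ^+ 2) + be * `|v i 0| <= (be + s) ^+ 2 / (4 * al) - s * `|v i
  0|.
  rewrite -lerBlDr opprK -real_normK ?num_real // ler_pdivlMr ?mulr_gt0 //.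
  set x := `|v i 0|; have := sqr_ge0 (2 * al * x - (be + s)); rewrite !expr2; lra.
by rewrite mulrDr in h2; lra.
Qed.

Let q : R := expR (-1).

Lemma expRN1_lt1 : 0 <= q < 1.
Proof. by rewrite expR_ge0 /= -expR0 ltr_expR; lra. Qed.

Lemma qX n : q ^+ n = expR (- n%:R).
Proof. by rewrite /q -expRM_natr mulN1r. Qed.

Lemma Im_bound w : exists2 B, 0 <= B & forall i, `|complex.Im (w i 0)| <= B.
Proof.
exists (\sum_i `|complex.Im (w i 0)|); first by apply: sumr_ge0.
by move=> i; rewrite (bigD1 i) //= lerDl sumr_ge0.
Qed.

Lemma theta_term_bounded_sum c w : bounded_sum (fun k => normc (theta_term c w k)).
Proof.
have [B B0 hB] := Im_bound w.
have [C C0 hC] := theta_term_bound c ler01 B0.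
apply: bounded_sum_le (bounded_sumZ C0 (lattice_geometric_bounded expRN1_lt1 g)) => k.
by rewrite qX; have := hC k w hB; rewrite mul1r.
Qed.

Lemma theta_has_sum c w : has_sum (theta_term c w) (theta c 0 w (Omega tau K)).
Proof.
have [S hS] := bounded_has_sum (theta_term_bounded_sum c w).
by rewrite /theta (has_sum_sum hS).
Qed.

Definition theta_pull c z := theta c 0 (K%:mx[R[i]] *m z + xi) (Omega tau K).

(** The logarithmic derivative in [z_j] of the [k]-th term, which is the exponential of an affine
    function of [z]. *)
Let ell c k (j : 'I_g) : R[i] := 2%:R * piC R * 'i%C * (K%:mx[R[i]] *m (k%:mx[R] +
  c)%:mxC) j 0.

Lemma theta_term_add c k z h :
  theta_term c (K%:mx[R[i]] *m (z + h) + xi) k =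
  theta_term c (K%:mx[R[i]] *m z + xi) k * cexp (\sum_j ell c k j * h j 0).
Proof.
rewrite !theta_termE -cexpD; congr cexp; rewrite -[RHS]addrA; congr (_ + _).
rewrite mulmxDr addrAC pairingDr mulrDr; congr (_ + _).
rewrite pairing_mulmx map_trmx symK pairingE mulr_sumr.
by apply: eq_bigr => j _; rewrite /ell mulrA.
Qed.

Lemma ell_bound c : exists2 D, 0 <= D & forall k j,
  normc (ell c k j) <= D * (1 + (absum k)%:R).
Proof.
have pi0 := pi_gt0 R.
pose kap : R := \sum_i \sum_j `|(K i j)%:~R|; pose gam := \sum_i `|c i 0|.
have kap0 : 0 <= kap by apply: sumr_ge0 => i _; apply: sumr_ge0.
have gam0 : 0 <= gam by apply: sumr_ge0.
exists (2 * pi * (kap * (1 + gam))).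
  by apply: mulr_ge0; apply: mulr_ge0 => //; [exact: ltW|exact: addr_ge0].
move=> k j.
have -> : ell c k j = (2 * pi * \sum_i (K j i)%:~R * (k%:mx[R] + c) i 0)%:C * 'i%C.
  rewrite /ell -map_mxC_K -map_mxM mxE mxE !rmorphM /= rmorph_nat /piC.
  rewrite mulrAC; congr (_ * _ * _); rewrite !rmorph_sum; apply: eq_bigr => i _.
  by rewrite mxE.
rewrite normcM normc_real [normc 'i]/normc /= expr0n add0r expr1n sqrtr1 mulr1.
rewrite normrM ger0_norm ?mulr_ge0 ?(ltW pi0) // -!mulrA 2?ler_wpM2l ?(ltW pi0) //.
have vi i : `|(k%:mx[R] + c) i 0| <= (1 + gam) * (1 + (absum k)%:R).
  have h1 : `|(k i 0)%:~R| <= (absum k)%:R :> R.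
    rewrite -intr_norm -natr_absz ler_nat /absum (bigD1 i) //=; exact: leq_addr.
  have h2 : `|c i 0| <= gam by rewrite /gam (bigD1 i) //= lerDl sumr_ge0.
  rewrite !mxE; apply: le_trans (ler_normD _ _) _.
  have : 0 <= gam * (absum k)%:R by rewrite mulr_ge0.
  have : 0 <= (absum k)%:R :> R by [].
  lra.
apply: le_trans (ler_norm_sum _ _ _) _.
apply: (@le_trans _ _ (\sum_i `|(K j i)%:~R| * ((1 + gam) * (1 + (absum k)%:R)))).
  by apply: ler_sum => i _; rewrite normrM ler_wpM2l.
rewrite -mulr_suml ler_wpM2r ?mulr_ge0 ?addr_ge0 // /kap [leRHS](bigD1 j) //= lerDl.
by apply: sumr_ge0 => i _; apply: sumr_ge0.
Qed.

(** Termwise differentiation: moving [z] by [h] multiplies the [k]-th term by [exp (u k)] with [u k]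
    linear in [h], and the remainders [exp (u k) - 1 - u k], weighted by the terms, sum to order
    [r^2]. *)
Lemma theta_pull_cdiff c z : cdiff (theta_pull c) z.
Proof.
have [B B0 hB] := Im_bound (K%:mx[R[i]] *m z + xi).
have [D D0 hD] := ell_bound c.
pose E := g%:R * D; have E0 : 0 <= E by rewrite mulr_ge0.
(* With [x = E (1 + |k|)] a remainder costs [x^2 e^x <= e^(3 x)], which uses up the part [3 E]; the
   other 2 pay for the factor [1 + |k|] in the derivatives and for a convergent geometric series. *)
have s0 : 0 <= 3 * E + 2 by lra.
have [C C0 hC] := theta_term_bound c s0 B0.
pose T k := theta_term c (K%:mx[R[i]] *m z + xi) k.
have hT k : normc (T k) <= C * expR (- ((3 * E + 2) * (absum k)%:R)) by exact: hC.
have geo := lattice_geometric_bounded expRN1_lt1 g.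
have lin j : exists S, has_sum (fun k => T k * ell c k j) S.
  apply: bounded_has_sum; apply: bounded_sum_le (bounded_sumZ (mulr_ge0 C0 D0) geo) =>
    k.
  rewrite normcM; apply: le_trans (ler_pM (normc_ge0 _) (normc_ge0 _) (hT k) (hD k j))
    _.
  rewrite -mulrA -[leRHS]mulrA ler_wpM2l // mulrCA ler_wpM2l // qX.
  apply: le_trans (ler_wpM2l (expR_ge0 _) (expR_ge1Dx _)) _.
  rewrite -expRD ler_expR; have : 0 <= E * (absum k)%:R by rewrite mulr_ge0.
  lra.
have /choice[L hL] := lin.
have [M hM] := bounded_sumZ (mulr_ge0 C0 (expR_ge0 (3 * E))) geo.
have M0 : 0 <= M by have := hM fset0; rewrite big_nil.
exists L => e e0; exists (Num.min 1 (e / (M + 1))).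
  by rewrite lt_min ltr01 divr_gt0 // ltr_wpDl.
move=> h r /andP[r0]; rewrite le_min => /andP[r1 re] hr.
pose u k := \sum_j ell c k j * h j 0.
have hu k : normc (u k) <= E * (1 + (absum k)%:R) * r.
  apply: le_trans (normc_linear_form_le _ hr) _; rewrite ler_wpM2r //.
  apply: (@le_trans _ _ (\sum_(j < g) D * (1 + (absum k)%:R))); first exact: ler_sum.
  by rewrite sumr_const card_ord -[(D * _) *+ g]mulr_natl /E mulrA.
have hsum : has_sum (fun k => T k * (cexp (u k) - 1 - u k))
    (theta_pull c (z + h) - theta_pull c z - \sum_j L j * h j 0).
  have hs1 := theta_has_sum c (K%:mx[R[i]] *m (z + h) + xi).
  have hs2 := theta_has_sum c (K%:mx[R[i]] *m z + xi).
  have hs3 := has_sum_fsum (index_enum 'I_g) (fun j => has_sumZ (h j 0) (hL j)).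
  have := has_sumB (has_sumB hs1 hs2) hs3.
  rewrite (_ : \sum_j L j * h j 0 = \sum_j h j 0 * L j); last first.
    by apply: eq_bigr => j _; rewrite mulrC.
  apply: eq_has_sum => k; rewrite theta_term_add -/(u k) -/(T k).
  have -> : \sum_j h j 0 * (T k * ell c k j) = T k * u k.
    by rewrite mulr_sumr; apply: eq_bigr => j _; ring.
  by ring.
apply: (@le_trans _ _ (M * r ^+ 2)).
  apply: (has_sum_le hsum (b := fun k => C * expR (3 * E) * q ^+ absum k * r ^+ 2));
    last first.
    by move=> A; rewrite -mulr_suml ler_wpM2r ?sqr_ge0.
  move=> k; rewrite normcM; set N : R := (absum k)%:R in hT hu *.
  have N0 : 0 <= N by [].
  pose x := E * (1 + N); have x0 : 0 <= x by rewrite mulr_ge0 // addr_ge0.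
  have h1 : normc (cexp (u k) - 1 - u k) <= (x * r) ^+ 2 * expR x.
    apply: le_trans (normc_cexp_taylor2 _) _.
    apply: ler_pM; rewrite ?sqr_ge0 ?expR_ge0 //.
      by apply: lerXn2r; rewrite ?nnegrE ?normc_ge0 ?(mulr_ge0 x0 r0) //; exact: hu.
    by rewrite ler_expR; apply: le_trans (hu k) _; rewrite ler_piMr.
  have h2 : x ^+ 2 <= expR (2 * x).
    have -> : 2 * x = x * 2%:R by rewrite mulrC.
    rewrite expRM_natr; apply: lerXn2r; rewrite ?nnegrE ?expR_ge0 //.
    by have := expR_ge1Dx x; lra.
  apply: le_trans (ler_pM (normc_ge0 _) (normc_ge0 _) (hT k) h1) _.
  rewrite exprMn; apply: (@le_trans _ _ (C * expR (- ((3 * E + 2) * N)) * (expR (2 * x)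
    * r ^+ 2 * expR x))).
    rewrite ler_wpM2l ?mulr_ge0 ?expR_ge0 // ler_wpM2r ?expR_ge0 //.
    by rewrite ler_wpM2r ?sqr_ge0.
  have -> : C * expR (- ((3 * E + 2) * N)) * (expR (2 * x) * r ^+ 2 * expR x) =
     C * (expR (- ((3 * E + 2) * N)) * expR (2 * x) * expR x) * r ^+ 2 by ring.
  rewrite ler_wpM2r ?sqr_ge0 // -[leRHS]mulrA ler_wpM2l // qX -!expRD ler_expR.
  by rewrite /x -/N; lra.
rewrite expr2 mulrA ler_wpM2r //; move: re; rewrite ler_pdivlMr ?ltr_wpDl // => re.
by apply: le_trans re; rewrite mulrC ler_wpM2l // lerDl.
Qed.

End ThetaTerms.

Lemma has_sum_single (R : realType) (I : choiceType) (i0 : I) (f : I -> R[i]) :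
  (forall i, i != i0 -> f i = 0) -> has_sum f (f i0).
Proof.
move=> f0 e e0; exists [fset i0]%fset => B /fsubsetP/(_ i0);
  rewrite inE eqxx => /(_ isT) i0B.
rewrite (big_fsetD1 i0) //= big_seq big1 ?addr0 ?subrr ?normc0 ?ltW //.
by move=> i; rewrite !inE => /andP[/f0].
Qed.

(** * Functional equations and Fourier coefficients of the theta series *)

Section ThetaLaws.
Variables (R : realType) (g : nat) (tau : R[i]) (K : 'M[int]_g) (xi : 'cV[R[i]]_g).
Hypotheses (tau_gt0 : 0 < complex.Im tau) (symK : K^T = K) (posK : posdefmx R K).
Implicit Types (k m : 'cV[int]_g) (a b c l : 'cV[R]_g) (z w h : 'cV[R[i]]_g).

Local Notation theta_pull := (theta_pull tau K xi).
Local Notation theta_term := (theta_term tau K).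

Lemma theta_term_translate c w k a : theta_term c (w + K%:mx[R[i]] *m a%:mxC) k =
  cunit (Kform K (k%:mx[R] + c) a) * theta_term c w k.
Proof.
rewrite !theta_termE pairingDr pairing_K_C mulrDr addrA cexpD mulrC; congr (_ * _).
by rewrite /cunit; congr cexp; ring.
Qed.

Lemma theta_pull_translate c a z : a \in @Klattice R g K ->
  theta_pull c (z + a%:mxC) = cunit (Kform K a c) * theta_pull c z.
Proof.
move=> aK; have hs1 := theta_has_sum tau_gt0 posK c (K%:mx[R[i]] *m (z + a%:mxC) + xi).
apply: has_sum_unique hs1 _.
apply: eq_has_sum (has_sumZ (cunit (Kform K a c)) (theta_has_sum tau_gt0 posK c _)) =>
  k /=.
rewrite mulmxDr addrAC theta_term_translate KformDl cunitD.
have [n ->] : exists n : int, Kform K k%:mx[R] a = n%:~R.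
  by apply: Kform_int aK; apply/ZlatticeP; exists k.
by rewrite cunit_int mul1r KformC.
Qed.

(** Completing the square at [k + c + b]. This holds for every real [b]: integral [b] give
    quasi-periodicity, and [b] in [K^-1 Z^g] the action of [R_b]. *)
Lemma theta_term_quasi c z k b :
  theta_term c (K%:mx[R[i]] *m (z + tau *: b%:mxC) + xi) k =
  mult tau K xi b z * theta_term (c + b) (K%:mx[R[i]] *m z + xi) k.
Proof.
rewrite !theta_termE /mult -cexpD; congr cexp.
rewrite !addrA; move: (k%:mx[R] + c) => v.
rewrite mulmxDr -scalemxAr [K%:mx[_] *m z + _]addrC -addrA !KformDl !KformDr //.
rewrite (KformC symK b v) map_mxD pairingDl !pairingDr !pairingZr !pairing_K_C
  pairing_Omega.
rewrite !rmorphD /=; ring.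
Qed.

Lemma theta_pull_quasi c b z :
  theta_pull c (z + tau *: b%:mxC) = mult tau K xi b z * theta_pull (c + b) z.
Proof.
have hs1 := theta_has_sum tau_gt0 posK c (K%:mx[R[i]] *m (z + tau *: b%:mxC) + xi).
apply: has_sum_unique hs1 _.
apply: eq_has_sum (has_sumZ (mult tau K xi b z) (theta_has_sum tau_gt0 posK (c + b) _))
  => k /=.
by rewrite theta_term_quasi.
Qed.

Lemma theta_pull_lattice c l z : l \in @Zlattice R g ->
  theta_pull (c + l) z = theta_pull c z.
Proof.
move=> /ZlatticeP[m ->].
have hs1 := theta_has_sum tau_gt0 posK (c + m%:mx[R]) (K%:mx[R[i]] *m z + xi).
have hs2 := theta_has_sum tau_gt0 posK c (K%:mx[R[i]] *m z + xi).
have := has_sum_reindex (addrK m) (subrK m) hs2.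
move=> hs3; apply: has_sum_unique hs1 _; apply: eq_has_sum hs3 => k /=.
by rewrite !theta_termE map_mxD (addrC c) addrA.
Qed.

Lemma Zlattice_Klattice l : l \in @Zlattice R g -> l \in @Klattice R g K.
Proof.
by move=> /ZlatticeP[m ->]; rewrite unfold_in -map_mxM; apply/ZlatticeP;
  exists (K *m m).
Qed.

Lemma theta_pull_in_W c : c \in @Klattice R g K -> theta_pull c \in in_W tau K xi.
Proof.
move=> cK; apply/asboolP; split.
- by move=> z; apply/differentiable_cdiff; exact: theta_pull_cdiff.
- move=> l z lZ; rewrite theta_pull_translate ?Zlattice_Klattice //.
  by have [n ->] := Kform_int lZ cK; rewrite cunit_int mul1r.
- by move=> l z lZ; rewrite theta_pull_quasi theta_pull_lattice.
Qed.

Lemma rchar_add_half m : m != 0 -> exists a, cunit (pairing m%:mx[R] a) = -1.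
Proof.
move=> m0; have [i mi] : exists i, m i 0 != 0.
  apply: contrapT => /forallNP h; move/eqP: m0; apply; apply/colP => i.
  by apply/eqP; rewrite mxE; apply/negPn/negP; exact: h.
exists ((2 * (m i 0)%:~R)^-1 *: delta_mx i 0); rewrite pairingZr.
have -> : pairing m%:mx[R] (delta_mx i 0) = (m i 0)%:~R.
  rewrite pairingE (bigD1 i) //= !mxE !eqxx mulr1 big1 ?addr0 // => j ij.
  by rewrite !mxE (negbTE ij) mulr0.
have mr : (m i 0)%:~R != 0 :> R by rewrite intr_eq0.
have -> : (2 * (m i 0)%:~R)^-1 * (m i 0)%:~R = 2^-1 :> R.
  by rewrite invfM -mulrA mulVf // mulr1.
rewrite cunit_cos.
have -> : 2 * pi / 2 = pi :> R by field.
by rewrite cospi sinpi; apply/eqP; rewrite eq_complex /= oppr0 !eqxx.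
Qed.

(** For [m != 0] a translation by half a period changes the sign of the character, so its mean
    equals its own opposite. *)
Lemma mean_rchar m : cube_integralC (rchar (R := R) m) = (m == 0)%:R.
Proof.
case: eqP => [->|/eqP m0] /=.
  rewrite -[RHS](mean_cst g); congr cube_integralC; apply/funext => x.
  by rewrite /rchar map_mx0 pairing0l cunit0.
have gm := rchar_cont_periodic R m; have [a ha] := rchar_add_half m0.
have := mean_shift a gm.
have -> : (fun x : 'cV[R]_g => rchar m (x + a)) = fun x => -1 * rchar m x.
  by apply/funext => x; rewrite /rchar pairingDr cunitD ha mulrC.
rewrite meanZ // mulN1r => /eqP; rewrite eq_sym -subr_eq0 opprK -mulr2n mulrn_eq0 /=.
by move/eqP.
Qed.

Section Coefficients.
Variables (c : 'cV[R]_g) (n : 'cV[int]_g).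
Hypothesis cn : K%:mx[R] *m c = n%:mx[R].

Lemma theta_term_real x k : theta_term c (K%:mx[R[i]] *m x%:mxC + xi) k =
  theta_term c xi k * rchar (K *m k + n) x.
Proof.
rewrite addrC theta_term_translate mulrC; congr (_ * cunit _).
by rewrite /Kform pairing_mulmx map_trmx symK mulmxDr cn -map_mxM -map_mxD.
Qed.

(** On real points the [k]-th term is a constant times the character of frequency [K k + n], and
    uniform convergence lets means be taken term by term. *)
Lemma theta_coef_has_sum m :
  has_sum (fun k => theta_term c xi k * (K *m k + n + m == 0)%:R)
    (fourier_coef (theta_pull c) m).
Proof.
have [B B0 hB] := Im_bound xi.
have [C C0 hC] := theta_term_bound tau_gt0 posK c ler01 B0.
have hw (x : 'cV[R]_g) i : `|complex.Im ((K%:mx[R[i]] *m x%:mxC + xi) i 0)| <= B.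
  by rewrite -map_mxC_K -map_mxM !mxE raddfD /= add0r.
have bs : bounded_sum (fun k : 'cV[int]_g => C * expR (-1) ^+ absum k).
  exact: bounded_sumZ C0 (lattice_geometric_bounded (expRN1_lt1 R) g).
have normc_rchar x : normc (rchar m x) = 1 :> R.
  by rewrite /rchar cunit_cos /normc cos2Dsin2 sqrtr1.
pose F (x : 'cV[R]_g) k := rchar m x * theta_term c (K%:mx[R[i]] *m x%:mxC + xi) k.
have hF x : has_sum (F x) (rchar m x * theta_pull c x%:mxC).
  exact: has_sumZ (theta_has_sum tau_gt0 posK c _).
have Fb x k : normc (F x k) <= C * expR (-1) ^+ absum k.
  by rewrite normcM normc_rchar mul1r qX; have := hC k _ (hw x); rewrite mul1r.
have gF k : cont_periodic (fun x => F x k).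
  have -> : (fun x => F x k) = (fun x => theta_term c xi k * rchar (K *m k + n + m) x).
    by apply/funext => x; rewrite /F theta_term_real [in RHS]rcharD; ring.
  exact: cont_periodicM (cont_periodic_cst _ _) (rchar_cont_periodic _ _).
have mF k : cube_integralC (fun x =>
  F x k) = theta_term c xi k * (K *m k + n + m == 0)%:R.
  have -> : (fun x => F x k) = (fun x => theta_term c xi k * rchar (K *m k + n + m) x).
    by apply/funext => x; rewrite /F theta_term_real [in RHS]rcharD; ring.
  by rewrite meanZ ?mean_rchar //; exact: rchar_cont_periodic.
have dth := theta_pull_cdiff xi tau_gt0 symK posK c.
have pth l z : l \in @Zlattice R g -> theta_pull c (z + l%:mxC) = theta_pull c z.
  move=> lZ; rewrite theta_pull_translate ?Zlattice_Klattice //.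
  have cK : c \in @Klattice R g K by rewrite unfold_in cn; apply/ZlatticeP; exists n.
  by have [i ->] := Kform_int lZ cK; rewrite cunit_int mul1r.
have gth : cont_periodic (fun x => theta_pull c x%:mxC).
  have -> : (fun x : 'cV[R]_g => theta_pull c x%:mxC) = (fun x =>
    theta_pull c (0 + x%:mxC)).
    by apply/funext => x; rewrite add0r.
  exact: (cont_periodic_real_shift dth pth).
have gG : cont_periodic (fun x => theta_pull c x%:mxC * rchar m x).
  exact: cont_periodicM gth (rchar_cont_periodic _ _).
move=> e e0; have [A hA] := has_sum_uniform hF Fb bs e0; exists A => D AD.
have [gS mS] := mean_sum (D : seq _) gF.
under eq_bigr do rewrite -mF; rewrite -mS /fourier_coef.
have gG' : cont_periodic (fun x => -1 * (theta_pull c x%:mxC * rchar m x)).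
  exact: cont_periodicM (cont_periodic_cst _ _) gG.
rewrite -mulN1r -(meanZ _ gG) -meanD //.
have := mean_le (cont_periodicD gS gG') (cont_periodic_cst g e%:C).
rewrite mean_cst /=; apply=> x.
by have := hA D AD x; rewrite mulN1r (mulrC (theta_pull c _)).
Qed.

End Coefficients.

Lemma K_inj (x : 'cV[R]_g) : K%:mx[R] *m x = 0 -> x = 0.
Proof.
move=> Kx; apply: contrapT => /eqP /posK; rewrite Kx /pairing mulmx0 mxE ltxx.
by [].
Qed.

(** Injectivity of [K] leaves only the term [k = 0], a single exponential. *)
Lemma theta_coef_diag c n : K%:mx[R] *m c = n%:mx[R] ->
  fourier_coef (theta_pull c) (- n) != 0.
Proof.
move=> cn; have hs := theta_coef_has_sum cn (- n).
have hs0 : forall k, k != 0 -> theta_term c xi k * (K *m k + n - n == 0)%:R = 0.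
  move=> k k0; case: eqP => [|_]; last by rewrite mulr0.
  rewrite addrK => Kk; exfalso; move/eqP: k0; apply.
  have /colP h : k%:mx[R] = 0.
    by apply: K_inj; rewrite -map_mxM Kk map_mx0.
  by apply/colP => i; have := h i; rewrite !mxE => /eqP; rewrite intr_eq0 => /eqP.
have := has_sum_unique hs (has_sum_single hs0).
rewrite mulmx0 add0r subrr eqxx mulr1 => ->; exact: cexp_neq0.
Qed.

(** A contributing [k] would satisfy [K k = n' - n], making [c - c'] the lattice vector [- k]. *)
Lemma theta_coef_offdiag c c' n n' : K%:mx[R] *m c = n%:mx[R] ->
  K%:mx[R] *m c' = n'%:mx[R] ->
  c - c' \notin @Zlattice R g -> fourier_coef (theta_pull c) (- n') = 0.
Proof.
move=> cn cn' ncc; have hs := theta_coef_has_sum cn (- n').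
have hs0 : forall k, theta_term c xi k * (K *m k + n - n' == 0)%:R = 0.
  move=> k; case: eqP => [Kk|_]; last by rewrite mulr0.
  exfalso; move/negP: ncc; apply; apply/ZlatticeP; exists (- k).
  apply/eqP; rewrite -subr_eq0; apply/eqP; apply: K_inj.
  rewrite mulmxBr mulmxBr cn cn' -map_mxM -!map_mxB mulmxN opprK.
  by rewrite addrC addrA Kk map_mx0.
have := has_sum_unique hs (has_sum_single (i0 := 0) (fun k _ => hs0 k)).
by rewrite hs0.
Qed.

End ThetaLaws.

(** * The finite group Pi *)

Section FiniteQuotient.
Variables (R : realType) (g : nat) (K : 'M[int]_g).
Hypotheses (posK : posdefmx R K).
Implicit Types (a b c : klat R K).

Lemma cls_eq a b : cls a = cls b <-> (a - b : klat R K) \in @klat_int R g K.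
Proof.
rewrite Quotient.idealrBE; split=> [h|/eqP h]; last exact: h.
by apply/eqP; exact: h.
Qed.

Lemma klat_of_int (n : 'cV[int]_g) : exists c, K%:mx[R] *m c = n%:mx[R].
Proof.
have Ku : K%:mx[R] \in unitmx.
  by rewrite unitmxE unitfE det_map_mx; exact: posdef_det_neq0.
have h : invmx K%:mx[R] *m n%:mx[R] \in @Klattice R g K.
  by rewrite unfold_in mulKVmx //; apply/ZlatticeP; exists n.
by exists (Klat h); rewrite /= mulKVmx.
Qed.

Lemma klat_int_of c : exists n : 'cV[int]_g, K%:mx[R] *m c = n%:mx[R].
Proof. by have := klatP c; rewrite unfold_in => /ZlatticeP. Qed.

Lemma int_map_inj (m n : 'cV[int]_g) : m%:mx[R] = n%:mx[R] -> m = n.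
Proof.
move=> /colP h; apply/colP => i; have := h i; rewrite !mxE => /eqP.
by rewrite eqr_int => /eqP.
Qed.

(* The Smith normal form [K = L D M] identifies [K^-1 Z^g / Z^g] with the
   product of the cyclic groups [Z / d_i Z]. *)
Lemma Pi_enum : exists e : 'I_(`|\det K|%N) -> Pi R K,
  injective e /\ forall p, exists j, e j = p.
Proof.
have [L Lu [M Mu [d _ KE]]] := int_Smith_normal_form K.
pose D : 'M[int]_g := \matrix_(i, j) (d`_i *+ (i == j :> nat)).
have DE : D = diag_mx (\row_i d`_i).
  by apply/matrixP => i j; rewrite !mxE.
have KE' : K = L *m D *m M by exact: KE.
have detK : `|\det K|%N = (\prod_(i < g) `|(d`_i)%R|)%N.
  rewrite KE' !det_mulmx DE det_diag !abszM.
  have unit1 (A : 'M[int]_g) : A \in unitmx -> `|\det A|%N = 1%N.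
    by rewrite unitmxE qualifE /= => /orP[] /eqP ->.
  rewrite !unit1 // mul1n muln1.
  elim/big_rec2: _ => [//|i x y _ <-]; by rewrite abszM mxE.
have d0 i : d`_(val (i : 'I_g)) != 0.
  have : `|\det K|%N != 0%N.
    by rewrite absz_eq0 -(intr_eq0 R); exact: posdef_det_neq0.
  by rewrite detK (bigD1 i) //= muln_eq0 negb_or absz_eq0 => /andP[].
(* Systems of residues [0 <= y_i < |d_i|]; the class attached to [y] will be that of [K^-1 L y]. *)
pose T := {dffun forall i : 'I_g, 'I_(`|(d`_i)%R|%N)}.
have cardT : #|{: T}| = `|\det K|%N.
  rewrite detK card_dep_ffun foldrE big_image /=.
  by apply: eq_bigr => i _; rewrite card_ord.
pose vec (y : T) : 'cV[int]_g := \col_i (y i : nat)%:Z.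
have /choice[f hf] := fun y : T => klat_of_int (L *m vec y).
have Dvec (q : 'cV[int]_g) i : (D *m q) i 0 = d`_i * q i 0.
  by rewrite DE mul_diag_mx !mxE.
have f_inj : injective (fun y => cls (f y)).
  move=> y y' /cls_eq; rewrite unfold_in /= => /ZlatticeP[m hm].
  have h1 : K *m m = L *m (vec y - vec y').
    by apply: int_map_inj; rewrite map_mxM -hm mulmxBr !hf -map_mxB mulmxBr.
  have h2 : D *m (M *m m) = vec y - vec y'.
    by apply: (can_inj (mulKmx Lu)); rewrite -h1 KE' !mulmxA.
  apply/ffunP => i; apply: val_inj => /=.
  have := congr1 (fun v : 'cV[int]_g => v i 0) h2; rewrite Dvec !mxE.
  have := ltn_ord (y i); have := ltn_ord (y' i); set q := \sum_j _.
  move: (nat_of_ord (y i)) (nat_of_ord (y' i)) => u v hv hu hq.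
  (* The difference of two residues is the multiple [d_i q] but smaller than [|d_i|], so [q = 0]. *)
  have [q0|qn] := eqVneq q 0.
    by move: hq; rewrite q0 mulr0 => /esym/eqP; rewrite subr_eq0 => /eqP[].
  have : (`|(d`_i)%R| <= `|(d`_i * q)%R|)%N by rewrite abszM leq_pmulr // absz_gt0.
  rewrite hq; lia.
have f_surj p : exists y, cls (f y) = p.
  have [n hn] := klat_int_of (repr p).
  have [u uE] : exists u, u = invmx L *m n by exists (invmx L *m n).
  have di i : (0 < `|(d`_(val (i : 'I_g)))%R|)%N by rewrite absz_gt0 d0.
  have ui i : (`|((u i 0)%R %% `|(d`_(val (i : 'I_g)))%R|%N)%Z| < `|(d`_i)%R|)%N.
    have di0 : 0 < (`|(d`_(val i))%R|%N)%:Z by exact: di.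
    have r0 := modz_ge0 (u i 0) (lt0r_neq0 di0); have r1 := ltz_pmod (u i 0) di0.
    by rewrite -ltz_nat (gez0_abs r0).
  pose y : T := [ffun i => Ordinal (ui i)]; exists y.
  rewrite -[RHS]clsK; apply/cls_eq; rewrite unfold_in /=.
  have [q hq] : exists q : 'cV[int]_g, u - vec y = D *m q.
    (* Residues are taken modulo [|d_i|] while [D] multiplies by [d_i], which may be negative; [sgz]
       corrects the sign. *)
    exists (\col_i (sgz (d`_i) * ((u i 0)%R %/ (`|(d`_i)%R|%N)%:Z)%Z)).
    apply/colP => i; rewrite Dvec !mxE ffunE /=.
    have di0 : 0 < (`|(d`_(val i))%R|%N)%:Z by exact: di.
    rewrite (gez0_abs (modz_ge0 _ (lt0r_neq0 di0))).
    rewrite {1}(divz_eq (u i 0) (`|(d`_i)%R|%N)%:Z) addrK mulrA mulrC.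
    by congr (_ * _); rewrite abszEsg mulrC.
  apply/ZlatticeP; exists (- (invmx M *m q)).
  apply/eqP; rewrite -subr_eq0; apply/eqP; apply: (K_inj posK).
  rewrite mulmxBr mulmxBr hf hn -map_mxM -!map_mxB mulmxN opprK.
  have -> : K *m (invmx M *m q) = n - L *m vec y.
    rewrite KE' mulmxA mulmxK // -mulmxA -hq mulmxBr uE mulKVmx //.
  by rewrite addrC addrA subrK subrr map_mx0.
exists (fun j => cls (f (enum_val (cast_ord (esym cardT) j)))); split.
  by move=> i j /f_inj /enum_val_inj /cast_ord_inj.
move=> p; have [y <-] := f_surj p; exists (cast_ord cardT (enum_rank y)).
by rewrite cast_ordK enum_rankK.
Qed.

End FiniteQuotient.

(** * The space W and its theta basis *)

Section CdiffShift.
Variables (R : realType) (g : nat).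
Implicit Types (F : 'cV[R[i]]_g -> R[i]).

Lemma cdiff_translate F z w : cdiff F (z + w) -> cdiff (fun z => F (z + w)) z.
Proof.
move=> [L hL]; exists L => e e0; have [d d0 hd] := hL e e0; exists d => // h r rd hr.
by rewrite (addrAC z h w); exact: hd.
Qed.

Lemma cdiff_cst c z : cdiff (fun _ : 'cV[R[i]]_g => c) z.
Proof.
exists (fun=> 0) => e e0; exists 1 => // h r /andP[r0 _] _.
by rewrite subrr big1 ?subrr ?normc0 ?mulr_ge0 ?(ltW e0) // => i _; rewrite mul0r.
Qed.

End CdiffShift.

Section Multiplier.
Variables (R : realType) (g : nat) (tau : R[i]) (K : 'M[int]_g) (xi : 'cV[R[i]]_g).
Hypothesis symK : K^T = K.
Implicit Types (a b l : 'cV[R]_g) (z h : 'cV[R[i]]_g).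
Local Notation mult := (mult tau K xi).

Lemma mult_neq0 l z : mult l z != 0.
Proof. exact: cexp_neq0. Qed.

Lemma mult_translate l z h : mult l (z + h) =
  mult l z * cexp (- (2%:R * 'i%C * piC R * pairing l%:mxC (K%:mx[R[i]] *m h))).
Proof.
rewrite /mult -cexpD; congr cexp; rewrite mulmxDr scalerDr !pairingDr !pairingZr; ring.
Qed.

Lemma mult_real l z a : mult l (z + a%:mxC) = mult l z * cunit (- Kform K l a).
Proof. by rewrite mult_translate pairing_K_C /cunit rmorphN mulrN. Qed.

Lemma mult_real_int l z a n : Kform K l a = n%:~R -> mult l (z + a%:mxC) = mult l z.
Proof. by move=> h; rewrite mult_real h -intrN cunit_int mulr1. Qed.

Lemma mult_tau l b z : mult l (z + tau *: b%:mxC) =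
  mult l z * cexp (- (2%:R * 'i%C * piC R * (tau * (Kform K l b)%:C))).
Proof. by rewrite mult_translate -scalemxAr pairingZr pairing_K_C. Qed.

(** The cocycle relation of the multipliers. It gives the additivity of [R] in [b] and, with
    quasi-periodicity, its independence of the representative. *)
Lemma multD b1 b2 z : mult (b1 + b2) z = mult b1 z * mult b2 (z + tau *: b1%:mxC).
Proof.
have key (x y u v : R[i]) : x = y + (u + v) -> cexp x = cexp y * (cexp u * cexp v).
  by move=> ->; rewrite !cexpD.
rewrite mult_tau; apply: key.
rewrite map_mxD !pairingDl mulmxDr !pairingDr !pairing_Omega (KformC symK b2 b1); ring.
Qed.

Lemma mult0 z : mult 0 z = 1.
Proof. by rewrite /mult map_mx0 pairing0l mulr0 oppr0 cexp0. Qed.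

Lemma cdiff_multV l z : cdiff (fun z => (mult l z)^-1) z.
Proof.
have -> : (fun z => (mult l z)^-1) = (fun z => (mult l 0)^-1 *
    cexp (\sum_j (2%:R * 'i%C * piC R * (K%:mx[R[i]] *m l%:mxC) j 0) * z j 0)).
  apply/funext => y; rewrite -[y in LHS]add0r mult_translate invfM; congr (_ * _).
  rewrite -cexpN opprK pairing_mulmx map_trmx symK pairingE mulr_sumr; congr cexp.
  by apply: eq_bigr => j _; rewrite mulrA.
by apply: cdiffM; [exact: cdiff_cst|exact: cdiff_cexp_linear].
Qed.

End Multiplier.

Section ActionOnW.
Variables (R : realType) (g : nat) (tau : R[i]) (K : 'M[int]_g) (xi : 'cV[R[i]]_g).
Hypothesis symK : K^T = K.
Local Notation W := (Wspace tau K xi).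
Implicit Types (a b : klat R K) (Phi : W).

Lemma W_cdiff Phi z : cdiff Phi z.
Proof.
by have /asboolP[dP _ _] := WfunP Phi; apply/differentiable_cdiff; exact: dP.
Qed.

Lemma W_period Phi l z : l \in @Zlattice R g -> Phi (z + l%:mxC) = Phi z.
Proof. by have /asboolP[_ h _] := WfunP Phi; exact: h. Qed.

Lemma W_quasi Phi l z : l \in @Zlattice R g ->
  Phi (z + tau *: l%:mxC) = mult tau K xi l z * Phi z.
Proof. by have /asboolP[_ _ h] := WfunP Phi; exact: h. Qed.

Lemma Kform_Zl (l : 'cV[R]_g) b : l \in @Zlattice R g ->
  exists n : int, Kform K l b = n%:~R.
Proof. by move=> lZ; apply: Kform_int => //; exact: klatP. Qed.

Lemma Kform_Zr (l : 'cV[R]_g) b : l \in @Zlattice R g ->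
  exists n : int, Kform K b l = n%:~R.
Proof. by move=> lZ; rewrite KformC //; exact: Kform_Zl. Qed.

Lemma Sop_in_W a Phi : Sop a Phi \in in_W tau K xi.
Proof.
apply/asboolP; split.
- move=> z; apply/differentiable_cdiff; apply: cdiff_translate; exact: W_cdiff.
- by move=> l z lZ; rewrite /Sop addrAC (W_period _ _ lZ).
- move=> l z lZ; rewrite /Sop addrAC (W_quasi _ _ lZ).
  by have [n h] := Kform_Zl a lZ; rewrite (mult_real_int _ _ _ h).
Qed.

Lemma Rop_in_W b Phi : Rop tau K xi b Phi \in in_W tau K xi.
Proof.
apply/asboolP; split.
- move=> z; apply/differentiable_cdiff; apply: cdiffM; first exact: cdiff_multV.
  by apply: cdiff_translate; exact: W_cdiff.
- move=> l z lZ; rewrite /Rop addrAC (W_period _ _ lZ).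
  by have [n h] := Kform_Zr b lZ; rewrite (mult_real_int _ _ _ h).
- move=> l z lZ; rewrite /Rop addrAC (W_quasi _ _ lZ) !mult_tau (KformC symK l).
  have key (m1 m2 e w : R[i]) : m1 != 0 -> e != 0 ->
      (m1 * e)^-1 * (m2 * e * w) = m2 * (m1^-1 * w).
    by move=> m0 e0; field; rewrite m0 e0.
  by apply: key; [exact: mult_neq0|exact: cexp_neq0].
Qed.

Definition Sw a Phi : W := WSpace (Sop_in_W a Phi).
Definition Rw b Phi : W := WSpace (Rop_in_W b Phi).

Lemma W_ext (Phi Psi : W) : (forall z, Phi z = Psi z) -> Phi = Psi.
Proof. by move=> h; apply: val_inj; apply/funext. Qed.

Lemma WfunD (Phi Psi : W) z : (Phi + Psi) z = Phi z + Psi z.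
Proof. by []. Qed.

Lemma WfunZ c Phi z : (c *: Phi) z = c * Phi z.
Proof. by []. Qed.

Lemma Wfun0 z : (0 : W) z = 0.
Proof. by []. Qed.

Lemma Wfun_sum (I : Type) (s : seq I) (F : I -> W) z :
  (\sum_(i <- s) F i) z = \sum_(i <- s) F i z.
Proof. by elim: s => [|i s IH]; rewrite ?big_nil // !big_cons WfunD IH. Qed.

Lemma Sw_lattice a a' Phi : cls a = cls a' -> Sw a Phi = Sw a' Phi.
Proof.
move=> /cls_eq; rewrite unfold_in /= => aZ; apply: W_ext => z /=.
rewrite /Sop -[klat_val a in LHS](subrK (klat_val a')) map_mxD addrA addrAC.
by rewrite (W_period _ _ aZ).
Qed.

Lemma Rw_lattice b b' Phi : cls b = cls b' -> Rw b Phi = Rw b' Phi.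
Proof.
move=> /cls_eq; rewrite unfold_in /= => bZ; apply: W_ext => z /=.
rewrite /Rop -[klat_val b](subrK (klat_val b')) addrC.
have key (m1 m2 w : R[i]) : m2 != 0 -> (m1 * m2)^-1 * (m2 * w) = m1^-1 * w.
  by move=> m0; rewrite invfM -mulrA mulKf.
rewrite (multD _ _ symK) map_mxD scalerDr addrA (W_quasi _ _ bZ).
by apply: key; exact: mult_neq0.
Qed.

Lemma Sw_add a a' Phi : Sw (a + a') Phi = Sw a (Sw a' Phi).
Proof. by apply: W_ext => z; rewrite /= /Sop /= map_mxD addrA. Qed.

Lemma Rw_add b b' Phi : Rw (b + b') Phi = Rw b (Rw b' Phi).
Proof.
apply: W_ext => z; rewrite /= /Rop /= multD // map_mxD scalerDr addrA invfM.
by rewrite -mulrA.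
Qed.

(** The source of the cocycle in the group law: [U_b (z + a)] is [U_b z] times
    [exp (- 2 pi i (b, K a))]. *)
Lemma Sw_Rw a b Phi : Sw a (Rw b Phi) = upsilon (cls a) (cls b) *: Rw b (Sw a Phi).
Proof.
apply: W_ext => z; rewrite WfunZ upsilonE //= /Sop /Rop /Sop addrAC mult_real invfM.
have -> : (cunit (- Kform K b a))^-1 = cunit (Kform K a b).
  rewrite (KformC symK a b); apply: (mulIf (cexp_neq0 _ : cunit (- Kform K b a) != 0)).
  by rewrite mulVf ?cexp_neq0 // -cunitD subrr cunit0.
by rewrite [_^-1 * _]mulrC mulrA.
Qed.

Lemma W_fourier_descend Phi m (n : 'cV[int]_g) :
  fourier_coef Phi (m - K *m n) = 0 -> fourier_coef Phi m = 0.
Proof.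
move=> h; have lZ : n%:mx[R] \in @Zlattice R g by apply/ZlatticeP; exists n.
have dP := W_cdiff Phi; have pP := W_period Phi.
rewrite -(fourier_coef_shift dP (fun l z => pP l z) m (tau *: (n%:mx[R])%:mxC)).
have gP : cont_periodic (fun x => Phi x%:mxC * rchar (m - K *m n) x).
  apply: cont_periodicM (rchar_cont_periodic _ _).
  have -> : (fun x : 'cV[R]_g => Phi x%:mxC) = (fun x => Phi (0 + x%:mxC)).
    by apply/funext => x; rewrite add0r.
  exact: (cont_periodic_real_shift dP (fun l z => pP l z)).
have -> : (fun x : 'cV[R]_g => Phi (tau *: (n%:mx[R])%:mxC + x%:mxC) *
      echar m (tau *: (n%:mx[R])%:mxC + x%:mxC)) =
    (fun x => mult tau K xi n%:mx[R] 0 * echar m (tau *: (n%:mx[R])%:mxC) *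
       (Phi x%:mxC * rchar (m - K *m n) x)).
  apply/funext => x; rewrite echarD echar_real addrC (W_quasi _ _ lZ).
  have -> : mult tau K xi n%:mx[R] x%:mxC = mult tau K xi n%:mx[R] 0 * cunit (- Kform K
    n%:mx[R] x).
    by rewrite -mult_real add0r.
  rewrite rcharD.
  have -> : cunit (- Kform K n%:mx[R] x) = rchar (- (K *m n)) x.
    by rewrite /rchar map_mxN pairingNl map_mxM /Kform pairing_mulmx map_trmx symK.
  ring.
by rewrite meanZ // -/(fourier_coef Phi (m - K *m n)) h mulr0.
Qed.

Lemma fourier_coef_linear (I : Type) (s : seq I) (c : I -> R[i]) (F : I -> W) m :
  fourier_coef (\sum_(i <- s) c i *: F i) m = \sum_(i <- s) c i * fourier_coef (F i) m.
Proof.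
have gF Phi : cont_periodic (fun x => Phi x%:mxC * rchar m x).
  apply: cont_periodicM (rchar_cont_periodic _ _).
  have -> : (fun x : 'cV[R]_g => Phi x%:mxC) = (fun x => Phi (0 + x%:mxC)).
    by apply/funext => x; rewrite add0r.
  exact: (cont_periodic_real_shift (W_cdiff Phi) (fun l z => @W_period Phi l z)).
have gcF i : cont_periodic (fun x => c i * (F i x%:mxC * rchar m x)).
  exact: cont_periodicM (cont_periodic_cst _ _) (gF _).
have [_ h] := mean_sum s gcF.
transitivity (cube_integralC (fun x => \sum_(i <- s) c i * (F i x%:mxC * rchar m x))).
  congr cube_integralC; apply/funext => x; rewrite Wfun_sum mulr_suml.
  by apply: eq_bigr => i _; rewrite WfunZ mulrA.
by rewrite h; apply: eq_bigr => i _; rewrite meanZ.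
Qed.

End ActionOnW.

Section ThetaBasis.
Variables (R : realType) (g : nat) (tau : R[i]) (K : 'M[int]_g) (xi : 'cV[R[i]]_g).
Hypotheses (tau_gt0 : 0 < complex.Im tau) (symK : K^T = K) (posK : posdefmx R K).
Local Notation W := (Wspace tau K xi).
Implicit Types (a b c : klat R K) (p q : Pi R K) (Phi : W).

Definition theta_vec p : W :=
  WSpace (theta_pull_in_W xi tau_gt0 symK posK (klatP (repr p))).

Lemma theta_vecE c z : theta_vec (cls c) z = theta_pull tau K xi c z.
Proof.
rewrite /=; have [m mZ ->] := repr_cls c.
by rewrite /= theta_pull_lattice.
Qed.

Lemma Sw_theta a p : Sw a (theta_vec p) = upsilon (cls a) p *: theta_vec p.
Proof.
apply: W_ext => z; rewrite -[p]clsK WfunZ; move: (repr p) => c.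
rewrite -[LHS]/(theta_vec (cls c) (z + (klat_val a)%:mxC)) !theta_vecE upsilonE //.
by rewrite theta_pull_translate //; exact: klatP.
Qed.

Lemma Rw_theta b p : Rw symK b (theta_vec p) = theta_vec (p + cls b).
Proof.
apply: W_ext => z; rewrite -[p]clsK -clsD; move: (repr p) => c.
rewrite -[LHS]/((mult tau K xi b z)^-1 * theta_vec (cls c) (z + tau *: (klat_val
  b)%:mxC)).
rewrite !theta_vecE theta_pull_quasi //.
by rewrite mulKf // mult_neq0.
Qed.

(** The coefficients at the frequencies [- n q] are functionals diagonal on the theta vectors; they
    yield independence and the coordinates of a general element. *)
Lemma theta_vec_coef : exists n : Pi R K -> 'cV[int]_g,
  [/\ forall p, K%:mx[R] *m repr p = (n p)%:mx[R],
      forall p, fourier_coef (theta_vec p) (- n p) != 0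
    & forall p q, p != q -> fourier_coef (theta_vec p) (- n q) = 0].
Proof.
have /choice[n hn] := fun p : Pi R K => klat_int_of (repr p).
exists n; split=> // [p|p q pq]; first by apply: theta_coef_diag => //; exact: hn.
apply: theta_coef_offdiag (hn p) (hn q) _ => //; apply/negP => pqZ.
move/eqP: pq; apply; rewrite -[p]clsK -[q]clsK; apply/cls_eq.
by rewrite unfold_in.
Qed.

Lemma theta_basis : is_basis theta_vec.
Proof.
have [n [hn diag offdiag]] := theta_vec_coef.
split=> [s c us s0 i is_|v].
  have := congr1 (fun Phi : W => fourier_coef Phi (- n i)) s0.
  rewrite fourier_coef_linear (bigD1_seq i) //= big1 => [|j ji]; last first.
    by rewrite offdiag ?mulr0 // eq_sym.
  rewrite addr0; have := fourier_coef_linear [::] c theta_vec (- n i).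
  rewrite !big_nil => -> /eqP; rewrite mulf_eq0 (negbTE (diag i)) orbF.
  by move/eqP.
have [e [e_inj e_surj]] := Pi_enum posK.
pose s := [seq e j | j <- enum 'I_(`|\det K|%N)].
have us : uniq s by rewrite map_inj_uniq ?enum_uniq.
have sP p : p \in s.
  by have [j <-] := e_surj p; apply: map_f; rewrite mem_enum.
pose al p := fourier_coef v (- n p) / fourier_coef (theta_vec p) (- n p).
exists s, al; apply/eqP; rewrite -subr_eq0; apply/eqP.
set G := v - _.
have GE m : fourier_coef G m = fourier_coef v m - \sum_(p <- s) al p * fourier_coef
  (theta_vec p) m.
  (* [v] minus a combination is written as one combination indexed by [option], to which
     [fourier_coef_linear] applies. *)
  pose F (o : option (Pi R K)) := if o is Some p then theta_vec p else v.
  pose al' (o : option (Pi R K)) := if o is Some p then - al p else 1.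
  have -> : G = \sum_(o <- None :: map Some s) al' o *: F o.
    rewrite big_cons big_map /= scale1r /G -sumrN; congr (_ + _).
    by apply: eq_bigr => p _; rewrite scaleNr.
  rewrite fourier_coef_linear big_cons big_map /= mul1r -sumrN; congr (_ + _).
  by apply: eq_bigr => p _; rewrite mulNr.
have G0 p : fourier_coef G (- n p) = 0.
  rewrite GE (bigD1_seq p) //= big1 => [|q qp]; last by rewrite offdiag ?mulr0.
  by rewrite addr0 /al divfK ?diag // subrr.
apply: W_ext => z; rewrite Wfun0.
apply: (entire_fourier_unique (W_cdiff G) (fun l z => @W_period _ _ _ _ _ G l z)) => m.
(* With [K c = - m] and [k] the lattice vector separating [c] from its chosen representative,
   [m - K k] is the frequency [- n (cls c)], where the coefficient of [G] is known to vanish. *)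
have [c hc] := klat_of_int posK (- m).
have [l lZ hl] := repr_cls c; have /ZlatticeP[k hk] := lZ.
have nE : - n (cls c) = m - K *m k.
  apply: (@int_map_inj R); rewrite map_mxN -hn hl /= mulmxDr hc hk.
  by rewrite !map_mxB map_mxN map_mxM opprD opprK.
by apply: (W_fourier_descend symK (n := k)); rewrite -nE.
Qed.

Lemma basis_reindex (F : fieldType) (V : lmodType F) (I : choiceType) (J : finType)
    (e : J -> I) (v : I -> V) : injective e -> (forall i, exists j, e j = i) ->
  is_basis v -> is_basis (v \o e).
Proof.
move=> e_inj e_surj [vfree vspan]; split=> [s c us s0 j js|u].
  have /choice[f fK] := e_surj.
  have := vfree (map e s) (c \o f); rewrite map_inj_uniq // big_map => /(_ us).
  have fe i : f (e i) = i by apply: e_inj; rewrite fK.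
  have -> : \sum_(i <- s) (c \o f) (e i) *: v (e i) = 0.
    by rewrite -[RHS]s0; apply: eq_bigr => i _; rewrite /= fe.
  by move=> /(_ erefl (e j)); rewrite /= fe; apply; exact: map_f.
have [s [c ->]] := vspan u; have /choice[f fK] := e_surj.
exists (map f s), (c \o e); rewrite big_map; apply: eq_bigr => i _.
by rewrite /= fK.
Qed.

Lemma W_has_dim : has_dim W `|\det K|%N.
Proof.
have [e [e_inj e_surj]] := Pi_enum posK.
by exists (theta_vec \o e); exact: basis_reindex e_inj e_surj theta_basis.
Qed.

(** For the fractional part [f], [cos (2 pi f) = 1] means [sin (pi f) = 0], impossible for
    [0 < f < 1]. *)
Lemma cunit_eq1 (x : R) : cunit x = 1 -> x \is a Num.int.
Proof.
pose f := x - (Num.floor x)%:~R.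
have f0 : 0 <= f by rewrite subr_ge0 floor_le.
have f1 : f < 1 by have := floorD1_gt x; rewrite intrD /f /=; lra.
have xE : x = f + (Num.floor x)%:~R by rewrite subrK.
rewrite {1}xE cunitD cunit_int mulr1 cunit_cos => /(congr1 (@complex.Re R)) /=.
have [fz _|fn] := eqVneq f 0; first by rewrite xE fz add0r intr_int.
have pi0 := pi_gt0 R; have fp : 0 < f by rewrite lt_def fn.
have -> : 2 * pi * f = (pi * f) *+ 2 by rewrite mulr2n; ring.
rewrite cos_mulr2n => h.
have : 0 < sin (pi * f).
  by rewrite sin_gt0_pi // mulr_gt0 //= gtr_pMr.
have := cos2Dsin2 (pi * f); move: h; rewrite mulr2n !expr2; nra.
Qed.

(** The solution [a] of [K a = e_i] pairs with [p] to give its [i]-th coordinate modulo 1. *)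
Lemma upsilon_nondegenerate p : (forall a, upsilon (cls a) p = 1) -> p = 0.
Proof.
move=> h; have -> : 0 = cls (0 : klat R K) by apply/esym; rewrite /cls raddf0.
rewrite -[p]clsK; apply/cls_eq; rewrite subr0 unfold_in; apply/fintype.forallP => i.
have [a ha] := klat_of_int posK (delta_mx i 0).
have := h a; rewrite -[p]clsK upsilonE // KformC // => /cunit_eq1.
rewrite /Kform ha clsK map_delta_mx pairingE (bigD1 i) //= big1 => [|j ji].
  by rewrite !mxE !eqxx mulr1 addr0.
by rewrite !mxE (negbTE ji) mulr0.
Qed.

Lemma upsilon_separates p q : p <> q ->
  exists a, upsilon (cls a) p != upsilon (cls a) q.
Proof.
move=> pq; apply: contrapT => /forallNP h; apply: pq; apply/eqP; rewrite -subr_eq0.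
apply/eqP/upsilon_nondegenerate => a; rewrite upsilonDr // upsilonNr //.
have /negP := h a; rewrite negbK => /eqP ->; rewrite mulfV // ; exact: cexp_neq0.
Qed.

End ThetaBasis.

(** * The hermitian product and the Heisenberg representation *)

Section Hermitian.
Variables (R : realType) (g : nat) (tau : R[i]) (K : 'M[int]_g) (xi : 'cV[R[i]]_g).
Variables (a0 b0 : 'cV[R]_g).
Hypotheses (symK : K^T = K) (xiE : xi = tau *: a0%:mxC + b0%:mxC).
Local Notation W := (Wspace tau K xi).
Local Notation dot := (herm tau K a0).
Implicit Types (a b : 'cV[R]_g) (Phi Psi : W) (z : 'cV[R[i]]_g).

Definition herm_weight (y : 'cV[R]_g) : R :=
  expR (- (2 * pi * complex.Im tau * pairing y (K%:mx[R] *m y + 2 *: a0))).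

Definition complex_point (v : 'cV[R]_(g + g)) : 'cV[R[i]]_g :=
  (usubmx v)%:mxC + tau *: (dsubmx v)%:mxC.

Definition herm_integrand (F1 F2 : 'cV[R[i]]_g -> R[i]) (v : 'cV[R]_(g + g)) : R[i] :=
  (herm_weight (dsubmx v))%:C * F1 (complex_point v) * (F2 (complex_point v))^*%C.

Lemma hermE (F1 F2 : 'cV[R[i]]_g ->
  R[i]^o) : dot F1 F2 = cube_integralC (herm_integrand F1 F2).
Proof. by []. Qed.

Lemma normc_mult b (v : 'cV[R]_(g + g)) : normc (mult tau K xi b (complex_point v)) =
  expR (pi * complex.Im tau *
    (2 * pairing b a0 + 2 * Kform K b (dsubmx v) + Kform K b b)).
Proof.
rewrite normc_cexp xiE /complex_point !mulmxDr -!scalemxAr !scalerDr !pairingDr.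
rewrite !pairingZr pairing_Omega !pairing_K_C !pairing_map; congr expR.
have -> : (2%:R : R[i]) = (2 : R)%:C by rewrite rmorph_nat.
case: (tau) => t1 t2; rewrite /piC /=; ring.
Qed.

(** The weight is made for this identity: completing the square in [y] produces exactly [|U_b|^-2],
    and the term in [a0] matches the contribution of [tau a0] to [|U_b|]. *)
Lemma herm_weight_shift b (v : 'cV[R]_(g + g)) : herm_weight (dsubmx v + b) =
  herm_weight (dsubmx v) * (normc (mult tau K xi b (complex_point v)) ^+ 2)^-1.
Proof.
rewrite normc_mult -expRM_natr -expRN -expRD; congr expR.
rewrite mulmxDr !pairingDr !pairingDl !pairingZr -!/(Kform K _ _) (KformC symK (dsubmx
  v) b); ring.
Qed.

(** The factor [|U_b|^-2] gained by the weight on the left is what [U_b^-1] and its conjugate supply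
    on the right. *)
Lemma herm_integrand_shift a b (F1 F2 : 'cV[R[i]]_g -> R[i]) v :
  herm_integrand F1 F2 (v + col_mx a b) =
  herm_integrand (Rop tau K xi b (Sop a F1)) (Rop tau K xi b (Sop a F2)) v.
Proof.
rewrite /herm_integrand linearD /= col_mxKd herm_weight_shift.
have -> : complex_point (v + col_mx a b) = complex_point v + tau *: b%:mxC + a%:mxC.
  rewrite /complex_point !linearD /= col_mxKu col_mxKd.
  by rewrite !map_mxD scalerDr; apply/colP => i; rewrite !mxE; ring.
rewrite /Rop /Sop; set m := mult _ _ _ _ _; set z := _ + _ + _.
have m0 : m != 0 by exact: cexp_neq0.
have mm : (normc m ^+ 2)%:C = m * m^*%C by rewrite -sqr_normc normr_normc rmorphXn.
have mc0 : m^*%C != 0 by rewrite conjc_eq0.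
have -> : (herm_weight (dsubmx v) * (normc m ^+ 2)^-1)%:C =
    (herm_weight (dsubmx v))%:C * (m * m^*%C)^-1 by rewrite -mm -fmorphV -rmorphM.
have -> : (m^-1 * F2 z)^*%C = (m^*%C)^-1 * (F2 z)^*%C by rewrite rmorphM fmorphV.
by field; rewrite m0 mc0.
Qed.

Lemma herm_integrand_cont_periodic Phi Psi : cont_periodic (herm_integrand Phi Psi).
Proof.
split.
  move=> v l lZ; rewrite -[l]vsubmxK herm_integrand_shift.
  have lu : usubmx l \in @Zlattice R g.
    by apply/fintype.forallP => i; rewrite mxE; move/fintype.forallP: lZ; apply.
  have ld : dsubmx l \in @Zlattice R g.
    by apply/fintype.forallP => i; rewrite mxE; move/fintype.forallP: lZ; apply.
  (* For lattice vectors [R] and [S] act trivially on the space, so periodicity is the shift formula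
     itself. *)
  have inv (X : W) : Rop tau K xi (dsubmx l) (Sop (usubmx l) X) = X.
    apply/funext => z; rewrite /Rop /Sop (W_period _ _ lu) (W_quasi _ _ ld).
    by rewrite mulKf // mult_neq0.
  by rewrite !inv.
have cpt i : cont (fun v => complex_point v i 0).
  have -> : (fun v => complex_point v i 0) = fun v : 'cV[R]_(g + g) =>
      (v (lshift g i) 0)%:C + tau * (v (rshift g i) 0)%:C.
    by apply/funext => v; rewrite !mxE.
  apply: contD; first exact: cont_coord.
  by apply: contM; [exact: cont_cst|exact: cont_coord].
have cW (X : W) : cont (fun v => X (complex_point v)).
  by apply: cont_comp_cdiff => //; exact: W_cdiff.
apply: contM; last by apply: cont_conj.
apply: contM => //.
(* The weight is rewritten as [cexp] of a polynomial, to which the closure rules of [cont] apply. *)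
have -> : (fun v : 'cV[R]_(g + g) => (herm_weight (dsubmx v))%:C) =
  (fun v => cexp (- ((2 * pi * complex.Im tau)%:C *
      \sum_i (v (rshift g i) 0)%:C * (\sum_j (K i j)%:~R * (v (rshift g j) 0)%:C + (2 *
        a0 i 0)%:C)))).
  apply/funext => v.
  have -> : \sum_i (v (rshift g i) 0)%:C * (\sum_j (K i j)%:~R * (v (rshift g j) 0)%:C
    + (2 * a0 i 0)%:C)
     = (pairing (dsubmx v) (K%:mx[R] *m dsubmx v + 2 *: a0))%:C.
    rewrite pairingE rmorph_sum; apply: eq_bigr => i _ /=.
    have -> : (K%:mx[R] *m dsubmx v + 2 *: a0) i 0 =
        \sum_j (K i j)%:~R * v (rshift g j) 0 + 2 * a0 i 0.
      by rewrite !mxE; congr (_ + _); apply: eq_bigr => j _; rewrite !mxE.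
    rewrite mxE [RHS]rmorphM rmorphD rmorph_sum; congr (_ * (_ + _)).
    by apply: eq_bigr => j _; rewrite rmorphM /= rmorph_int.
  rewrite -rmorphM -rmorphN /cexp /= cos0 sin0 mulr1 mulr0 /herm_weight.
  by [].
apply: cont_cexp.
have -> : (fun v : 'cV[R]_(g + g) => - ((2 * pi * complex.Im tau)%:C *
      \sum_i (v (rshift g i) 0)%:C * (\sum_j (K i j)%:~R * (v (rshift g j) 0)%:C + (2 *
        a0 i 0)%:C))) =
   (fun v => (- (2 * pi * complex.Im tau)%:C) *
      \sum_i (v (rshift g i) 0)%:C * (\sum_j (K i j)%:~R * (v (rshift g j) 0)%:C + (2 *
        a0 i 0)%:C)).
  by apply/funext => v; rewrite mulNr.
apply: contM; first exact: cont_cst.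
apply: cont_sum => i; apply: contM; first exact: cont_coord.
apply: contD; last exact: cont_cst.
by apply: cont_sum => j; apply: contM; [exact: cont_cst|exact: cont_coord].
Qed.

Lemma herm_translate a b Phi Psi :
  dot (Rop tau K xi b (Sop a Phi)) (Rop tau K xi b (Sop a Psi)) = dot Phi Psi.
Proof.
rewrite !hermE -(mean_shift (col_mx a b) (herm_integrand_cont_periodic Phi Psi)).
by congr cube_integralC; apply/funext => v; rewrite herm_integrand_shift.
Qed.

Lemma hermZ (c d : R[i]) Phi Psi : dot (c *: Phi) (d *: Psi) = c * d^*%C * dot Phi Psi.
Proof.
rewrite !hermE -meanZ; last exact: herm_integrand_cont_periodic.
congr cube_integralC; apply/funext => v; rewrite /herm_integrand.
rewrite -[(c *: Phi : W) _]/(c * Phi _) -[(d *: Psi : W) _]/(d * Psi _) rmorphM /=;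
  ring.
Qed.

End Hermitian.

(** * The Heisenberg representation *)

Section HeisenbergAction.
Variables (R : realType) (g : nat) (tau : R[i]) (K : 'M[int]_g) (xi : 'cV[R[i]]_g).
Variables (a0 b0 : 'cV[R]_g).
Hypotheses (tau_gt0 : 0 < complex.Im tau) (symK : K^T = K) (posK : posdefmx R K).
Hypothesis xiE : xi = tau *: a0%:mxC + b0%:mxC.
Local Notation W := (Wspace tau K xi).
Local Notation G := (heisenberg symK posK).
Local Notation dot := (herm tau K a0).
Local Notation H := (@theta_vec R g tau K xi tau_gt0 symK posK).
Implicit Types (a b : klat R K) (p q : Pi R K) (Phi : W) (x y : G).

Definition heis_act (x : G) (Phi : W) : W :=
  (x.2 : R[i]) *: Rw symK (repr x.1.2) (Sw (repr x.1.1) Phi).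

Lemma heis_act_linear x : linear (heis_act x).
Proof.
move=> c u v; apply: W_ext => z.
rewrite -[LHS]/((x.2 : R[i]) * ((mult tau K xi (repr x.1.2) z)^-1 *
  (c * u (z + tau *: (klat_val (repr x.1.2))%:mxC + (klat_val (repr x.1.1))%:mxC) +
   v (z + tau *: (klat_val (repr x.1.2))%:mxC + (klat_val (repr x.1.1))%:mxC)))).
rewrite -[RHS]/(c * ((x.2 : R[i]) * ((mult tau K xi (repr x.1.2) z)^-1 *
  u (z + tau *: (klat_val (repr x.1.2))%:mxC + (klat_val (repr x.1.1))%:mxC))) +
  (x.2 : R[i]) * ((mult tau K xi (repr x.1.2) z)^-1 *
  v (z + tau *: (klat_val (repr x.1.2))%:mxC + (klat_val (repr x.1.1))%:mxC))).
ring.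
Qed.

HB.instance Definition _ x :=
  GRing.isLinear.Build R[i] W W *:%R (heis_act x) (heis_act_linear x).

Definition heis_rep (x : G) : {linear W -> W} := heis_act x.

Lemma heis_repE a b (gam : gamma R K) Phi :
  heis_rep (cls a, cls b, gam) Phi = (gam : R[i]) *: Rw symK b (Sw a Phi).
Proof.
rewrite /heis_rep /= /heis_act /=; congr (_ *: _).
by rewrite (Sw_lattice _ (clsK (cls a))) (Rw_lattice _ _ (clsK (cls b))).
Qed.

Lemma SwZ a (c : R[i]) Phi : Sw a (c *: Phi) = c *: Sw a Phi.
Proof. by apply: W_ext. Qed.

Lemma RwZ b (c : R[i]) Phi : Rw symK b (c *: Phi) = c *: Rw symK b Phi.
Proof. by apply: W_ext => z; exact: mulrCA. Qed.

Lemma Sw0 Phi : Sw 0 Phi = Phi.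
Proof. by apply: W_ext => z; rewrite /= /Sop map_mx0 addr0. Qed.

Lemma Rw0 Phi : Rw symK 0 Phi = Phi.
Proof. by apply: W_ext => z; rewrite /= /Rop mult0 map_mx0 scaler0 addr0 invr1 mul1r.
  Qed.

Lemma cls0 : cls (0 : klat R K) = 0.
Proof. by rewrite /cls raddf0. Qed.

Lemma heis_rep_representation : representation heis_rep.
Proof.
split=> [v|x y v].
  have -> : (1%g : G) = (cls (0 : klat R K), cls (0 : klat R K), Gamma (in_gamma1 R K)).
    by rewrite cls0.
  by rewrite heis_repE scale1r Sw0 Rw0.
case: x => [[p1 q1] c1]; case: y => [[p2 q2] c2].
rewrite -[p1]clsK -[q1]clsK -[p2]clsK -[q2]clsK.
move: (repr p1) (repr q1) (repr p2) (repr q2) => a1 b1 a2 b2.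
have -> : (((cls a1, cls b1, c1) : G) * ((cls a2, cls b2, c2) : G))%g = (cls (a1 + a2),
  cls (b1 + b2),
   Gamma (in_gammaM (in_gammaM (upsilon_gamma symK posK (cls a1) (cls b2))
                               (gammaP c1)) (gammaP c2))).
  by rewrite !clsD.
rewrite !heis_repE /= SwZ RwZ Sw_Rw RwZ !scalerA Sw_add Rw_add //.
by congr (_ *: _); ring.
Qed.

Lemma normc_root_unity : normc (root_unity R K) = 1.
Proof.
have -> : root_unity R K = cunit ((\det K)%:~R^-1).
  by rewrite /root_unity /cunit fmorphV rmorph_int.
by rewrite cunit_cos /normc cos2Dsin2 sqrtr1.
Qed.

Lemma normc_gamma (c : gamma R K) : normc c = 1.
Proof.
case: c => c /= /asboolP[n ->]; case: n => n;
  first by rewrite -exprnP normcX normc_root_unity expr1n.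
by rewrite NegzE -exprnN normcV normcX normc_root_unity expr1n invr1.
Qed.

Lemma unit_mul_conj (c : R[i]) : normc c = 1 -> c * c^*%C = 1.
Proof. by move=> h; rewrite -sqr_normc normr_normc h rmorph1 expr1n. Qed.

Lemma heis_rep_unitary : unitary_rep heis_rep (fun Phi1 Phi2 : W => dot Phi1 Phi2).
Proof.
move=> [[p q] c] u v; rewrite -[p]clsK -[q]clsK !heis_repE (hermZ symK xiE).
by rewrite unit_mul_conj ?normc_gamma // mul1r (herm_translate symK xiE).
Qed.

(** A spanning list may repeat indices, so the coefficients of [p] are gathered first; if they
    cancel, [p] is dropped and a shorter list remains. *)
Lemma span_separate (s : seq (Pi R K)) (c : Pi R K -> R[i]) (u : W) :
  u = \sum_(i <- s) c i *: H i -> u <> 0 -> exists p (al : R[i]) s',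
    [/\ al != 0, p \notin s' & u = al *: H p + \sum_(i <- s') c i *: H i].
Proof.
have [n] := ubnP (size s); elim: n s => // n IH [|p s] hs uE u0.
  by case: u0; rewrite uE big_nil.
pose s' := [seq i <- p :: s | i != p]; pose al := \sum_(i <- p :: s | i == p) c i.
have uE' : u = al *: H p + \sum_(i <- s') c i *: H i.
  rewrite uE (bigID (fun i => i == p)) /= big_filter scaler_suml; congr (_ + _).
  by apply: eq_bigr => i /eqP ->.
have [al0|aln] := eqVneq al 0; last first.
  by exists p, al, s'; split=> //; rewrite mem_filter eqxx.
apply: (IH s') => //; last by rewrite uE' al0 scale0r add0r.
have hs' : (size s < n)%N by exact: hs.
apply: leq_ltn_trans hs'; rewrite /s' /= eqxx /= size_filter; exact: count_size.
Qed.

Section Invariant.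
Variable U : set W.
Hypotheses (U0 : U 0) (Ulin : forall (c : R[i]) u v, U u -> U v -> U (c *: u + v)).
Hypothesis Uinv : forall x u, U u -> U (heis_rep x u).

Lemma invariant_Sw a u : U u -> U (Sw a u).
Proof.
move=> /(Uinv (cls a, cls 0, Gamma (in_gamma1 R K))).
by rewrite heis_repE scale1r Rw0.
Qed.

Lemma invariant_Rw b u : U u -> U (Rw symK b u).
Proof.
move=> /(Uinv (cls 0, cls b, Gamma (in_gamma1 R K))).
by rewrite heis_repE scale1r Sw0.
Qed.

(* [S_a - upsilon(a, q)] kills the [H q] component and keeps that of [H p]. *)
Lemma invariant_isolate p (s : seq (Pi R K)) (al : R[i]) (c : Pi R K -> R[i]) :
  al != 0 -> p \notin s -> U (al *: H p + \sum_(i <- s) c i *: H i) -> U (H p).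
Proof.
elim: s al c => [|q s IH] al c al0; first rewrite big_nil addr0 => _ h.
  have := Ulin al^-1 h U0; by rewrite addr0 scalerA mulVf // scale1r.
rewrite inE negb_or => /andP[pq ps] h.
have [a ha] := upsilon_separates symK posK (elimN eqP pq).
set u := _ + _ in h; pose y i := upsilon (cls a) i - upsilon (cls a) q.
have uE : - upsilon (cls a) q *: u + Sw a u =
    (al * y p) *: H p + \sum_(i <- s) (c i * y i) *: H i.
  have SwE : Sw a u = (al * upsilon (cls a) p) *: H p +
      \sum_(i <- q :: s) (c i * upsilon (cls a) i) *: H i.
    have SwD (u1 u2 : W) : Sw a (u1 + u2) = Sw a u1 + Sw a u2 by apply: W_ext.
    rewrite /u SwD SwZ Sw_theta scalerA; congr (_ + _).
    elim: (q :: s) => [|i r IHr]; first by rewrite !big_nil; apply: W_ext.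
    by rewrite !big_cons SwD SwZ Sw_theta scalerA IHr.
  rewrite SwE /u scalerDr addrACA scalerA -scalerDl; congr (_ *: _ + _).
    by rewrite /y; ring.
  rewrite scaler_sumr -big_split big_cons /= scalerA -scalerDl.
  have -> : - upsilon (cls a) q * c q + c q * upsilon (cls a) q = 0 by ring.
  rewrite scale0r add0r.
  by apply: eq_bigr => i _; rewrite scalerA -scalerDl /y; congr (_ *: _); ring.
apply: (IH (al * y p) (fun i => c i * y i)) => //.
  by rewrite mulf_neq0 // subr_eq0.
by rewrite -uE; apply: Ulin => //; exact: invariant_Sw.
Qed.

Lemma invariant_full p : U (H p) -> forall v, U v.
Proof.
move=> hp; have hq q : U (H q).
  have := invariant_Rw (repr (q - p)) hp.
  by rewrite Rw_theta clsK addrC subrK.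
have [_ span] := theta_basis xi tau_gt0 symK posK.
move=> v; have [s [c ->]] := span v.
elim: s => [|i s IH]; first by rewrite big_nil.
by rewrite big_cons; exact: Ulin.
Qed.

End Invariant.

Lemma theta_vec_neq0 p : H p <> 0.
Proof.
move=> h; have [free _] := theta_basis xi tau_gt0 symK posK.
have := free [:: p] (fun=> 1) erefl.
rewrite big_seq1 h scaler0 => /(_ erefl p); rewrite inE eqxx => /(_ isT)/eqP.
by rewrite oner_eq0.
Qed.

Lemma heis_rep_irreducible : irreducible_rep heis_rep.
Proof.
split; first by exists (H 0); apply/eqP; exact: theta_vec_neq0.
move=> U U0 Ulin Uinv; have [[u [Uu u0]]|nU] := pselect (exists u, U u /\ u <> 0).
  right; apply/seteqP; split => // v _.
  have [_ span] := theta_basis xi tau_gt0 symK posK.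
  have [s [c uE]] := span u; have [p [al [s' [al0 ps' uE']]]] := span_separate uE u0.
  apply: (invariant_full (p := p) U0 Ulin Uinv).
  by apply: (invariant_isolate U0 Ulin Uinv (c := c) al0 ps'); rewrite -uE'.
left; apply/seteqP; split=> [v Uv|v ->] //.
by apply: contrapT => v0; apply: nU; exists v.
Qed.

Lemma normc_upsilon p q : normc (upsilon p q) = 1.
Proof. by rewrite /upsilon -/(cunit _) cunit_cos /normc cos2Dsin2 sqrtr1. Qed.

Lemma herm_Sw a (u v : W) : dot (Sw a u) (Sw a v) = dot u v.
Proof.
rewrite -(herm_translate symK xiE a 0 u v).
have R0 (w : W) : Rop tau K xi 0 (Sop a w) = Sw a w.
  by apply/funext => z; rewrite /Rop mult0 map_mx0 scaler0 addr0 invr1 mul1r.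
by rewrite !R0.
Qed.

Lemma herm_Rw b (u v : W) : dot (Rw symK b u) (Rw symK b v) = dot u v.
Proof.
rewrite -(herm_translate symK xiE 0 b u v).
have S0 (w : W) : Sop 0 w = w by apply/funext => z; rewrite /Sop map_mx0 addr0.
by rewrite !S0.
Qed.

(** Invariance under [S_a] gives [(c d^* - 1) (u, v) = 0], and [c d^* = 1 = d d^*] would force
    [c = d]. *)
Lemma herm_eigen_orthogonal a (c d : R[i]) (u v : W) : Sw a u = c *: u ->
  Sw a v = d *: v ->
  c != d -> normc d = 1 -> dot u v = 0.
Proof.
move=> Su Sv cd d1; have := herm_Sw a u v; rewrite Su Sv (hermZ symK xiE) => /eqP.
rewrite -subr_eq0 -[X in _ - X]mul1r -mulrBl mulf_eq0 => /orP[|/eqP //].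
have d0 : d != 0 by apply/eqP => dz; move/eqP: d1; rewrite dz normc0 eq_sym oner_eq0.
rewrite subr_eq0 -(unit_mul_conj d1) => /eqP h.
by move/eqP: cd; case; apply: mulIf h; rewrite conjc_eq0.
Qed.

Lemma herm_theta_orthogonal p q : p <> q -> dot (H p) (H q) = 0.
Proof.
move=> pq; have [a ha] := upsilon_separates symK posK pq.
apply: (herm_eigen_orthogonal (a := a) _ _ ha (normc_upsilon _ _)); exact: Sw_theta.
Qed.

Lemma herm_theta_norm p q : dot (H p) (H p) = dot (H q) (H q).
Proof.
have <- : Rw symK (repr (q - p)) (H p) = H q by rewrite Rw_theta clsK addrC subrK.
by move: (H p) => u; rewrite herm_Rw.
Qed.

End HeisenbergAction.

Theorem theorem4p7 (R : realType) (g : nat) (tau : R[i]) (K : 'M[int]_g)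
    (xi : 'cV[R[i]]_g) (a0 b0 : 'cV[R]_g)
    (tau_gt0 : 0 < complex.Im tau)
    (symK : K^T = K) (posK : posdefmx R K)
    (xiE : xi = tau *: a0%:mxC + b0%:mxC) :
  let W := Wspace tau K xi in
  let dot := herm tau K a0 in
  exists (rho : heisenberg symK posK -> {linear W -> W}) (H : Pi R K -> W),
  [/\ [/\ forall (a b : klat R K) (gam : gamma R K) (Phi : W),
            (rho (cls a, cls b, gam) Phi : _ -> _) =
              (gam : R[i]) *: Rop tau K xi b (Sop a Phi),
          representation rho,
          unitary_rep rho (fun Phi1 Phi2 : W => dot Phi1 Phi2)
        & irreducible_rep rho],
      [/\ has_dim W `|\det K|%N,
          forall (c : klat R K) z,
            H (cls c) z = theta c 0 (K%:mx[R[i]] *m z + xi) (Omega tau K)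
        & is_basis H],
      (forall (a b : klat R K) (c : Pi R K),
          Sop a (H c) = upsilon (cls a) c *: (H c : _ -> _) /\
          Rop tau K xi b (H c) = H (c + cls b))
    & (forall c1 c2 : Pi R K, c1 <> c2 ->
          dot (H c1) (H c2) = 0 /\ dot (H c1) (H c1) = dot (H c2) (H c2))].
Proof.
move=> W dot; exists (@heis_rep R g tau K xi symK posK),
  (theta_vec xi tau_gt0 symK posK).
split; [split|split| |].
- by move=> a b gam Phi; rewrite heis_repE.
- exact: heis_rep_representation.
- exact: heis_rep_unitary xiE.
- exact: heis_rep_irreducible.
- exact: W_has_dim.
- by move=> c z; rewrite theta_vecE.
- exact: theta_basis.
- move=> a b c; split.
    exact: (congr1 (@Wfun _ _ _ _ _) (Sw_theta xi tau_gt0 symK posK a c)).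
  exact: (congr1 (@Wfun _ _ _ _ _) (Rw_theta xi tau_gt0 symK posK b c)).
- move=> c1 c2 c12; split.
    exact: (herm_theta_orthogonal tau_gt0 symK posK xiE c12).
  exact: (herm_theta_norm tau_gt0 symK posK xiE).
Qed.
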